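(* Let $N\ge2$ and $3\le k\le d$ be integers and let $\gamma_L>0$ be given for every $L\subseteq[d]$ with $|L|=k$. Let $\Omega\subset\mathbb{R}^N$ be a bounded domain with $C^1$ boundary and let $\boldsymbol\psi=(\psi_1,\dots,\psi_d)$ be a nonnegative Lipschitz continuous function on $\overline\Omega$ such that $\prod_{j\in J}\psi_j\equiv0$ in $\overline\Omega$ for every $J\subseteq[d]$ with $|J|=k$. Let $\beta>0$ and let $f_{i,\beta}:\Omega\times\mathbb{R}\to\mathbb{R}$, $i=1,\dots,d$, be Carathéodory functions satisfying the growth condition (G) and the assumptions (A1) and (A2) of the context. Then the infimum $$c_{\beta,\boldsymbol f_\beta}:=\inf_{\mathbf u\in\mathcal U_{\boldsymbol\psi}}J_{\beta,\boldsymbol f_\beta}(\mathbf u,\Omega)$$ is achieved by at least one nonnegative minimizer. Similarly, if $f_i:\Omega\times\mathbb{R}\to\mathbb{R}$, $i=1,\dots,d$, are Carathéodory functions satisfying (G), (A1) and (A2), then the limit problem $$c_{\infty,\boldsymbol f}:=\inf_{\mathbf u\in\mathcal H_{\boldsymbol\psi}}J_{\infty,\boldsymbol f}(\mathbf u)$$ admits at least one nonnegative minimizer.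
   Context: Notation. $[d]=\{1,\dots,d\}$; $|J|$ is the cardinality of a set $J$ of indices. $2^*=2N/(N-2)$ if $N\ge3$, $2^*=+\infty$ if $N=2$; exponents $p$ are finite and $p\ge1$. For a Carathéodory function $f:\Omega\times\mathbb{R}\to\mathbb{R}$ put $F(x,u):=\int_0^uf(x,s)\,ds$ and consider: (G) there are $C>0$ and $p\le2^*$ with $|f(x,s)|\le C(1+|s|^{p-1})$ for a.e. $x\in\Omega$ and all $s\in\mathbb{R}$. (A1) $F(x,u)\ge F(x,-u)$ for a.e. $x\in\Omega$ and all $u\ge0$. (A2) There exist $b\in L^\infty(\Omega)$ and $C>0$ such that $F(x,u)\le\frac{b(x)}2u^2+Cu$ for a.e. $x\in\Omega$ and all $u\in[0,+\infty)$, and there exists $\varepsilon>0$ such that $\int_\Omega(|\nabla v|^2-b(x)v^2)\,dx\ge\varepsilon\int_\Omega|\nabla v|^2\,dx$ for all $v\in H^1_0(\Omega)$. Functionals and classes (with $F_{i,\beta}(x,u):=\int_0^uf_{i,\beta}(x,s)\,ds$ and $F_i(x,u):=\int_0^uf_i(x,s)\,ds$): $$J_{\beta,\boldsymbol f_\beta}(\mathbf u,\Omega):=\int_{\Omega}\Big(\frac12\sum_{i=1}^d|\nabla u_i|^2+\frac\beta2\sum_{\substack{J\subseteq[d]\\|J|=k}}\gamma_J\prod_{j\in J}u_j^2-\sum_{i=1}^dF_{i,\beta}(x,u_i(x))\Big)dx\in(-\infty,+\infty],$$ $$J_{\infty,\boldsymbol f}(\mathbf u):=\sum_{i=1}^d\int_\Omega\Big(\frac12|\nabla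 u_i|^2-F_i(x,u_i(x))\Big)dx,$$ $$\mathcal U_{\boldsymbol\psi}:=\{\mathbf u\in H^1(\Omega,\mathbb{R}^d):\ \mathbf u-\boldsymbol\psi\in H^1_0(\Omega,\mathbb{R}^d)\},$$ $$\mathcal H_{\boldsymbol\psi}:=\Big\{\mathbf u\in\mathcal U_{\boldsymbol\psi}:\ \prod_{j\in J}u_j\equiv0\text{ in }\Omega\text{ for every }J\subseteq[d],\ |J|=k\Big\}.$$ A vector function is nonnegative if all its components are. *)

(* Defs.v *)
From HB Require Import structures.
From mathcomp Require Import all_boot all_order all_algebra.
From mathcomp Require Import all_classical all_reals all_analysis.

Set Implicit Arguments.
Unset Strict Implicit.
Unset Printing Implicit Defensive.

Import Order.TTheory GRing.Theory Num.Theory.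
Import numFieldNormedType.Exports.

Local Open Scope classical_set_scope.
Local Open Scope ring_scope.

(** The product measure [lebesgue_measure \x mu] carried to [n.+1.-tuple R] by
    the bijection [(x, t) |-> x :: t]. *)
Section lebesgue_step.
Local Open Scope ereal_scope.
Context (R : realType) (n : nat).
Local Notation mR := (measurableTypeR R).
Variable mu : {sigma_finite_measure set (n.-tuple mR) -> \bar R}.

Definition tuple_cons (p : mR * n.-tuple mR) : n.+1.-tuple mR :=
  [the n.+1.-tuple mR of p.1 :: p.2].

Lemma measurable_tuple_cons : measurable_fun [set: mR * n.-tuple mR] tuple_cons.
Proof. exact: measurable_cons. Qed.

Definition lebesgue_step : set (n.+1.-tuple mR) -> \bar R :=
  pushforward (@lebesgue_measure R \x mu) tuple_cons.

Let lebesgue_step0 : lebesgue_step set0 = 0.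
Proof. by rewrite /lebesgue_step /pushforward preimage_set0 measure0. Qed.

Let lebesgue_step_ge0 A : 0 <= lebesgue_step A.
Proof. exact: (measure_ge0 (@lebesgue_measure R \x mu)). Qed.

Let lebesgue_step_sigma_additive : semi_sigma_additive lebesgue_step.
Proof.
move=> F mF tF mUF; rewrite /lebesgue_step /pushforward preimage_bigcup.
apply: measure_semi_sigma_additive.
- by move=> k; rewrite -[X in measurable X]setTI; exact: measurable_tuple_cons.
- apply/trivIsetP => /= i j _ _ ij; rewrite -preimage_setI.
  by move/trivIsetP : tF => /(_ _ _ _ _ ij) ->//; rewrite preimage_set0.
- rewrite -preimage_bigcup -[X in measurable X]setTI.
  exact: measurable_tuple_cons.
Qed.

HB.instance Definition _ := isMeasure.Build _ _ _ lebesgue_step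
  lebesgue_step0 lebesgue_step_ge0 lebesgue_step_sigma_additive.

(* Reproved because the library's sigma-finiteness instance for [\x] is shadowed
   by the one for pairs of subprobabilities. *)
Let lebesgue_step_sigma_finite : sigma_finite setT lebesgue_step.
Proof.
pose L : {sigma_finite_measure set mR -> \bar R} := @lebesgue_measure R.
have /sigma_finiteP[F [TF ndF Foo]] := sigma_finiteT L.
have /sigma_finiteP[G [TG ndG Goo]] := sigma_finiteT mu.
pose g (t : n.+1.-tuple mR) : mR * n.-tuple mR :=
  (tnth t ord0, [tuple of behead t]).
have mg : measurable_fun setT g.
  apply/measurable_fun_pairP; split; first exact: measurable_tnth.
  exact: measurable_behead.
have gK p : g (tuple_cons p) = p.
  by case: p => x t; congr pair; apply/val_inj.
exists (fun k => g @^-1` (F k `*` G k)).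
  rewrite -preimage_bigcup; apply/esym; rewrite -subTset => t _ /=.
  have [k1 _ Fk1] : (\bigcup_k F k) (g t).1 by rewrite -TF.
  have [k2 _ Gk2] : (\bigcup_k G k) (g t).2 by rewrite -TG.
  exists (maxn k1 k2) => //; split.
    by move: Fk1; exact/subsetPset/ndF/leq_maxl.
  by move: Gk2; exact/subsetPset/ndG/leq_maxr.
move=> k; have [mF Fk] := Foo k; have [mG Gk] := Goo k; split.
  by rewrite -[X in measurable X]setTI; apply: mg => //; exact: measurableX.
rewrite /lebesgue_step /pushforward (_ : _ @^-1` _ = F k `*` G k).
  by rewrite product_measure1E// lte_mul_pinfty// ge0_fin_numE.
by apply/funext => p; rewrite -[in RHS](gK p).
Qed.

HB.instance Definition _ := Measure_isSigmaFinite.Build _ _ _ lebesgue_step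
  lebesgue_step_sigma_finite.

End lebesgue_step.

(** The n-fold product of the one-dimensional Lebesgue measure, on the Borel
    sets of [n.-tuple R]. *)
Fixpoint lebesgue_tuple (R : realType) (n : nat) :
    {sigma_finite_measure set (n.-tuple (measurableTypeR R)) -> \bar R} :=
  if n is n'.+1 then lebesgue_step (lebesgue_tuple R n')
  else \d_([tuple] : 0.-tuple (measurableTypeR R)).

(** The Lebesgue outer measure on [R^n], seen as a set function on ['rV[R]_n]. *)
Section lebesgue_outer.
Local Open Scope ereal_scope.
Context (R : realType) (n : nat).

Definition row_of_tuple (t : n.-tuple (measurableTypeR R)) : 'rV[R]_n :=
  \row_i tnth t i.

Definition lebesgue_outer (A : set 'rV[R]_n) : \bar R :=
  mu_ext (lebesgue_tuple R n) (row_of_tuple @^-1` A).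

Let lebesgue_outer0 : lebesgue_outer set0 = 0.
Proof. by rewrite /lebesgue_outer preimage_set0 outer_measure0. Qed.

Let lebesgue_outer_ge0 A : 0 <= lebesgue_outer A.
Proof. exact: outer_measure_ge0. Qed.

Let le_lebesgue_outer : {homo lebesgue_outer : A B / A `<=` B >-> A <= B}.
Proof. by move=> A B AB; apply: le_outer_measure; exact: preimage_subset. Qed.

Let lebesgue_outer_sigma_subadditive : sigma_subadditive lebesgue_outer.
Proof.
by move=> F; rewrite /lebesgue_outer preimage_bigcup;
  exact: outer_measure_sigma_subadditive.
Qed.

HB.instance Definition _ := isOuterMeasure.Build R 'rV[R]_n lebesgue_outer
  lebesgue_outer0 lebesgue_outer_ge0 le_lebesgue_outer
  lebesgue_outer_sigma_subadditive.

End lebesgue_outer.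

(** [euclid R n] is ['rV[R]_n] with the Lebesgue (that is,
    Caratheodory-measurable) sigma-algebra; [lebesgue R n] is complete. *)
Definition euclid (R : realType) (n : nat) :=
  caratheodory_type (@lebesgue_outer R n).

HB.instance Definition _ (R : realType) (n : nat) :=
  Measurable.on (euclid R n).

Section lebesgue.
Local Open Scope ereal_scope.
Context (R : realType) (n : nat).

Definition lebesgue : set (euclid R n) -> \bar R := @lebesgue_outer R n.

Let lebesgue0 : lebesgue set0 = 0.
Proof. exact: outer_measure0. Qed.

Let lebesgue_ge0 A : 0 <= lebesgue A.
Proof. exact: outer_measure_ge0. Qed.

Let lebesgue_sigma_additive : semi_sigma_additive lebesgue.
Proof. exact: caratheodory_measure_sigma_additive. Qed.

HB.instance Definition _ := isMeasure.Build _ (euclid R n) R lebesgue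
  lebesgue0 lebesgue_ge0 lebesgue_sigma_additive.

End lebesgue.

Section sobolev.
Context (R : realType) (N : nat).
Local Notation V := 'rV[R]_N.
Local Notation mu := (@lebesgue R N).
Implicit Types (Omega : set V) (u v g phi : V -> R) (i : 'I_N).

Definition ae_on Omega (P : V -> Prop) : Prop :=
  {ae mu, forall x, Omega x -> P x}.

Definition measurable_on Omega u : Prop :=
  measurable_fun (Omega : set (euclid R N)) (u : euclid R N -> R).

Definition partial n (i : 'I_n) (h : 'rV[R]_n -> R) : 'rV[R]_n -> R :=
  'D_(delta_mx 0 i) h.

Definition C1 n (h : 'rV[R]_n -> R) : Prop :=
  forall i : 'I_n, (forall x, derivable h x (delta_mx 0 i)) /\
            continuous (partial i h).

Definition smooth phi : Prop :=
  forall s : seq 'I_N, let h := foldr (@partial N) phi s in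
    continuous h /\ forall i x, derivable h x (delta_mx 0 i).

Definition closed_support phi : set V := closure [set x | phi x != 0].

Definition test_function Omega phi : Prop :=
  [/\ smooth phi, compact (closed_support phi) & closed_support phi `<=` Omega].

Definition bounded_domain Omega : Prop :=
  [/\ open Omega, connected Omega, Omega !=set0 & bounded_set Omega].

(** Near each boundary point, [Omega] is the region strictly above the graph of
    a C^1 function of the other [N - 1] coordinates ([col' j x]), after choosing
    a coordinate axis [j] and an orientation [sg] of it. For open [Omega] the
    boundary is [closure Omega `\` Omega]. *)
Definition C1_boundary Omega : Prop :=
  forall x0, (closure Omega `\` Omega) x0 ->
    exists (j : 'I_N) (sg : bool) (h : 'rV[R]_N.-1 -> R), C1 h /\
      \forall x \near x0, Omega x <-> h (col' j x) < (-1) ^+ sg * x 0 j.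

(** Elements of the function spaces below are functions [V -> R], of which only
    the a.e. class on [Omega] matters. *)
Definition L2 Omega u : Prop :=
  measurable_on Omega u /\ (\int[mu]_(x in Omega) ((u x) ^+ 2)%:E < +oo)%E.

Definition Linfty Omega u : Prop :=
  measurable_on Omega u /\ exists M : R, ae_on Omega (fun x => `|u x| <= M).

Definition is_weak_partial Omega i u g : Prop :=
  forall phi, test_function Omega phi ->
    \int[mu]_(x in Omega) (u x * partial i phi x) =
    - \int[mu]_(x in Omega) (g x * phi x).

Definition H1 Omega u : Prop :=
  L2 Omega u /\ forall i, exists g, L2 Omega g /\ is_weak_partial Omega i u g.

(** A representative of the weak partial derivative, which is unique a.e. on
    [Omega]; the value is a dummy when [u] has no weak derivative in L^2. *)
Definition wpartial Omega i u : V -> R :=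
  xget (fun=> 0) [set g | L2 Omega g /\ is_weak_partial Omega i u g].

Definition grad_sq Omega u (x : V) : R := \sum_(i < N) (wpartial Omega i u x) ^+ 2.

Definition H1_norm_sq Omega u : \bar R :=
  \int[mu]_(x in Omega) ((u x) ^+ 2 + grad_sq Omega u x)%:E.

Definition H10 Omega u : Prop :=
  H1 Omega u /\ forall e : R, 0 < e ->
    exists2 phi, test_function Omega phi &
      (H1_norm_sq Omega (fun x => (u x - phi x)%R) < e%:E)%E.

End sobolev.

Section nonlinearities.
Context (R : realType) (N : nat) (Omega : set 'rV[R]_N).
Local Notation mu := (@lebesgue R N).
Implicit Type f : 'rV[R]_N -> R -> R.

Definition caratheodory_fun f : Prop :=
  (forall s, measurable_on Omega (f ^~ s)) /\
  ae_on Omega (fun x => continuous (f x)).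

Definition primitive f (x : 'rV[R]_N) (t : R) : R :=
  if 0 <= t then \int[lebesgue_measure]_(s in `[0, t]) f x s
  else - \int[lebesgue_measure]_(s in `[t, 0]) f x s.

Definition crit_exponent : \bar R :=
  if (3 <= N)%N then (2 * N%:R / (N%:R - 2))%:E else +oo%E.

Definition condG f : Prop :=
  exists C p : R, [/\ 0 < C, 1 <= p, (p%:E <= crit_exponent)%E &
    ae_on Omega (fun x => forall s, `|f x s| <= C * (1 + `|s| `^ (p - 1)))].

Definition condA1 f : Prop :=
  ae_on Omega (fun x => forall t, 0 <= t -> primitive f x (- t) <= primitive f x t).

Definition condA2 f : Prop :=
  exists b : 'rV[R]_N -> R, Linfty Omega b /\
  (exists C : R, 0 < C /\
    ae_on Omega (fun x => forall t, 0 <= t ->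
      primitive f x t <= b x / 2 * t ^+ 2 + C * t)) /\
  (exists e : R, 0 < e /\ forall v, H10 Omega v ->
    e * \int[mu]_(x in Omega) grad_sq Omega v x <=
    \int[mu]_(x in Omega) (grad_sq Omega v x - b x * (v x) ^+ 2)).

End nonlinearities.

Section functionals.
Context (R : realType) (N d : nat) (Omega : set 'rV[R]_N).
Local Notation mu := (@lebesgue R N).
Implicit Types (u psi : 'I_d -> 'rV[R]_N -> R) (f : 'I_d -> 'rV[R]_N -> R -> R).

Definition J_beta k (gamma : {set 'I_d} -> R) (beta : R) f u : \bar R :=
  \int[mu]_(x in Omega)
    (2^-1 * (\sum_(i < d) grad_sq Omega (u i) x)
     + beta / 2 * (\sum_(J : {set 'I_d} | #|J| == k)
                     gamma J * \prod_(j in J) (u j x) ^+ 2)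
     - \sum_(i < d) primitive (f i) x (u i x))%:E.

Definition J_infty f u : \bar R :=
  (\sum_(i < d) \int[mu]_(x in Omega)
    (2^-1 * grad_sq Omega (u i) x - primitive (f i) x (u i x))%:E)%E.

Definition U_class psi u : Prop :=
  forall i, H1 Omega (u i) /\ H10 Omega (fun x => u i x - psi i x).

Definition H_class k psi u : Prop :=
  U_class psi u /\ forall J : {set 'I_d}, #|J| = k ->
    ae_on Omega (fun x => \prod_(j in J) u j x = 0).

Definition nonnegative u : Prop := forall i, ae_on Omega (fun x => 0 <= u i x).

End functionals.

(* Main.v *)
Require Import Defs.
From HB Require Import structures.
From mathcomp Require Import all_boot all_order all_algebra.
From mathcomp Require Import all_classical all_reals all_analysis.
From mathcomp Require Import measurable_realfun.
From mathcomp Require Import ring lra.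

Set Implicit Arguments.
Unset Strict Implicit.
Unset Printing Implicit Defensive.

Import Order.TTheory GRing.Theory Num.Theory.
Import numFieldNormedType.Exports.

Local Open Scope classical_set_scope.
Local Open Scope ring_scope.

(** Write F_i(x,t) = b_i(x)/2 t^2 + C_i |t| - r_i(x,t): by (A1) the bound of (A2)
    holds for every real t, so r_i >= 0 almost everywhere. Each functional is then
    the sum of a finite energy, the quadratic form of (A2) minus a linear term, and
    the integral of a nonnegative function, continuous in the values of u; the
    coupling is part of the latter, with coefficient beta/2 or 0. By (A2) and
    Poincare's inequality the energy is coercive in u - psi, so a minimising
    sequence is bounded in H^1; by Rellich's theorem a subsequence converges in L^2
    and almost everywhere, the gradient norms are lower semicontinuous, and Fatou's
    lemma handles the nonnegative part. The product constraints pass to almost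
    everywhere limits. Replacing u by |u| preserves the
    class and, by (A1), does not increase the functional.

    Weak derivatives are accessed through difference quotients tested against
    smooth functions and Riesz representation, which gives |u| and Lipschitz
    functions in H^1 without chain rule. Membership in H^1_0 is obtained from
    L^2-approximation by test functions with bounded gradients: near-minimisers of
    the Dirichlet energy among the test functions close to the limit form a Cauchy
    sequence by the parallelogram law. Rellich's theorem follows by mollification,
    the mollified sequences being equi-Lipschitz. *)

(** * Square integrable functions *)

(** The integrand of the functional has no sign, and the coupling may have infinite integral.
    Subtracting the bound of (A2) leaves signed terms that are finite and either quadratic in the
    gradient or continuous in L^2, plus a nonnegative rest that may integrate to +oo. The form
    inequality of (A2) is stated on H^1_0 only, so coercivity is expanded around psi and the mixed
    terms are absorbed by Young's inequality. The gradient of the statement is an arbitrary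
    representative, so functions are compared through the L^2 norms of each partial derivative.
    Bounds by duality and bounds on translations are converted into each other: this is how |u|
    inherits the gradient bounds of u. The delicate point for |u| is its boundary value: |u| - psi
    must lie in H^1_0. If a test function phi approximates u - psi, then |psi + phi| - psi is
    Lipschitz and, psi being nonnegative, vanishes wherever phi does; mollification puts it in
    H^1_0, with gradient norms controlled by those of psi and phi. *)

Section square_integrable.
Context d (T : measurableType d) (R : realType).
Variables (mu : {measure set T -> \bar R}) (D : set T) (mD : measurable D).
Implicit Types (u v w : T -> R) (a : R).

(** For the Lebesgue measure this unfolds to [L2]; the abstract measure serves [Omega], its open
    subsets and the whole space alike. *)
Definition sqint u : Prop :=
  measurable_fun D u /\ (\int[mu]_(x in D) ((u x) ^+ 2)%:E < +oo)%E.

(** The real integral is 0 when the extended one is infinite; this is why the algebraic rules below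
    ask for square integrability. *)
Definition ip u v : R := \int[mu]_(x in D) (u x * v x).

Definition nrm u : R := Num.sqrt (ip u u).

Lemma sqint_integrable_sqr u : sqint u ->
  mu.-integrable D (EFin \o (fun x => u x ^+ 2)).
Proof.
move=> [mu_ iu]; apply/integrableP; split.
  by apply/measurable_EFinP; exact: measurable_funX.
rewrite (eq_integral (fun x => ((u x) ^+ 2)%:E))// => x _ /=.
by rewrite ger0_norm// sqr_ge0.
Qed.

Lemma integrable_sqr_sqint u : measurable_fun D u ->
  mu.-integrable D (EFin \o (fun x => u x ^+ 2)) -> sqint u.
Proof.
move=> mu_ /integrableP[_ h]; split => //; move: h.
rewrite (eq_integral (fun x => ((u x) ^+ 2)%:E))// => x _ /=.
by rewrite ger0_norm// sqr_ge0.
Qed.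

Lemma sqint_mul_integrable u v : sqint u -> sqint v ->
  mu.-integrable D (EFin \o (fun x => u x * v x)).
Proof.
move=> su sv; have [mu_ _] := su; have [mv _] := sv.
have := integrableD mD (sqint_integrable_sqr su) (sqint_integrable_sqr sv).
apply: le_integrable => //.
  by apply/measurable_EFinP; exact: measurable_funM.
move=> x _ /=; rewrite lee_fin (@ger0_norm _ (_ + _)) ?addr_ge0 ?sqr_ge0//.
rewrite normrM -(real_normK (num_real (u x))) -(real_normK (num_real (v x))).
have := sqr_ge0 (`|u x| - `|v x|); have := normr_ge0 (u x).
have := normr_ge0 (v x); nra.
Qed.

Lemma le_sqint u v : measurable_fun D u -> sqint v ->
  (forall x, D x -> `|u x| <= `|v x|) -> sqint u.
Proof.
move=> mu_ sv uv; apply: integrable_sqr_sqint => //.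
apply: le_integrable (sqint_integrable_sqr sv) => //.
  by apply/measurable_EFinP; exact: measurable_funX.
move=> x Dx /=; rewrite lee_fin !normrX; apply: lerXn2r; rewrite ?nnegrE//.
exact: uv.
Qed.

Lemma sqintD u v : sqint u -> sqint v -> sqint (fun x => u x + v x).
Proof.
move=> su sv; have [mu_ _] := su; have [mv _] := sv.
have muv : measurable_fun D (fun x => u x + v x) by exact: measurable_funD.
apply: integrable_sqr_sqint => //.
have uv := sqint_mul_integrable su sv.
have := integrableD mD (integrableD mD (sqint_integrable_sqr su) uv)
  (integrableD mD uv (sqint_integrable_sqr sv)).
apply: eq_integrable => // x _ /=; rewrite -!EFinD; congr EFin; ring.
Qed.

Lemma sqintZ a u : sqint u -> sqint (fun x => a * u x).
Proof.
move=> su; have [mu_ _] := su; apply: integrable_sqr_sqint.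
  exact: measurable_funM.
have := integrableZl mD (a ^+ 2) (sqint_integrable_sqr su).
by apply: eq_integrable => // x _ /=; rewrite -EFinM exprMn.
Qed.

Lemma sqintN u : sqint u -> sqint (fun x => - u x).
Proof. by move=> /(sqintZ (-1)); under eq_fun do rewrite mulN1r. Qed.

Lemma sqintB u v : sqint u -> sqint v -> sqint (fun x => u x - v x).
Proof. by move=> su sv; exact: (sqintD su (sqintN sv)). Qed.

Lemma sqint0 : sqint (fun=> 0).
Proof.
split; first exact: measurable_cst.
by under eq_integral do rewrite expr0n; rewrite integral0 ltry.
Qed.

Lemma sqint_norm u : sqint u -> sqint (fun x => `|u x|).
Proof.
move=> su; have [mu_ _] := su; apply: (le_sqint _ su).
  exact: measurableT_comp.
by move=> x _; rewrite normr_id.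
Qed.

Lemma bounded_sqint u a : (mu D < +oo)%E -> measurable_fun D u ->
  (forall x, D x -> `|u x| <= a) -> sqint u.
Proof.
move=> muD mu_ ua; apply: (@le_sqint _ (cst a)) => //; last first.
  by move=> x /ua; move=> /le_trans; apply; exact: ler_norm.
apply: integrable_sqr_sqint => //.
apply/integrableP; split.
  by apply/measurable_EFinP; apply: measurable_funX; exact: measurable_cst.
rewrite (eq_integral (cst (`|a ^+ 2|%:E)))// integral_cst// lte_mul_pinfty//.
Qed.

Lemma ipC u v : ip u v = ip v u.
Proof. by rewrite /ip; under eq_Rintegral do rewrite mulrC. Qed.

Lemma ipDl u v w : sqint u -> sqint v -> sqint w ->
  ip (fun x => u x + v x) w = ip u w + ip v w.
Proof.
move=> su sv sw; rewrite /ip -RintegralD//; last 2 first.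
- exact: sqint_mul_integrable.
- exact: sqint_mul_integrable.
by under eq_Rintegral do rewrite mulrDl.
Qed.

Lemma ipZl a u w : sqint u -> sqint w ->
  ip (fun x => a * u x) w = a * ip u w.
Proof.
move=> su sw; rewrite /ip -RintegralZl//; last exact: sqint_mul_integrable.
by under eq_Rintegral do rewrite -mulrA.
Qed.

Lemma ipNl u w : sqint u -> sqint w -> ip (fun x => - u x) w = - ip u w.
Proof.
by move=> su sw; rewrite -mulN1r -ipZl//; under eq_fun do rewrite -mulN1r.
Qed.

Lemma ipBl u v w : sqint u -> sqint v -> sqint w ->
  ip (fun x => u x - v x) w = ip u w - ip v w.
Proof. by move=> su sv sw; rewrite ipDl ?ipNl//; exact: sqintN. Qed.

Lemma ipDr u v w : sqint u -> sqint v -> sqint w ->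
  ip w (fun x => u x + v x) = ip w u + ip w v.
Proof. by move=> su sv sw; rewrite ipC ipDl// !(ipC w). Qed.

Lemma ipZr a u w : sqint u -> sqint w ->
  ip w (fun x => a * u x) = a * ip w u.
Proof. by move=> su sw; rewrite ipC ipZl// ipC. Qed.

Lemma ipBr u v w : sqint u -> sqint v -> sqint w ->
  ip w (fun x => u x - v x) = ip w u - ip w v.
Proof. by move=> su sv sw; rewrite ipC ipBl// !(ipC w). Qed.

Lemma ip_ge0 u : 0 <= ip u u.
Proof. by apply: Rintegral_ge0 => x _; rewrite -expr2 sqr_ge0. Qed.

Lemma ipE u : sqint u -> (ip u u)%:E = (\int[mu]_(x in D) ((u x) ^+ 2)%:E)%E.
Proof.
move=> su; rewrite /ip /Rintegral fineK; first exact: eq_integral.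
exact/integrable_fin_num/sqint_mul_integrable.
Qed.

Lemma ae_eq_ip u u' v v' : sqint u -> sqint u' -> sqint v -> sqint v' ->
  {ae mu, forall x, D x -> u x = u' x} ->
  {ae mu, forall x, D x -> v x = v' x} -> ip u v = ip u' v'.
Proof.
move=> su su' sv sv' uu vv; rewrite /ip /Rintegral; congr fine.
apply: ae_eq_integral => //.
- by have /integrableP[] := sqint_mul_integrable su sv.
- by have /integrableP[] := sqint_mul_integrable su' sv'.
by apply: filterS2 uu vv => x h1 h2 Dx; rewrite h1// h2.
Qed.

Lemma nrm_ge0 u : 0 <= nrm u. Proof. exact: sqrtr_ge0. Qed.

Lemma sqr_nrm u : nrm u ^+ 2 = ip u u.
Proof. by rewrite sqr_sqrtr// ip_ge0. Qed.

Lemma cauchy_schwarz u v : sqint u -> sqint v -> `|ip u v| <= nrm u * nrm v.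
Proof.
move=> su sv.
have poly t : 0 <= ip u u + 2 * t * ip u v + t ^+ 2 * ip v v.
  have := ip_ge0 (fun x => u x + t * v x).
  have stv := sqintZ t sv; have suv := sqintD su stv.
  rewrite ipDl// !ipDr// !ipZl// !ipZr// (ipC v u); nra.
suff : (ip u v) ^+ 2 <= ip u u * ip v v.
  move=> h; rewrite -(@ler_pXn2r _ 2)// ?nnegrE ?mulr_ge0 ?nrm_ge0//.
  by rewrite exprMn !sqr_nrm real_normK// num_real.
have := ip_ge0 v; rewrite le_eqVlt => /orP[/eqP v0|v0]; last first.
  have := poly (- (ip u v / ip v v)).
  have -> : ip u u + 2 * - (ip u v / ip v v) * ip u v +
    (- (ip u v / ip v v)) ^+ 2 * ip v v = ip u u - (ip u v)^+2 / ip v v.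
    field; lra.
  by rewrite subr_ge0 ler_pdivrMr.
(* When (v, v) = 0 the polynomial is affine in t; unless (u, v) = 0, the t chosen below gives it the
   value -1. *)
rewrite -v0 mulr0; case: (eqVneq (ip u v) 0) => [->|uv0]; first by rewrite expr0n.
have := poly (- (ip u u + 1) / (2 * ip u v)); rewrite -v0 mulr0 addr0.
have -> : ip u u + 2 * (- (ip u u + 1) / (2 * ip u v)) * ip u v = -1.
  by field.
lra.
Qed.

Lemma le_ip_nrm u v : sqint u -> sqint v -> ip u v <= nrm u * nrm v.
Proof. by move=> su sv; apply: le_trans (ler_norm _) (cauchy_schwarz su sv). Qed.

Lemma nrmD u v : sqint u -> sqint v -> nrm (fun x => u x + v x) <= nrm u + nrm v.
Proof.
move=> su sv; have suv := sqintD su sv.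
rewrite -(@ler_pXn2r _ 2)// ?nnegrE ?addr_ge0 ?nrm_ge0//.
rewrite sqr_nrm sqrrD !sqr_nrm ipDl// !ipDr// (ipC v u).
have := le_ip_nrm su sv; lra.
Qed.

Lemma nrmZ a u : sqint u -> nrm (fun x => a * u x) = `|a| * nrm u.
Proof.
move=> su; rewrite /nrm ipZl ?ipZr//; last exact: sqintZ.
by rewrite mulrA -expr2 sqrtrM ?sqr_ge0// sqrtr_sqr.
Qed.

Lemma nrmN u : nrm (fun x => - u x) = nrm u.
Proof. by rewrite /nrm /ip; under eq_Rintegral do rewrite mulrNN. Qed.

Lemma nrmB u v : sqint u -> sqint v -> nrm (fun x => u x - v x) <= nrm u + nrm v.
Proof.
by move=> su sv; rewrite -(nrmN v); exact: (nrmD su (sqintN sv)).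
Qed.

Lemma nrm_subC u v : nrm (fun x => u x - v x) = nrm (fun x => v x - u x).
Proof. by rewrite -nrmN; under eq_fun do rewrite opprB. Qed.

Lemma nrm_triangle v u w : sqint u -> sqint v -> sqint w ->
  nrm (fun x => u x - w x) <= nrm (fun x => u x - v x) + nrm (fun x => v x - w x).
Proof.
move=> su sv sw; have := nrmD (sqintB su sv) (sqintB sv sw).
by under eq_fun do rewrite addrA subrK.
Qed.

Lemma nrm_dist u v : sqint u -> sqint v ->
  `|nrm u - nrm v| <= nrm (fun x => u x - v x).
Proof.
move=> su sv; have h1 : nrm u <= nrm (fun x => u x - v x) + nrm v.
  by have := nrmD (sqintB su sv) sv; under eq_fun do rewrite subrK.
have : nrm v <= nrm (fun x => v x - u x) + nrm u.
  by have := nrmD (sqintB sv su) su; under eq_fun do rewrite subrK.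
move: h1; rewrite (nrm_subC v u) ler_norml => h1 h2; apply/andP; split; lra.
Qed.

Lemma le_nrm u v : sqint u -> sqint v ->
  (forall x, D x -> `|u x| <= `|v x|) -> nrm u <= nrm v.
Proof.
move=> su sv uv; rewrite ler_wsqrtr// le_Rintegral//.
- exact: sqint_mul_integrable.
- exact: sqint_mul_integrable.
- move=> x Dx; rewrite -!expr2 -(real_normK (num_real (u x))).
  rewrite -(real_normK (num_real (v x))) lerXn2r ?nnegrE//; exact: uv.
Qed.

Lemma nrm_bounded u a : 0 <= a -> (mu D < +oo)%E -> measurable_fun D u ->
  (forall x, D x -> `|u x| <= a) -> nrm u <= a * Num.sqrt (fine (mu D)).
Proof.
move=> a0 muD mu_ ua; have sa : sqint (cst a).
  by apply: (@bounded_sqint _ a) => // x _; rewrite ger0_norm.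
apply: le_trans (le_nrm (bounded_sqint muD mu_ ua) sa _) _.
  by move=> x Dx /=; rewrite (ger0_norm a0) ua.
rewrite /nrm (_ : ip _ _ = a ^+ 2 * fine (mu D)); last first.
  rewrite -(Rintegral_cst _ mD); apply: eq_Rintegral => x _; by rewrite expr2.
rewrite -{2}(ger0_norm a0) -sqrtr_sqr -sqrtrM ?sqr_ge0//.
Qed.

End square_integrable.

Lemma inv_natS_lt (R : realType) (e : R) : 0 < e -> exists n : nat, n.+1%:R^-1 < e.
Proof. by move=> /ltr_add_invr[n]; rewrite add0r => ?; exists n. Qed.

(** * Extraction of subsequences *)

Section diagonal.
Variable R : realType.

(* Tychonoff's theorem in the product topology replaces the diagonal argument. *)
Lemma diagonal_extraction (a : nat -> nat -> R) (B : nat -> R) :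
  (forall n i, `|a n i| <= B i) ->
  exists s : nat -> nat, (forall n, (s n < s n.+1)%N) /\
    forall i, cvgn (fun n => a (s n) i).
Proof.
move=> aB.
pose P : topologicalType := prod_topology (fun _ : nat => (R : topologicalType)).
pose K : set P := [set f | forall i, `[- B i, B i]%classic (f i)].
have cK : compact K.
  apply: (@tychonoff nat (fun=> R : topologicalType)
    (fun i => `[- B i, B i]%classic)) => i; exact: segment_compact.
have [p [_ clp]] : exists p : P, K p /\ cluster ((a : nat -> P) @ \oo) p.
  have [|p [Kp cp]] := cK ((a : nat -> P) @ \oo) _.
  - by exists 0%N => // n _ i /=; rewrite in_itv/= -ler_norml.
  - by exists p.
(* A cluster point is approached by indices beyond any [m], and a neighbourhood in the product
   topology may constrain finitely many coordinates at once. *)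
have step k m : exists n, (m < n)%N /\
    forall i, (i <= k)%N -> `|a n i - p i| < k.+1%:R^-1.
  have nb : nbhs p [set f : P | forall i, (i <= k)%N -> `|f i - p i| < k.+1%:R^-1].
    have : \forall f \near p, forall i : 'I_k.+1, ball (p i) k.+1%:R^-1 ((f : P) i).
      have e0 : 0 < k.+1%:R^-1 :> R by rewrite invr_gt0.
      pose S (i : 'I_k.+1) : set P := [set f | ball (p i) k.+1%:R^-1 (f i)].
      have Si i : nbhs p (S i).
        exact: (@proj_continuous nat (fun=> R) i p _ (nbhsx_ballx (p i) _ e0)).
      exact: (@filter_forall P _ S (nbhs p) (nbhs_filter p) Si).
    apply: filterS => f fp i; rewrite -ltnS => ik.
    by have := fp (Ordinal ik); rewrite /ball /= distrC.
  have [f [/= [n] mn <- ]] := clp _ _ (ex_intro2 _ _ m.+1 I (fun n (h : (m < n)%N) =>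
      ex_intro2 _ _ n h (erefl _)) : ((a : nat -> P) @ \oo) (a @` [set n | (m < n)%N])) nb.
  by exists n.
have [g gP] := choice (fun km : nat * nat => step km.1 km.2).
pose s := fix s n := if n is n'.+1 then g (n, s n') else g (0%N, 0%N).
exists s; split=> [n|i]; first by rewrite /=; have [] := gP (n.+1, s n).
have sP n : (i <= n)%N -> `|a (s n) i - p i| < n.+1%:R^-1.
  by case: n => [|n]; [have [_] := gP (0%N, 0%N)|have [_] := gP (n.+1, s n)]; apply.
apply/cvg_ex; exists (p i); apply/cvgrPdist_lt => e e0.
have [k ke] := inv_natS_lt e0.
near=> n; have : (maxn i k <= n)%N by near: n; exact: nbhs_infty_ge.
rewrite geq_max => /andP[ni nk].
have := sP n ni; rewrite distrC => /lt_le_trans; apply; apply: le_trans (ltW ke).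
by rewrite lef_pV2 ?posrE// ler_nat.
Unshelve. all: by end_near. Qed.

End diagonal.

(** * Fatou's lemma and completeness of L^2 *)

Section completeness.
Context d (T : measurableType d) (R : realType).
Variables (mu : {measure set T -> \bar R}) (D : set T) (mD : measurable D).
Local Notation sqint := (sqint mu D).
Local Notation ip := (ip mu D).
Local Notation nrm := (nrm mu D).

(** Cutting every function off on one null set makes sign and convergence hold everywhere on [D], so
    the pointwise form of Fatou's lemma applies. *)
Lemma ae_fatou (h : nat -> T -> R) (g : T -> R) (c : \bar R) :
  (forall n, measurable_fun D (h n)) -> measurable_fun D g ->
  {ae mu, forall x, D x -> (forall n, 0 <= h n x) /\ h n x @[n --> \oo] --> g x} ->
  (\forall n \near \oo, (\int[mu]_(x in D) (h n x)%:E <= c)%E) ->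
  (\int[mu]_(x in D) (g x)%:E <= c)%E.
Proof.
move=> mh mg [N [mN N0 subN]] hc.
have goodN x : D x -> ~ N x -> (forall n, 0 <= h n x) /\ h n x @[n --> \oo] --> g x.
  by move=> Dx Nx; apply: contrapT => bad; apply: Nx; apply: subN => /= /(_ Dx).
have aeN (f : T -> R) : measurable_fun D f ->
    (\int[mu]_(x in D) (f x)%:E = \int[mu]_(x in D) ((f \_ (~` N)) x)%:E)%E.
  move=> mf; apply: ae_eq_integral => //.
  - exact/measurable_EFinP.
  - apply/measurable_EFinP/measurable_restrict => //; first exact: measurableC.
    by apply: measurable_funS mf => // x [].
  - exists N; split=> // x /= /not_implyP[Dx]; apply: contra_notP => Nx.
    by rewrite patchE mem_set.
rewrite aeN//.
have cvx x : D x -> ((h n \_ (~` N)) x)%:E @[n --> \oo] --> ((g \_ (~` N)) x)%:E.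
  move=> Dx; apply: cvg_EFin; first exact: nearW.
  have [xN|xN] := pselect (N x).
    rewrite [X in _ --> X]patchE memNset; last exact.
    rewrite [X in X @ _ --> _](_ : _ = fun=> 0); first exact: cvg_cst.
    by apply/funext => n /=; rewrite patchE memNset//=.
  have [_ cg] := goodN _ Dx xN.
  rewrite [X in _ --> X]patchE mem_set//.
  rewrite [X in X @ _ --> _](_ : _ = h ^~ x)//.
  by apply/funext => n /=; rewrite patchE mem_set.
have := fatou mu mD (f := fun n x => ((h n \_ (~` N)) x)%:E).
rewrite (eq_integral (fun x => ((g \_ (~` N)) x)%:E)); last first.
  move=> x /set_mem Dx; rewrite is_cvg_limn_einfE; last first.
    by apply/cvg_ex; eexists; exact: cvx.
  by apply/cvg_lim => //; exact: cvx.
move=> fat; apply: le_trans (fat _ _) _.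
- move=> n; apply/measurable_EFinP/measurable_restrict => //.
    exact: measurableC.
  by apply: measurable_funS (mh n) => // x [].
- move=> n x Dx; rewrite lee_fin patchE; case: ifPn => //.
  by rewrite inE => Nx; have [] := goodN _ Dx Nx.
rewrite limn_einf_lim; apply: lime_le; first exact: is_cvg_einfs.
(* The bound is only eventual: each tail infimum is compared with the term of index [maxn n n0]. *)
have [n0 _ n0c] := hc; apply: nearW => n.
apply: le_trans (n0c (maxn n n0) _); last by rewrite /= leq_maxr.
apply: ereal_inf_lbound; exists (maxn n n0); first by rewrite /= leq_maxl.
by rewrite aeN.
Unshelve. all: by end_near. Qed.

Lemma nrm_fatou (w : nat -> T -> R) (v : T -> R) (C : R) : 0 <= C ->
  (forall n, sqint (w n)) -> measurable_fun D v ->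
  {ae mu, forall x, D x -> w n x @[n --> \oo] --> v x} ->
  (\forall n \near \oo, nrm (w n) <= C) -> sqint v /\ nrm v <= C.
Proof.
move=> C0 sw mv wv wC.
have le : (\int[mu]_(x in D) ((v x) ^+ 2)%:E <= (C ^+ 2)%:E)%E.
  apply: (@ae_fatou (fun n x => w n x ^+ 2)).
  - by move=> n; apply: measurable_funX; have [] := sw n.
  - exact: measurable_funX.
  - apply: filterS wv => x wvx Dx; split; first by move=> n; exact: sqr_ge0.
    rewrite expr2 (_ : (fun n => _) = w ^~ x \* w ^~ x).
      exact: cvgM (wvx Dx) (wvx Dx).
    by apply/funext => n; rewrite expr2.
  apply: filterS wC => n wnC; rewrite -ipE// lee_fin -sqr_nrm.
  by rewrite lerXn2r ?nnegrE ?nrm_ge0.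
have sv : sqint v by split => //; apply: le_lt_trans le _; rewrite ltry.
split=> //; rewrite -(@ler_pXn2r _ 2)// ?nnegrE ?nrm_ge0//.
by rewrite sqr_nrm -lee_fin ipE.
Qed.

(** The increments are at most sqrt C / 2^n, hence summable. *)
Lemma geo_le_bounded_cvg (a : nat -> R) (C : R) :
  (forall n, 4 ^+ n * (a n.+1 - a n) ^+ 2 <= C) -> cvgn a.
Proof.
move=> aC.
have C0 : 0 <= C by apply: le_trans (aC 0%N); rewrite mulr_ge0// sqr_ge0.
have le n : `|a n.+1 - a n| <= Num.sqrt C * 2^-1 ^+ n.
  rewrite -(@ler_pXn2r _ 2)// ?nnegrE ?mulr_ge0 ?sqrtr_ge0//.
  rewrite exprMn sqr_sqrtr// real_normK ?num_real// -exprM mulnC exprM.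
  have -> : (2^-1 ^+ 2 : R) = 4^-1 by rewrite exprVn; congr (_^-1); lra.
  by rewrite exprVn ler_pdivlMr ?exprn_gt0// mulrC.
have : cvgn (series (fun n => a n.+1 - a n)).
  apply: normed_cvg.
  apply: (@series_le_cvg _ _ (geometric (Num.sqrt C) 2^-1)) => //.
  - by move=> n /=.
  - by move=> n; rewrite mulr_ge0 ?sqrtr_ge0// exprn_ge0 ?invr_ge0.
  - apply: is_cvg_geometric_series; rewrite ger0_norm ?invr_ge0//; lra.
move=> /cvg_ex[l hl]; apply/cvg_ex; exists (l + a 0%N).
rewrite [X in X @ _ --> _](_ : _ =
    (fun n => series (fun n => a n.+1 - a n) n + a 0%N)); last first.
  by apply/funext => n; rewrite /series /= telescope_sumr// subrK.
by apply: cvgD hl _; exact: cvg_cst.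
Qed.

(** Riesz-Fischer. Weighted squares of the increments are summed instead of their absolute values,
    so only monotone integration of series is used, and no Minkowski inequality for infinite
    sums. *)
Lemma sqint_complete (u : nat -> T -> R) : (forall n, sqint (u n)) ->
  (forall e : R, 0 < e -> exists n0, forall n m, (n0 <= n)%N -> (n0 <= m)%N ->
     nrm (fun x => u n x - u m x) < e) ->
  exists v, [/\ sqint v,
    nrm (fun x => u n x - v x) @[n --> \oo] --> 0 &
    exists s : nat -> nat, (forall n, (s n < s n.+1)%N) /\
      {ae mu, forall x, D x -> u (s n) x @[n --> \oo] --> v x}].
Proof.
move=> su cu.
have /choice[N NP] : forall k : nat, exists n0, forall n m, (n0 <= n)%N ->
    (n0 <= m)%N -> nrm (fun x => u n x - u m x) < 4^-1 ^+ k.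
  by move=> k; apply: cu; rewrite exprn_gt0// invr_gt0.
pose s := fix s n := if n is n'.+1 then maxn (s n').+1 (N n) else N 0%N.
have s_incr n : (s n < s n.+1)%N by rewrite /= leq_maxl.
have Ns k : (N k <= s k)%N by case: k => //= k; rewrite leq_maxr.
(* The norm of the increment is at most 4^-k, so this has integral at most 4^k (4^-k)^2 = 4^-k,
   which is summable; where the sum is finite, [geo_le_bounded_cvg] gives convergence. *)
pose g k x := 4 ^+ k * (u (s k.+1) x - u (s k) x) ^+ 2.
have sd k : sqint (fun x => u (s k.+1) x - u (s k) x) by exact: sqintB.
have mg k : measurable_fun D (EFin \o g k).
  apply/measurable_EFinP/measurable_funM; first exact: measurable_cst.
  by apply: measurable_funX; have [] := sd k.
have g0 k x : (0 <= (g k x)%:E)%E.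
  by rewrite lee_fin mulr_ge0 ?sqr_ge0 ?exprn_ge0.
have ig k : (\int[mu]_(x in D) (g k x)%:E <= (4^-1 ^+ k)%:E)%E.
  rewrite /g; under eq_integral do rewrite EFinM.
  have [msd _] := sd k; rewrite ge0_integralZl//; last 2 first.
  - exact/measurable_EFinP/measurable_funX.
  - by move=> x _; rewrite lee_fin sqr_ge0.
  rewrite -ipE// -EFinM lee_fin -sqr_nrm.
  have : nrm (fun x => u (s k.+1) x - u (s k) x) <= 4^-1 ^+ k.
    by apply/ltW/NP => //; apply: leq_trans (Ns k) _; exact/ltnW.
  move=> h; have : nrm (fun x => u (s k.+1) x - u (s k) x) ^+ 2 <= (4^-1 ^+ k) ^+ 2.
    by rewrite lerXn2r ?nnegrE ?nrm_ge0 ?exprn_ge0 ?invr_ge0.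
  move=> /(ler_wpM2l (exprn_ge0 k (ler0n R 4))) /le_trans; apply.
  by rewrite expr2 mulrA -exprMn divff ?expr1n ?mul1r// pnatr_eq0.
pose G x := (\sum_(0 <= k <oo) (g k x)%:E)%E.
have mG : measurable_fun D G.
  by apply: ge0_emeasurable_sum => [k x Dx _|k _]; [exact: g0|exact: mg].
have iG : (\int[mu]_(x in D) G x < +oo)%E.
  rewrite integral_nneseries//.
  apply: (@le_lt_trans _ _ (\sum_(0 <= k <oo) (4^-1 ^+ k)%:E)%E).
    by apply: lee_nneseries => [k _ _|k _]; [exact: integral_ge0|exact: ig].
  have cg : cvgn (series (geometric (1 : R) 4^-1)).
    by apply: is_cvg_geometric_series; rewrite ger0_norm ?invr_ge0//; lra.
  have -> : (fun n => (\sum_(0 <= k < n) (4^-1 ^+ k)%:E)%E) =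
            EFin \o series (geometric (1 : R) 4^-1).
    apply/funext => n /=; rewrite sumEFin; congr EFin.
    by apply: eq_bigr => i _; rewrite /geometric/= mul1r.
  by rewrite EFin_lim// ltry.
have aG : {ae mu, forall x, D x -> G x \is a fin_num}.
  apply: integrable_ae => //; apply/integrableP; split => //.
  rewrite (eq_integral G)// => x _; rewrite gee0_abs//.
  by apply: nneseries_ge0 => k _ _.
have cvG x : G x \is a fin_num -> cvgn (fun n => u (s n) x).
  move=> Gx; apply: (@geo_le_bounded_cvg _ (fine (G x))) => k.
  rewrite -lee_fin fineK//.
  apply: le_trans (nneseries_lim_ge k.+1 (fun n _ _ => g0 n x)).
  rewrite big_nat_recr//= leeDr//; exact: sume_ge0.
(* Replacing the sequence by 0 off [A] makes it converge at every point of [D], which yields a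
   measurable limit. *)
pose A := D `&` [set x | G x \is a fin_num].
have mA : measurable A by exact: emeasurable_fin_num.
pose h n := u (s n) \_ A.
have mh n : measurable_fun D (h n).
  apply/measurable_restrict => //; have [m1 _] := su (s n).
  by apply: measurable_funS m1 => // x [].
pose v x := limn (h ^~ x).
have hv x : D x -> h n x @[n --> \oo] --> v x.
  move=> Dx; suff : cvgn (h ^~ x) by [].
  rewrite /h; have [Ax|nAx] := pselect (A x).
    rewrite (_ : (fun n => _) = (fun n => u (s n) x)); first exact: cvG Ax.2.
    by apply/funext => n; rewrite patchE mem_set.
  rewrite (_ : (fun n => _) = (fun n => 0)); first exact: is_cvg_cst.
  by apply/funext => n; rewrite patchE memNset.
have mv : measurable_fun D v by exact: measurable_fun_cvg mh hv.
have aev : {ae mu, forall x, D x -> u (s n) x @[n --> \oo] --> v x}.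
  apply: filterS aG => x Gx Dx; have := hv x Dx.
  rewrite (_ : (fun n => h n x) = (fun n => u (s n) x))//.
  by apply/funext => n; rewrite /h patchE mem_set//; split => //; exact: Gx.
have s_ge n : (n <= s n)%N.
  by elim: n => // n IH; apply: leq_ltn_trans (s_incr n).
(* With [n] fixed, Fatou's lemma is applied along the subsequence in the second index. *)
have close e : 0 < e -> exists n0, forall n, (n0 <= n)%N ->
    sqint (fun x => u n x - v x) /\ nrm (fun x => u n x - v x) <= e.
  move=> e0; have [n0 n0P] := cu e e0; exists n0 => n n0n.
  apply: (@nrm_fatou (fun k x => u n x - u (s k) x)) => //.
  - exact: ltW.
  - by move=> k; exact: sqintB.
  - by apply: measurable_funB => //; have [] := su n.
  - by apply: filterS aev => x cx Dx; apply: cvgB (cx Dx); exact: cvg_cst.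
  - exists n0 => // k /= n0k; apply/ltW/n0P => //.
    exact: leq_trans n0k (s_ge k).
have sv : sqint v.
  have [n0 /(_ n0 (leqnn _)) [sd0 _]] := close 1 ltr01.
  have := sqintB mD (su n0) sd0; congr (sqint _).
  by apply/funext => x; rewrite opprB addrC subrK.
exists v; split => //; last by exists s.
apply/cvgrPdist_le => e e0; have [n0 n0P] := close e e0.
exists n0 => // n /= n0n; rewrite sub0r normrN ger0_norm ?nrm_ge0//.
by have [] := n0P _ n0n.
Qed.

End completeness.

(** * Near-minimisers in nested convex sets *)

Section nested_minimisation.
Context (R : realType) (X : Type).
Variables (C : nat -> set X) (q : X -> R) (mid : X -> X -> X) (gap : X -> X -> R).

(* Parallelogram law: near-minimisers of [q] over decreasing midpoint-convex
   sets form a Cauchy sequence, the gaps being bounded by the variation of the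
   bounded nondecreasing sequence of the infima. *)
Lemma nested_minimisation (m M : R) :
  (forall n, C n.+1 `<=` C n) -> (forall n a b, C n a -> C n b -> C n (mid a b)) ->
  (forall a b, C 0%N a -> C 0%N b -> q (mid a b) + gap a b <= (q a + q b) / 2) ->
  (forall a, C 0%N a -> m <= q a) -> (forall n, exists2 a, C n a & q a <= M) ->
  exists w : nat -> X, [/\ forall n, C n (w n),
    forall n a, C n a -> q (w n) <= q a + n.+1%:R^-1,
    forall n, q (w n) <= M + 1 &
    forall e : R, 0 < e -> exists n0, forall i j, (n0 <= i)%N -> (n0 <= j)%N ->
      gap (w i) (w j) < e].
Proof.
move=> decr cmid par qm CM.
have Cmono n k : C (n + k)%N `<=` C n.
  elim: k => [|k IH]; first by rewrite addn0.
  by rewrite addnS => a /decr /IH.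
have C0 n : C n `<=` C 0%N by have := Cmono 0%N n; rewrite add0n.
pose D n := inf (q @` C n).
have lbC n : has_lbound (q @` C n).
  by exists m => _ [a Ca <-]; apply/qm/(C0 n).
have infC n : has_inf (q @` C n).
  by split; [have [a Ca _] := CM n; exists (q a); exists a|exact: lbC].
have Dle n a : C n a -> D n <= q a by move=> Ca; apply: ge_inf => //; exists a.
have DM n : D n <= M by have [a /Dle /le_trans] := CM n; apply.
have ndD : nondecreasing_seq D.
  apply/nondecreasing_seqP => n; apply: lb_le_inf; first by have [] := infC n.+1.
  by move=> _ [a /decr Ca <-]; exact: Dle.
have /choice[w wP] : forall n, exists a, C n a /\ q a < D n + n.+1%:R^-1.
  move=> n; have e0 : 0 < n.+1%:R^-1 :> R by rewrite invr_gt0.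
  by have [_ [a Ca <-] h] := inf_adherent e0 (infC n); exists a.
have cD : cvgn D.
  by apply: nondecreasing_is_cvgn => //; exists M => _ [n _ <-].
(* Both points lie in the larger set [C i], so their midpoint has value at least [D i]; the two
   excesses average to at most 1/(i+1). *)
have gapb i j : (i <= j)%N -> gap (w i) (w j) <= (D j - D i) / 2 + i.+1%:R^-1.
  move=> ij; have [Ci qi] := wP i; have [Cj qj] := wP j.
  have Cji : C i (w j) by have := Cmono i (j - i)%N; rewrite subnKC//; apply.
  have := par _ _ (C0 _ _ Ci) (C0 _ _ Cj).
  have := Dle _ _ (cmid _ _ _ Ci Cji).
  have : j.+1%:R^-1 <= i.+1%:R^-1 :> R by rewrite lef_pV2 ?posrE// ler_nat.
  move: qi qj; set Di := D i; set Dj := D j; set ei := i.+1%:R^-1.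
  set ej := j.+1%:R^-1; clearbody Di Dj ei ej; lra.
have gapb' i j : (j <= i)%N -> gap (w i) (w j) <= (D i - D j) / 2 + j.+1%:R^-1.
  move=> ji; have [Ci qi] := wP i; have [Cj qj] := wP j.
  have Cij : C j (w i) by have := Cmono j (i - j)%N; rewrite subnKC//; apply.
  have := par _ _ (C0 _ _ Ci) (C0 _ _ Cj).
  have := Dle _ _ (cmid _ _ _ Cij Cj).
  have : i.+1%:R^-1 <= j.+1%:R^-1 :> R by rewrite lef_pV2 ?posrE// ler_nat.
  move: qi qj; set Di := D i; set Dj := D j; set ei := i.+1%:R^-1.
  set ej := j.+1%:R^-1; clearbody Di Dj ei ej; lra.
exists w; split=> [n|n a Ca|n|e e0].
- by have [] := wP n.
- have [_ /ltW /le_trans] := wP n; apply; rewrite lerD2r; exact: Dle.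
- have [_ /ltW /le_trans] := wP n; apply; apply: lerD => //.
  by rewrite invf_le1 ?ltr0n// ler1n.
- have /cvg_cauchy/cauchy_cvgP/cvgrPdist_lt : cvgn D by [].
  move=> /(_ (e / 2)); rewrite divr_gt0// => /(_ isT)[n0 _ n0P].
  have [k ke] := inv_natS_lt (divr_gt0 e0 (ltr0n R 2)).
  have sm i : (maxn n0 k <= i)%N -> `|limn D - D i| < e / 2 /\ i.+1%:R^-1 < e / 2.
    rewrite geq_max => /andP[ni ki]; split; first exact: n0P.
    by apply: le_lt_trans ke; rewrite lef_pV2 ?posrE// ler_nat.
  exists (maxn n0 k) => i j ni nj; have [ci vi] := sm _ ni; have [cj vj] := sm _ nj.
  move: ci cj; rewrite !ltr_norml => /andP[a1 a2] /andP[a3 a4].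
  have gb := gapb i j; have gb' := gapb' i j; move: gb gb' vi vj a1 a2 a3 a4.
  set ei := i.+1%:R^-1; set ej := j.+1%:R^-1; set l := limn D.
  set Di := D i; set Dj := D j; clearbody ei ej l Di Dj.
  have [ij|ji] := leqP i j; first by move=> /(_ isT) ? _; lra.
  by move=> _ /(_ (ltnW ji)) ?; lra.
Qed.

End nested_minimisation.

(** * Lebesgue measure on the row vectors *)

Section row_vectors.
Context (R : realType) (n : nat).
Implicit Types (x y a : 'rV[R]_n).

Lemma rV_normE x : `|x| = \big[Num.max/0]_ij `|x ij.1 ij.2|.
Proof. exact: mx_normrE. Qed.

Lemma coord_le_norm x i : `|x 0 i| <= `|x|.
Proof.
rewrite rV_normE.
by apply: (le_trans _ (le_bigmax _ (fun ij => `|x ij.1 ij.2|) (0, i))).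
Qed.

Lemma rV_norm_le x (e : R) : 0 <= e -> (forall i, `|x 0 i| <= e) -> `|x| <= e.
Proof.
move=> e0 xe; rewrite rV_normE; apply: bigmax_le => // -[i j] _ /=.
by rewrite ord1.
Qed.

Lemma rV_norm_lt x (e : R) : 0 < e -> (forall i, `|x 0 i| < e) -> `|x| < e.
Proof.
move=> e0 xe; rewrite rV_normE; apply: bigmax_lt => // -[i j] _ /=.
by rewrite ord1.
Qed.

Lemma norm_delta (i : 'I_n) (t : R) : `|t *: delta_mx 0 i : 'rV[R]_n| <= `|t|.
Proof.
apply: rV_norm_le => // j; rewrite !mxE /=.
by case: eqP => _; rewrite ?mulr1// mulr0 normr0.
Qed.

Lemma rational_dense x (e : R) : 0 < e ->
  exists q : 'rV[rat]_n, `|x - map_mx ratr q| < e.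
Proof.
move=> e0.
have /choice[q qP] : forall i, exists q : rat, ratr q \in `]x 0 i - e, x 0 i + e[.
  by move=> i; apply: rat_in_itvoo; lra.
exists (\row_i q i); apply: rV_norm_lt => // i; rewrite !mxE.
by have := qP i; rewrite in_itv/= ltr_distlC.
Qed.

(** An open set is the union of the countably many boxes with rational centre and radius 1/(r+1)
    that it contains, and preimages of boxes are handled one coordinate at a time. *)
Lemma measurable_preimage_open d (T : measurableType d) (D : set T)
    (f : T -> 'rV[R]_n) (O : set 'rV[R]_n) : measurable D ->
  (forall i, measurable_fun D (fun t => f t 0 i)) -> open O ->
  measurable (D `&` f @^-1` O).
Proof.
move=> mD mf oO.
pose box (qr : 'rV[rat]_n * nat) : set 'rV[R]_n :=
  [set y | forall i, y 0 i \in
     `](ratr (qr.1 0 i) - qr.2.+1%:R^-1), (ratr (qr.1 0 i) + qr.2.+1%:R^-1)[].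
pose U k := if unpickle k is Some qr then
  (if pselect (box qr `<=` O) then box qr else set0) else set0.
have -> : O = \bigcup_k U k.
  apply/seteqP; split => x; last first.
    move=> [k _]; rewrite /U; case: unpickle => // qr.
    by case: pselect => // sub; exact: sub.
  move=> Ox; have /nbhs_ballP[e /= e0 eO] : nbhs x O
    by exact: open_nbhs_nbhs.
  have [r re] := inv_natS_lt (divr_gt0 e0 (ltr0n R 2)).
  have r0 : 0 < r.+1%:R^-1 :> R by rewrite invr_gt0.
  have [q qx] := rational_dense x r0.
  have xb : box (q, r) x.
    move=> i; have := le_lt_trans (coord_le_norm _ i) qx; rewrite !mxE /= in_itv/=.
    set c := _^-1; clearbody c.
    by rewrite ltr_norml => /andP[h1 h2]; apply/andP; split; lra.
  exists (pickle (q, r)) => //; rewrite /U pickleK; case: pselect => // ns.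
  case: ns => y yb; apply: eO; rewrite mx_norm_ball /ball_ /=.
  apply: rV_norm_lt => // i; rewrite !mxE.
  move: (yb i) (xb i) re; rewrite /= !in_itv /= => /andP[y1 y2] /andP[x1 x2].
  move: y1 y2 x1 x2; set c := r.+1%:R^-1; set z := ratr _.
  clearbody c z => *; rewrite ltr_norml; apply/andP; split; lra.
rewrite preimage_bigcup setI_bigcupr; apply: bigcupT_measurable => k.
rewrite /U; case: unpickle => [qr|]; last by rewrite preimage_set0 setI0.
case: (pselect _) => sub /=; last by rewrite preimage_set0 setI0.
have -> : D `&` f @^-1` box qr = D `&` \bigcap_(i in [set: 'I_n]) (D `&` (fun t => f t 0 i) @^-1`
    `](ratr (qr.1 0 i) - qr.2.+1%:R^-1), (ratr (qr.1 0 i) + qr.2.+1%:R^-1)[%classic).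
  apply/seteqP; split => t [Dt h]; split => //; first by move=> i _; split => //; exact: h.
  by move=> i; have [] := h i I.
apply: measurableI => //; apply: fin_bigcap_measurable; first exact: finite_finset.
by move=> i _; apply: mf => //; exact: measurable_itv.
Qed.

Lemma measurable_continuous_comp d (T : measurableType d) (D : set T)
    (f : T -> 'rV[R]_n) (g : 'rV[R]_n -> R) :
  (forall i, measurable_fun D (fun t => f t 0 i)) -> continuous g ->
  measurable_fun D (fun t => g (f t)).
Proof.
move=> mf cg mD; apply: (measurability _ (RGenOInfty.measurableE R)) => //.
move=> _ [_ [a ->] <-].
apply: (@measurable_preimage_open _ _ D f (g @^-1` `]a, +oo[%classic)) => //.
by apply: open_comp => [x _|]; [exact: cg|exact: interval_open].
Qed.

End row_vectors.

Section lebesgue_facts.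
Context (R : realType) (n : nat).
Local Notation mR := (measurableTypeR R).
Local Notation mu := (@lebesgue R n).
Local Notation V := 'rV[R]_n.

Definition tuple_of_row (x : V) : n.-tuple mR := [tuple x 0 i | i < n].

Lemma tuple_of_rowK : cancel tuple_of_row (@row_of_tuple R n).
Proof. by move=> x; apply/rowP => i; rewrite mxE tnth_mktuple. Qed.

Lemma row_of_tupleK : cancel (@row_of_tuple R n) tuple_of_row.
Proof. by move=> t; apply: eq_from_tnth => i; rewrite tnth_mktuple mxE. Qed.

Lemma preimage_row_of_tuple (B : set (n.-tuple mR)) :
  @row_of_tuple R n @^-1` (tuple_of_row @^-1` B) = B.
Proof. by apply/funext => t; rewrite /preimage /= row_of_tupleK. Qed.

(** Borel sets satisfy the Caratheodory splitting for the outer extension of [lebesgue_tuple], and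
    the bijection between rows and tuples carries this identity over. *)
Lemma measurable_tuple_of_row :
  measurable_fun [set: euclid R n] (tuple_of_row : euclid R n -> _).
Proof.
move=> _ B mB; rewrite setTI.
suff h : caratheodory_measurable (@lebesgue_outer R n) (tuple_of_row @^-1` B) by exact: h.
move=> X; rewrite /= /lebesgue_outer.
have -> : @row_of_tuple R n @^-1` (X `&` tuple_of_row @^-1` B) =
    @row_of_tuple R n @^-1` X `&` B by rewrite preimage_setI preimage_row_of_tuple.
have -> : @row_of_tuple R n @^-1` (X `&` ~` (tuple_of_row @^-1` B)) =
    @row_of_tuple R n @^-1` X `&` ~` B.
  by rewrite preimage_setI preimage_setC preimage_row_of_tuple.
exact: (caratheodory_measurable_mu_ext (lebesgue_tuple R n) mB).
Qed.

Lemma lebesgue_borel (B : set (n.-tuple mR)) : measurable B ->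
  mu (tuple_of_row @^-1` B) = lebesgue_tuple R n B.
Proof.
move=> mB; rewrite /lebesgue /lebesgue_outer preimage_row_of_tuple.
exact: measurable_mu_extE.
Qed.

Lemma measurable_coord (i : 'I_n) :
  measurable_fun [set: euclid R n] (fun x : euclid R n => (x : V) 0 i).
Proof.
rewrite (_ : (fun x => _) = (fun t => tnth t i) \o (tuple_of_row : euclid R n -> _)).
  apply: measurableT_comp; [exact: measurable_tnth|exact: measurable_tuple_of_row].
by apply/funext => x /=; rewrite tnth_mktuple.
Qed.

Lemma open_measurable_euclid (O : set V) : open O -> measurable (O : set (euclid R n)).
Proof.
move=> oO; have := @measurable_preimage_open R n _ (euclid R n) setT
  (fun x => x) O measurableT measurable_coord oO.
by rewrite setTI.
Qed.

Lemma continuous_measurable_euclid (D : set V) (g : V -> R) : continuous g ->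
  measurable_fun (D : set (euclid R n)) (g : euclid R n -> R).
Proof.
move=> cg.
have mc (i : 'I_n) : measurable_fun (D : set (euclid R n)) (fun x : euclid R n => (x : V) 0 i).
  exact: (measurable_funTS (measurable_coord i)).
exact: (@measurable_continuous_comp R n _ (euclid R n) D (fun x => x) g mc cg).
Qed.

Lemma lebesgue_complete : measure_is_complete mu.
Proof. exact: measure_is_complete_caratheodory. Qed.

(** The outer measure is an infimum over countable measurable covers; the union of a nearly optimal
    cover is the desired Borel set. It lets statements proved on Borel sets reach all Lebesgue
    measurable ones. *)
Lemma borel_approximation (A : set V) (e : R) : 0 < e -> (mu A < +oo)%E ->
  exists B : set (n.-tuple mR), [/\ measurable B, A `<=` tuple_of_row @^-1` B &
    (mu (tuple_of_row @^-1` B) <= mu A + e%:E)%E].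
Proof.
move=> e0 Aoo.
have fA : lebesgue_outer A \is a fin_num.
  by rewrite ge0_fin_numE//; exact: outer_measure_ge0.
have [_ [F [mF subF] <-] lt] := lb_ereal_inf_adherent e0 fA.
exists (\bigcup_k F k); split; first exact: bigcupT_measurable.
  by move=> x Ax; apply: subF; rewrite /= tuple_of_rowK.
rewrite lebesgue_borel; last exact: bigcupT_measurable.
apply: le_trans (ltW lt); apply: measure_sigma_subadditive => //.
exact: bigcupT_measurable.
Qed.

End lebesgue_facts.

(** * Translation invariance and volume of cubes *)

Section translation_invariance.
Context (R : realType).
Local Notation mR := (measurableTypeR R).

Lemma lebesgue_measure_shift (a : R) (A : set mR) : measurable A ->
  lebesgue_measure ((fun x : mR => x + a : mR) @^-1` A) = lebesgue_measure A.
Proof.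
move=> mA.
have ms : measurable_fun [set: mR] (fun x : mR => x + a : mR).
  exact: measurable_funD.
rewrite -[LHS]/(pushforward lebesgue_measure (fun x : mR => x + a : mR) A).
apply/esym/lebesgue_measure_unique => //= _ [[b c]] _ <-.
rewrite /pushforward (_ : _ @^-1` _ = `](b - a), (c - a)]%classic); last first.
  by apply/funext => x; rewrite /preimage /= !in_itv/= ltrBlDr lerBrDr.
rewrite !lebesgue_measure_itv/= !lte_fin ltrD2r; case: ifPn => // _.
by congr EFin; ring.
Qed.

Lemma integral_measure_preserving d (T : measurableType d)
    (m : {measure set T -> \bar R}) (f : T -> T) (h : T -> \bar R) :
  measurable_fun setT f -> (forall A, measurable A -> m (f @^-1` A) = m A) ->
  measurable_fun setT h -> (\int[m]_x h (f x) = \int[m]_x h x)%E.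
Proof.
move=> mf mp.
suff pos (g : T -> \bar R) : measurable_fun setT g -> (forall x, 0 <= g x)%E ->
    (\int[m]_x g (f x) = \int[m]_x g x)%E.
  move=> mh; rewrite integralE [in RHS]integralE; congr (_ - _)%E.
    rewrite (_ : (fun x => h (f x))^\+%E = fun x => (h^\+)%E (f x)); last first.
      by rewrite unlock.
    by apply: (pos (h^\+)%E) => [|x]; [exact: measurable_funepos|exact: funepos_ge0].
  rewrite (_ : (fun x => h (f x))^\-%E = fun x => (h^\-)%E (f x)); last first.
    by rewrite unlock.
  by apply: (pos (h^\-)%E) => [|x]; [exact: measurable_funeneg|exact: funeneg_ge0].
move=> mg g0.
transitivity (\int[pushforward m f]_x g x)%E; last first.
  by apply: eq_measure_integral => // A mA _; exact: mp.
by rewrite ge0_integral_pushforward.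
Qed.

Definition tuple_shift n (a : 'I_n -> R) (t : n.-tuple mR) : n.-tuple mR :=
  [tuple (tnth t i + a i : R) | i < n].

Lemma measurable_tuple_shift n (a : 'I_n -> R) :
  measurable_fun setT (tuple_shift a).
Proof.
apply/measurable_fun_tnthP => i.
rewrite (_ : _ \o _ = fun t => tnth t i + a i).
  by apply: measurable_funD => //; exact: measurable_tnth.
by apply/funext => t /=; rewrite tnth_mktuple.
Qed.

(** The product measure integrates the measures of sections: the induction hypothesis shifts the
    sections, and invariance on the line shifts the variable of integration. *)
Lemma lebesgue_tuple_shift n (a : 'I_n -> R) (A : set (n.-tuple mR)) :
  measurable A -> lebesgue_tuple R n (tuple_shift a @^-1` A) = lebesgue_tuple R n A.
Proof.
elim: n a A => [|n IH] a A mA.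
  congr (lebesgue_tuple R 0 _); apply/funext => t; rewrite /preimage /=.
  by rewrite (tuple0 (tuple_shift a t)) (tuple0 t).
rewrite /= /lebesgue_step /pushforward.
have mcA : measurable (@tuple_cons R n @^-1` A).
  by rewrite -[X in measurable X]setTI; exact: measurable_tuple_cons.
pose a' (i : 'I_n) := a (lift ord0 i).
rewrite /product_measure1.
transitivity (\int[lebesgue_measure]_(x in [set: mR])
    lebesgue_tuple R n (xsection (@tuple_cons R n @^-1` A) ((x : R) + a ord0)%R))%E.
  apply: eq_integral => x _ /=.
  rewrite -[RHS](IH a'); last exact: measurable_xsection.
  congr (lebesgue_tuple R n _); apply/seteqP.
  have consE (t : n.-tuple mR) : tuple_shift a (tuple_cons (x, t)) =
      tuple_cons (x + a ord0 : mR, tuple_shift a' t).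
    apply: eq_from_tnth => i; rewrite tnth_mktuple.
    case: (unliftP ord0 i) => [j ->|->]; last by rewrite !tnth0.
    by rewrite !tnthS tnth_mktuple.
  split => t; rewrite /preimage /= /xsection /= !inE /=.
    by rewrite -consE.
  by rewrite consE.
apply: (@integral_measure_preserving _ mR lebesgue_measure (fun x : mR => x + a ord0 : mR)
  (fun x => lebesgue_tuple R n (xsection (@tuple_cons R n @^-1` A) x))).
- exact: measurable_funD.
- exact: lebesgue_measure_shift.
- exact: measurable_fun_xsection.
Qed.

Context (n : nat).
Local Notation mu := (@lebesgue R n).
Local Notation V := 'rV[R]_n.

(** Shifting a measurable cover of a set gives a cover of the shifted set with the same total
    measure; this proves one inequality, and the opposite shift gives the other. *)
Lemma lebesgue_shift (a : V) (A : set V) : mu ((fun x => x + a) @^-1` A) = mu A.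
Proof.
suff le (b : V) (B : set V) : (mu ((fun x => x + b)%R @^-1` B) <= mu B)%E.
  apply/eqP; rewrite eq_le le /=.
  have := le (- a) ((fun x => x + a) @^-1` A).
  rewrite -comp_preimage (_ : _ \o _ = id)//.
  by apply/funext => x /=; rewrite subrK.
rewrite /lebesgue /lebesgue_outer.
apply: le_ereal_inf_tmp => _ [F [mF subF] <-].
apply: ereal_inf_lbound.
exists (fun k => tuple_shift (fun i => b 0 i) @^-1` F k).
  split=> [k|t /= Bt].
    by rewrite -[X in measurable X]setTI; exact: measurable_tuple_shift.
  have [|k _ Fk] := subF (tuple_shift (fun i => b 0 i) t).
    rewrite /= (_ : row_of_tuple _ = row_of_tuple t + b)//.
    by apply/rowP => i; rewrite !mxE tnth_mktuple.
  by exists k.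
by apply: eq_eseriesr => k _; exact: lebesgue_tuple_shift.
Qed.

Lemma measurable_shift (a : V) :
  measurable_fun [set: euclid R n] ((fun x => x + a) : euclid R n -> euclid R n).
Proof.
move=> _ A mA; rewrite setTI.
suff h : caratheodory_measurable (@lebesgue_outer R n) ((fun x => x + a) @^-1` A).
  exact: h.
have mA' Y : lebesgue_outer Y = (lebesgue_outer (Y `&` A) + lebesgue_outer (Y `&` ~` A))%E.
  exact: mA.
have inv B : lebesgue_outer ((fun x : V => x - a) @^-1` B) = lebesgue_outer B.
  exact: (lebesgue_shift (- a)).
move=> X; rewrite /= -(inv X) mA' -[in RHS]inv; congr (_ + _)%E.
  congr lebesgue_outer; rewrite preimage_setI; congr (_ `&` _).
  by apply/funext => x; rewrite /preimage /= subrK.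
rewrite -[RHS]inv; congr lebesgue_outer; rewrite preimage_setI; congr (_ `&` _).
by apply/funext => x; rewrite /preimage /= subrK.
Qed.

Lemma integral_shift (a : V) (h : V -> \bar R) :
  measurable_fun [set: euclid R n] (h : euclid R n -> \bar R) ->
  (\int[mu]_x h (x + a)%R = \int[mu]_x h x)%E.
Proof.
move=> mh.
exact: (@integral_measure_preserving _ (euclid R n) mu (fun x => x + a) h
  (measurable_shift a) (fun A _ => lebesgue_shift a A) mh).
Qed.

Lemma Rintegral_shift (a : V) (h : V -> R) :
  measurable_fun [set: euclid R n] (h : euclid R n -> R) ->
  \int[mu]_x h (x + a) = \int[mu]_x h x.
Proof.
move=> mh; congr fine; apply: (integral_shift a (h := EFin \o h)).
exact/measurable_EFinP.
Qed.

Definition cube (r : R) : set V := [set x | forall i, `|x 0 i| < r].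

Lemma cubeE r : 0 < r -> cube r = ball 0 r.
Proof.
move=> r0; rewrite mx_norm_ball; apply/seteqP; split => x; rewrite /ball_ /= sub0r normrN.
  exact: rV_norm_lt.
by move=> xr i; apply: le_lt_trans (coord_le_norm x i) xr.
Qed.

Lemma open_cube r : 0 < r -> open (cube r).
Proof. by move=> r0; rewrite cubeE//; exact: ball_open. Qed.

Lemma lebesgue_cube (r : R) : 0 < r -> mu (cube r) = ((r *+ 2) ^+ n)%:E.
Proof.
move=> r0.
pose C m : set (m.-tuple mR) := [set t | forall i, `|tnth t i| < r].
have mC m : measurable (C m).
  have -> : C m = \bigcap_(i in [set: 'I_m]) (fun t => tnth t i) @^-1` (ball 0 r : set mR).
    by apply/seteqP; split => x h i; have := h i; rewrite /ball/= sub0r normrN// => /(_ I).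
  apply: fin_bigcap_measurable; first exact: finite_finset.
  by move=> i _; rewrite -[X in measurable X]setTI; apply: measurable_tnth => //;
    exact: measurable_ball.
have -> : cube r = @tuple_of_row R n @^-1` C n.
  by apply/seteqP; split => x h i; have := h i; rewrite tnth_mktuple.
rewrite lebesgue_borel//; elim: n => [|m IH] /=.
  by rewrite expr0 diracE mem_set// => -[].
rewrite /lebesgue_step /pushforward (_ : _ @^-1` _ = ball 0 r `*` C m).
  have mb : measurable (ball (0 : R) r : set mR) by exact: measurable_ball.
  apply: eq_trans (product_measure1E _ _ mb (mC m)) _.
  have lb : lebesgue_measure (ball (0 : R) r : set mR) = (r *+ 2)%:E.
    exact: lebesgue_measure_ball (ltW r0).
  by rewrite [X in (X * _)%E]lb [X in (_ * X)%E]IH -EFinM exprS.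
apply/seteqP; split=> [[x t] h|[x t] [hx ht]] /=.
  split; first by have := h ord0; rewrite /ball/= sub0r normrN tnth0.
  by move=> i; have := h (lift ord0 i); rewrite tnthS.
move=> i; case: (unliftP ord0 i) => [j ->|->]; last first.
  by move: hx; rewrite /ball/= sub0r normrN tnth0.
by rewrite tnthS; exact: ht.
Qed.

Lemma lebesgue_bounded_lty (A : set V) : bounded_set A -> (mu A < +oo)%E.
Proof.
move=> [M [_ AM]].
pose r := Num.max 1 (M + 2).
have r0 : 0 < r by rewrite lt_max ltr01.
apply: (@le_lt_trans _ _ (mu (cube r))); last by rewrite lebesgue_cube// ltry.
apply: le_outer_measure => x Ax i; apply: le_lt_trans (coord_le_norm x i) _.
have : M < M + 1 by rewrite ltrDl.
move=> /AM /(_ x Ax) /le_lt_trans; apply; rewrite lt_max; apply/orP; right; lra.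
Qed.

Lemma lebesgue_sigma_finite : sigma_finite [set: euclid R n] mu.
Proof.
exists (fun k => cube k.+1%:R) => [|k]; last first.
  split; first by apply: open_measurable_euclid; exact: open_cube.
  by rewrite lebesgue_cube// ltry.
apply/esym; rewrite -subTset => x _; exists (Num.bound `|(x : V)|) => // i.
apply: le_lt_trans (coord_le_norm x i) _.
by apply: lt_le_trans (archi_boundP _) _ => //; rewrite ler_nat.
Qed.

HB.instance Definition _ := Measure_isSigmaFinite.Build _ _ _ mu
  lebesgue_sigma_finite.

End translation_invariance.

(** * Smooth functions and test functions *)

Section smooth_functions.
Context (R : realType) (N : nat).
Local Notation V := 'rV[R]_N.
Implicit Types (f g : V -> R) (x v a : V).

Local Notation e_ i := (delta_mx 0 i : V).

(** Coinduction: smoothness concerns all iterated partial derivatives, so it suffices to find a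
    class of regular functions stable under them. *)
Lemma smooth_coind (S : set (V -> R)) f :
  (forall h, S h -> continuous h /\ forall i x, derivable h x (e_ i)) ->
  (forall h i, S h -> S (partial i h)) -> S f -> smooth f.
Proof.
move=> S1 S2 Sf s; apply: S1; elim: s => //= i s IH; exact: S2.
Qed.

Lemma smooth_partial f i : smooth f -> smooth (partial i f).
Proof. by move=> sf s; have := sf (rcons s i); rewrite foldr_rcons. Qed.

Lemma smooth_continuous f : smooth f -> continuous f.
Proof. by move=> /(_ [::])[]. Qed.

Lemma smooth_derivable f i x : smooth f -> derivable f x (e_ i).
Proof. by move=> /(_ [::])[]. Qed.

(** Directional derivatives are moved to the real line, where the chain rule and the mean value
    theorem are available. *)
Lemma is_derive_line (h : V -> R) x v (df : R) :
  is_derive (0 : R) (1 : R) (fun t : R => h (t *: v + x) : R) df ->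
  is_derive x v h df.
Proof.
have E : (fun t : R => t^-1 *: (((fun t : R => h (t *: v + x)) \o shift 0) (t *: 1) -
    h ((0 : R) *: v + x))) = (fun t : R => t^-1 *: ((h \o shift x) (t *: v) - h x)).
  by apply/funext => t /=; rewrite addr0 scale0r add0r [t *: (1 : R)]mulr1.
move=> [d1 d2]; split; first by move: d1; rewrite /derivable E.
by move: d2; rewrite /derive E.
Qed.

Lemma derive_line (h : V -> R) x v : derivable h x v ->
  is_derive (0 : R) (1 : R) (fun t : R => h (t *: v + x) : R) ('D_v h x).
Proof.
have E : (fun t : R => t^-1 *: (((fun t : R => h (t *: v + x)) \o shift 0) (t *: 1) -
    h ((0 : R) *: v + x))) = (fun t : R => t^-1 *: ((h \o shift x) (t *: v) - h x)).
  by apply/funext => t /=; rewrite addr0 scale0r add0r [t *: (1 : R)]mulr1.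
by move=> d; split; rewrite /derivable /derive E.
Qed.

Lemma derive_translate (h : V -> R) a x v :
  (derivable (fun y => h (y + a)) x v <-> derivable h (x + a) v) /\
  'D_v (fun y => h (y + a)) x = 'D_v h (x + a).
Proof.
have E : (fun t : R => t^-1 *: (((fun y => h (y + a)) \o shift x) (t *: v) - h (x + a))) =
  (fun t : R => t^-1 *: ((h \o shift (x + a)) (t *: v) - h (x + a))).
  by apply/funext => t /=; rewrite addrA.
by split; rewrite /derivable /derive E.
Qed.

Lemma is_derive_along (h : V -> R) x v (t : R) : derivable h (t *: v + x) v ->
  is_derive t (1 : R) (fun s : R => h (s *: v + x) : R) ('D_v h (t *: v + x)).
Proof.
move=> d; have [d1 d2] := derive_line d.
have E : (fun s : R => s^-1 *: (((fun s : R => h (s *: v + x)) \o shift t) (s *: 1) -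
    h (t *: v + x))) = (fun s : R => s^-1 *: (((fun s : R => h (s *: v + (t *: v + x)))
    \o shift 0) (s *: 1) - h ((0 : R) *: v + (t *: v + x)))).
  by apply/funext => s /=; rewrite addr0 scale0r add0r scalerDl addrA.
by split; [move: d1; rewrite /derivable E|move: d2; rewrite /derive E].
Qed.

Lemma smooth_translate f a : smooth f -> smooth (fun x => f (x + a)).
Proof.
move=> sf; apply: (@smooth_coind [set h | exists2 g, smooth g & h = fun x => g (x + a)]).
- move=> _ [g sg ->]; split=> [x|i x]; last first.
    by apply/(derive_translate _ _ _ _).1; exact: smooth_derivable.
  apply: (@continuous_comp _ _ _ (fun x => x + a) g); last exact: smooth_continuous.
  exact: (cvgD cvg_id (cvg_cst _)).
- move=> _ i [g sg ->]; exists (partial i g); first exact: smooth_partial.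
  by apply/funext => x; rewrite /partial (derive_translate _ _ _ _).2.
- by exists f.
Qed.

Lemma partial_translate f a i : partial i (fun x => f (x + a)) = fun x => partial i f (x + a).
Proof. by apply/funext => x; rewrite /partial (derive_translate _ _ _ _).2. Qed.

Lemma smooth_cst (c : R) : smooth (fun _ : V => c).
Proof.
apply: (@smooth_coind [set h | exists c : R, h = fun=> c]); last by exists c.
- by move=> _ [b ->]; split; [exact: cst_continuous|move=> i x; exact: derivable_cst].
- by move=> _ i [b ->]; exists 0; apply/funext => x; exact: derive_cst.
Qed.

(** A product of smooth functions does not have products as partial derivatives, but sums of
    products do: this is the class that [smooth_coind] needs. *)
Inductive products_sum : set (V -> R) :=
| PS_mul f g : smooth f -> smooth g -> products_sum (f * g)
| PS_add f g : products_sum f -> products_sum g -> products_sum (f + g).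

Lemma smooth_products_sum f : products_sum f -> smooth f.
Proof.
have reg h : products_sum h -> continuous h /\ forall i x, derivable h x (e_ i).
  elim=> [{}f g sf sg|{}f g _ [cf df] _ [cg dg]]; split.
  - have cf := smooth_continuous sf; have cg := smooth_continuous sg.
    move=> x; exact: (@cvgM _ _ (nbhs x) _ f g _ _ (cf x) (cg x)).
  - by move=> i x; apply: derivableM; exact: smooth_derivable.
  - by move=> x; exact: (cvgD (cf x) (cg x)).
  - by move=> i x; apply: derivableD.
apply: smooth_coind => // h i; elim=> [{}f g sf sg|{}f g pf psf pg psg].
  have -> : partial i (f * g) = f * partial i g + g * partial i f.
    by apply/funext => x; rewrite /partial deriveM//; exact: smooth_derivable.
  exact: PS_add (PS_mul sf (smooth_partial i sg)) (PS_mul sg (smooth_partial i sf)).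
have -> : partial i (f + g) = partial i f + partial i g.
  apply/funext => x; rewrite /partial deriveD//.
    by have [_ d] := reg _ pf; exact: d.
  by have [_ d] := reg _ pg; exact: d.
exact: PS_add.
Qed.

Lemma smoothM f g : smooth f -> smooth g -> smooth (fun x => f x * g x).
Proof. by move=> sf sg; apply: smooth_products_sum; exact: PS_mul. Qed.

Lemma smoothD f g : smooth f -> smooth g -> smooth (fun x => f x + g x).
Proof.
move=> sf sg; apply: smooth_products_sum.
have -> : (fun x => f x + g x) = (fun _ : V => 1) * f + (fun _ : V => 1) * g.
  by apply/funext => x; rewrite !fctE !mul1r.
exact: PS_add (PS_mul (smooth_cst 1) sf) (PS_mul (smooth_cst 1) sg).
Qed.

Lemma smooth_prod (I : Type) (r : seq I) (F : I -> V -> R) :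
  (forall i, smooth (F i)) -> smooth (fun x => \prod_(i <- r) F i x).
Proof.
move=> sF; elim: r => [|i r IH].
  rewrite (_ : (fun x => _) = fun=> 1); first exact: smooth_cst.
  by apply/funext => x; rewrite big_nil.
rewrite (_ : (fun x => _) = fun x => F i x * \prod_(j <- r) F j x).
  exact: smoothM (sF i) IH.
by apply/funext => x; rewrite big_cons.
Qed.

Lemma partialD f g i : smooth f -> smooth g ->
  partial i (fun x => f x + g x) = fun x => partial i f x + partial i g x.
Proof.
by move=> sf sg; apply/funext => x; rewrite /partial deriveD//; exact: smooth_derivable.
Qed.

Lemma partialM f g i : smooth f -> smooth g ->
  partial i (fun x => f x * g x) = fun x => f x * partial i g x + g x * partial i f x.
Proof.
by move=> sf sg; apply/funext => x; rewrite /partial deriveM//; exact: smooth_derivable.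
Qed.

Lemma partialZ (c : R) f i : smooth f ->
  partial i (fun x => c * f x) = fun x => c * partial i f x.
Proof.
move=> sf; rewrite (partialM _ (smooth_cst c) sf).
by apply/funext => x; rewrite /partial derive_cst mulr0 addr0.
Qed.

End smooth_functions.

(** * Bump functions from the flat exponential *)

Section flat_exponential.
Context (R : realType).

(* The derivatives of [x |-> exp (- 1 / x)] are combinations of these. *)
Definition flat (m : nat) (x : R) : R :=
  if 0 < x then x^-1 ^+ m * expR (- x^-1) else 0.

Lemma flat_ge0 m x : 0 <= flat m x.
Proof.
rewrite /flat; case: ifPn => // x0.
by rewrite mulr_ge0 ?exprn_ge0 ?invr_ge0 ?expR_ge0// ltW.
Qed.

(** The term of degree m+2 in the exponential series of 1/x beats x^-m by a factor x^2. A quadratic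
    bound at 0 gives derivative 0 there. *)
Lemma flat_le m x : flat m x <= m.+2`!%:R * x ^+ 2.
Proof.
rewrite /flat; case: ifPn => x0; last by rewrite mulr_ge0 ?sqr_ge0.
have x10 : 0 < x^-1 by rewrite invr_gt0.
have e0 := expR_gt0 x^-1.
have := expR_ge1Dxn m.+1 (ltW x10) => h.
have : x^-1 ^+ m.+2 / m.+2`!%:R <= expR x^-1 by apply: le_trans h; rewrite lerDr.
rewrite ler_pdivrMr ?ltr0n ?fact_gt0// => h2.
rewrite expRN ler_pdivrMr//.
have -> : x^-1 ^+ m = x^-1 ^+ m.+2 * x ^+ 2.
  by rewrite -addn2 exprD -mulrA -exprMn mulVf ?gt_eqF// expr1n mulr1.
rewrite [leRHS]mulrAC ler_wpM2r ?sqr_ge0//.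
by rewrite mulrC.
Qed.

Lemma is_derive_flat m (x : R) :
  is_derive x (1 : R) (flat m) (flat m.+2 x - m%:R * flat m.+1 x).
Proof.
have [x0|x0|x0] := ltgtP x 0.
- rewrite {2 3}/flat ltNge (ltW x0) /= mulr0 subr0.
  apply: (@near_eq_is_derive _ _ _ (cst 0)) => //.
  near=> y; have y0 : y < 0 by near: y; exact: lt_nbhsl.
  by rewrite /flat ltNge (ltW y0).
- rewrite /(flat m.+2 x) /(flat m.+1 x) x0.
  apply: (@near_eq_is_derive _ _ _ (fun y : R => y^-1 ^+ m * expR (- y^-1))) => //.
  + near=> y; have y0 : 0 < y by near: y; exact: lt_nbhsr.
    by rewrite /flat y0.
  have xn0 : x != 0 by rewrite gt_eqF.
  have dV : is_derive x (1 : R) (fun y : R => y^-1) (- x^-1 ^+ 2).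
    have := @is_deriveV R (fun y : R => y) x 1 1 xn0 (is_derive_id x 1).
    by rewrite [_ *: _]mulr1 exprVn.
  have dE : is_derive x (1 : R) (fun y : R => expR (- y^-1)) (x^-1 ^+ 2 * expR (- x^-1)).
    have dN : is_derive x (1 : R) (fun y : R => - y^-1) (x^-1 ^+ 2).
      by have := is_deriveN dV; rewrite opprK.
    have := @is_derive1_comp R expR (fun y : R => - y^-1) x _ _ (is_derive_expR _) dN.
    by rewrite mulrC.
  have dX : is_derive x (1 : R) (fun y : R => y^-1 ^+ m) (- (m%:R * x^-1 ^+ m.+1)).
    have := is_deriveX m dV; rewrite [_ *: _]mulrN -mulrA -exprD.
    have -> : (fun y : R => y^-1) ^+ m = (fun y : R => y^-1 ^+ m).
      elim: (m) => [//|k IH]; rewrite exprS IH.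
      by apply/funext => y; rewrite exprS.
    by case: (m) => [|k]; [rewrite !mul0r|rewrite /= addnC].
  have := is_deriveM dX dE; rewrite /GRing.scale /=.
  have -> : x^-1 ^+ m * (x^-1 ^+ 2 * expR (- x^-1)) +
      expR (- x^-1) * - (m%:R * x^-1 ^+ m.+1) =
    x^-1 ^+ m.+2 * expR (- x^-1) - m%:R * (x^-1 ^+ m.+1 * expR (- x^-1)).
    by rewrite -(addn2 m) exprD; ring.
  by [].
- rewrite x0 /(flat m.+2 0) /(flat m.+1 0) ltxx mulr0 subr0.
  have cv : (fun h : R => h^-1 *: ((flat m \o shift 0) (h *: 1) - flat m 0)) @ 0^' --> (0 : R).
    apply/cvgr0Pnorm_le => e e0; pose C : R := m.+2`!%:R.
    have C0 : 0 < C by rewrite ltr0n fact_gt0.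
    near=> h; have hn0 : h != 0 by near: h; exact: nbhs_dnbhs_neq.
    have he : `|h| < e / C.
      near: h; apply: dnbhs0_lt; exact: divr_gt0.
    rewrite /= addr0 [h *: 1]mulr1 {2}/flat ltxx subr0 normrZ normfV.
    rewrite (ger0_norm (flat_ge0 _ _)) mulrC ler_pdivrMr ?normr_gt0//.
    apply: le_trans (flat_le m h) _; rewrite -/C -(real_normK (num_real h)) expr2 mulrA.
    by apply: ler_wpM2r => //; rewrite mulrC -ler_pdivlMr// ltW.
  by split; [apply/cvg_ex; exists 0|exact/cvg_lim].
Unshelve. all: by end_near. Qed.

End flat_exponential.

Section bumps.
Context (R : realType) (N : nat).
Local Notation V := 'rV[R]_N.

Section flat_affine.
Variables (i : 'I_N) (c b : R).

Local Notation aff m := (fun x : V => flat m (c * x 0 i + b)).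

Lemma is_derive_flat_affine m (x : V) (j : 'I_N) :
  is_derive x (delta_mx 0 j : V) (aff m) (c * (i == j)%:R *
    (flat m.+2 (c * x 0 i + b) - m%:R * flat m.+1 (c * x 0 i + b))).
Proof.
apply: is_derive_line.
have -> : (fun t : R => flat m (c * (t *: (delta_mx 0 j : V) + x) 0 i + b)) =
    flat m \o (fun t : R => (c * (i == j)%:R) * t + (c * x 0 i + b)).
  by apply/funext => t /=; rewrite !mxE eqxx; congr flat; ring.
have d0 : is_derive (0 : R) (1 : R)
    (fun t : R => (c * (i == j)%:R) * t + (c * x 0 i + b)) (c * (i == j)%:R).
  have dc := is_derive_cst (c * x 0 i + b) (0 : R) (1 : R).
  have di := is_deriveZ (c * (i == j)%:R) (is_derive_id (0 : R) (1 : R)).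
  by have := is_deriveD di dc; rewrite addr0 [_ *: (1 : R)]mulr1.
have df := is_derive_flat m (c * x 0 i + b).
have E : (c * (i == j)%:R) * 0 + (c * x 0 i + b) = c * x 0 i + b by rewrite mulr0 add0r.
rewrite -{1}E in df.
by have := @is_derive1_comp R (flat m) _ 0 _ _ df d0; rewrite (mulrC (_ - _)).
Qed.

(** The span of the functions [flat m] of one fixed affine coordinate. It is stable under partial
    derivatives because differentiating [flat m] yields [flat m.+2] and [flat m.+1]. *)
Inductive flat_combination : set (V -> R) :=
| FC_base m (k : R) : flat_combination (fun x => k * aff m x)
| FC_add f g : flat_combination f -> flat_combination g ->
    flat_combination (fun x => f x + g x).

Lemma smooth_flat_affine m : smooth (aff m).
Proof.
have base k (a : R) : continuous (fun x => a * aff k x) /\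
    forall j x, is_derive x (delta_mx 0 j : V) (fun x => a * aff k x)
      (a * (c * (i == j)%:R *
    (flat k.+2 (c * x 0 i + b) - k%:R * flat k.+1 (c * x 0 i + b)))).
  split=> [x|j x]; last exact: is_deriveZ (is_derive_flat_affine k x j).
  suff h : {for x, continuous (fun x : V => flat k (c * x 0 i + b))}.
    exact: (@cvgM _ _ (nbhs x) _ (cst a) _ _ _ (cvg_cst _) h).
  apply: (@continuous_comp _ _ _ (fun x : V => c * x 0 i + b) (flat k)).
    apply: (@continuous_comp _ _ _ (fun x : V => x 0 i) (fun t : R => c * t + b)).
      exact: coord_continuous.
    by apply: cvgD; [apply: cvgM; [exact: cvg_cst|exact: cvg_id]|exact: cvg_cst].
  apply: differentiable_continuous; apply/derivable1_diffP.
  by have [] := is_derive_flat k (c * x 0 i + b).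
have reg h : flat_combination h ->
    continuous h /\ forall j x, derivable h x (delta_mx 0 j).
  elim=> [k a|f g _ [cf df] _ [cg dg]].
    by have [h1 h2] := base k a; split => // j x; have [] := h2 j x.
  split=> [x|j x]; first exact: (cvgD (cf x) (cg x)).
  exact: derivableD.
have -> : (fun x : V => flat m (c * x 0 i + b)) = fun x => 1 * aff m x.
  by apply/funext => x; rewrite mul1r.
apply: (@smooth_coind _ _ flat_combination) => //; last exact: FC_base.
move=> h j; elim=> [k a|f g pf sf pg sg].
  have -> : partial j (fun x => a * aff k x) = fun x =>
     (a * (c * (i == j)%:R)) * aff k.+2 x +
     (- (a * (c * (i == j)%:R) * k%:R)) * aff k.+1 x.
    apply/funext => x; have [_ h2] := base k a; have [_ h3] := h2 j x.
    by rewrite /partial h3; ring.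
  exact: FC_add (FC_base _ _) (FC_base _ _).
have -> : partial j (fun x => f x + g x) = fun x => partial j f x + partial j g x.
  have [_ df] := reg _ pf; have [_ dg] := reg _ pg.
  by apply/funext => x; rewrite /partial deriveD.
exact: FC_add.
Qed.

End flat_affine.

Definition open_box (a b : V) : set V := [set x | forall i, a 0 i < x 0 i < b 0 i].
Definition closed_box (a b : V) : set V := [set x | forall i, a 0 i <= x 0 i <= b 0 i].

(** The arguments are in the affine form of [smooth_flat_affine]; [bumpE] is the readable form. The
    factor [n.+1] makes the bumps tend to the indicator of the open box. *)
Definition bump (n : nat) (a b x : V) : R :=
  \prod_(i < N) (flat 0 (n.+1%:R * x 0 i + - (n.+1%:R * a 0 i)) *
                 flat 0 (- n.+1%:R * x 0 i + n.+1%:R * b 0 i)).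

Lemma bumpE n a b x : bump n a b x =
  \prod_(i < N) (flat 0 (n.+1%:R * (x 0 i - a 0 i)) * flat 0 (n.+1%:R * (b 0 i - x 0 i))).
Proof.
by rewrite /bump; apply: eq_bigr => i _; congr (flat 0 _ * flat 0 _); ring.
Qed.

Lemma smooth_bump n a b : smooth (bump n a b).
Proof.
by apply: smooth_prod => i; apply: smoothM; exact: smooth_flat_affine.
Qed.

Lemma flat0_le1 (x : R) : flat 0 x <= 1.
Proof.
rewrite /flat; case: ifPn => // x0; rewrite expr0 mul1r.
by rewrite -expR0 ler_expR oppr_le0 invr_ge0 ltW.
Qed.

Lemma flat_gt0 m (x : R) : 0 < x -> 0 < flat m x.
Proof. by move=> x0; rewrite /flat x0 mulr_gt0 ?expR_gt0// exprn_gt0// invr_gt0. Qed.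

Lemma flat_le0 m (x : R) : x <= 0 -> flat m x = 0.
Proof. by move=> x0; rewrite /flat ltNge x0. Qed.

Lemma bump_ge0 n a b x : 0 <= bump n a b x.
Proof. by apply: prodr_ge0 => i _; rewrite mulr_ge0// flat_ge0. Qed.

Lemma bump_le1 n a b x : bump n a b x <= 1.
Proof.
apply: prodr_ile1 => i _; rewrite mulr_ge0 ?flat_ge0//=.
by rewrite mulr_ile1 ?flat_ge0 ?flat0_le1.
Qed.

Lemma bump_gt0 n a b x : open_box a b x -> 0 < bump n a b x.
Proof.
move=> abx; rewrite bumpE; apply: prodr_gt0 => i _; have /andP[h1 h2] := abx i.
by rewrite mulr_gt0// flat_gt0// mulr_gt0// subr_gt0.
Qed.

Lemma bump_eq0 n a b x : ~ open_box a b x -> bump n a b x = 0.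
Proof.
move=> /existsNP[i]; apply: contra_notP => bn0.
have : flat 0 (n.+1%:R * (x 0 i - a 0 i)) * flat 0 (n.+1%:R * (b 0 i - x 0 i)) != 0.
  by apply: contra_not_neq bn0 => h; rewrite bumpE (bigD1 i)//= h mul0r.
rewrite mulf_eq0 negb_or => /andP[h1 h2]; apply/andP; split.
  rewrite ltNge; apply: contra_neqN h1 => xa; apply: flat_le0.
  by rewrite mulr_ge0_le0// subr_le0.
rewrite ltNge; apply: contra_neqN h2 => xa; apply: flat_le0.
by rewrite mulr_ge0_le0// subr_le0.
Qed.

Lemma closed_closed_box a b : closed (closed_box a b).
Proof.
have -> : closed_box a b =
    \bigcap_(i in [set: 'I_N]) ((fun x : V => x 0 i) @^-1` `[a 0 i, b 0 i]%classic).
  apply/seteqP; split => x h i => [_|]; first by rewrite /= in_itv/=; exact: h.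
  by have := h i I; rewrite /= in_itv.
apply: closed_bigI => i _; apply: closed_comp; last exact: interval_closed.
by move=> x _; exact: coord_continuous.
Qed.

Lemma open_open_box a b : open (open_box a b).
Proof.
have -> : open_box a b = [set x | forall i : 'I_N, x 0 i \in `]a 0 i, b 0 i[].
  by apply/seteqP; split => x h i; have := h i; rewrite in_itv.
rewrite openE => x /= h; rewrite /interior.
pose S (i : 'I_N) : set V := [set x | x 0 i \in `]a 0 i, b 0 i[].
have Si i : nbhs x (S i).
  have io : nbhs (x 0 i) [set` `]a 0 i, b 0 i[].
    by apply: open_nbhs_nbhs; split; [exact: interval_open|exact: h].
  exact: (@coord_continuous R 1 N 0 i x _ io).
exact: (@filter_forall V _ S (nbhs x) (nbhs_filter x) Si).
Qed.

Lemma bounded_closed_box a b : bounded_set (closed_box a b).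
Proof.
exists (`|a| + `|b|); split; first exact: num_real.
move=> M hM x abx /=; apply: ltW; apply: le_lt_trans hM.
apply: rV_norm_le => [|i]; first by rewrite addr_ge0.
have /andP[h1 h2] := abx i; have := coord_le_norm a i; have := coord_le_norm b i.
rewrite !ler_norml => /andP[b1 b2] /andP[a1 a2]; apply/andP.
by have := normr_ge0 a; have := normr_ge0 b; split; lra.
Qed.

Lemma compact_closed_box a b : compact (closed_box a b).
Proof.
apply: bounded_closed_compact; [exact: bounded_closed_box|exact: closed_closed_box].
Qed.

Lemma bump_support n a b : closed_support (bump n a b) `<=` closed_box a b.
Proof.
rewrite /closed_support; move/closure_id : (@closed_closed_box a b) => ->.
apply: closure_subset => x /=; apply: contra_neqP => h; apply: bump_eq0.
by apply: contra_not h => abx i; have /andP[h1 h2] := abx i; rewrite !ltW.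
Qed.

Lemma test_function_bump n a b (Omega : set V) : closed_box a b `<=` Omega ->
  test_function Omega (bump n a b).
Proof.
move=> abO; split; first exact: smooth_bump.
  apply: (subclosed_compact _ (compact_closed_box (a:=a) (b:=b))).
    exact: closed_closure.
  exact: bump_support.
exact: subset_trans (@bump_support _ _ _) abO.
Qed.

Lemma cvg_flat0 (c : R) : 0 < c -> flat 0 (n.+1%:R * c) @[n --> \oo] --> (1 : R).
Proof.
move=> c0; rewrite (_ : (fun n => _) = (fun n => expR (- (n.+1%:R^-1 * c^-1)))).
  rewrite -[X in _ --> X]expR0.
  apply: continuous_cvg; first exact: continuous_expR.
  rewrite -[X in _ --> X]oppr0 -[X in _ --> - X](mul0r (c^-1)).
  apply: cvgN; apply: cvgM; last exact: cvg_cst.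
  exact: cvg_harmonic.
by apply/funext => n; rewrite /flat mulr_gt0// expr0 mul1r invfM.
Qed.

Lemma cvg_bump a b x :
  bump n a b x @[n --> \oo] --> (\1_(open_box a b) x : R).
Proof.
have [abx|abx] := pselect (open_box a b x); last first.
  rewrite indicE memNset//= (_ : (fun n => _) = fun=> 0); first exact: cvg_cst.
  by apply/funext => n; rewrite bump_eq0.
rewrite indicE mem_set//=.
rewrite (_ : (fun n => _) = fun n => \prod_(i < N) (flat 0 (n.+1%:R * (x 0 i - a 0 i)) *
  flat 0 (n.+1%:R * (b 0 i - x 0 i)))); last by apply/funext => n; exact: bumpE.
rewrite -[X in _ --> X](@big1_eq _ _ *%R 'I_N (index_enum 'I_N) xpredT).
apply: cvg_big => [|i _]; first exact: mul_continuous.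
have /andP[h1 h2] := abx i.
rewrite -[X in _ --> X]mulr1; apply: cvgM.
  by apply: cvg_flat0; rewrite subr_gt0.
by apply: cvg_flat0; rewrite subr_gt0.
Qed.

End bumps.

(** * Subdomains and extension by zero *)

Section restriction.
Context d (T : measurableType d) (R : realType).
Variable mu : {measure set T -> \bar R}.
Implicit Types (A D : set T) (u v : T -> R).

Lemma sqint_sub D D' u : measurable D -> measurable D' -> D `<=` D' ->
  sqint mu D' u -> sqint mu D u.
Proof.
move=> mD mD' DD' [m i]; split; first exact: measurable_funS mD' DD' m.
apply: le_lt_trans i; apply: ge0_subset_integral => //.
- by apply/measurable_EFinP; exact: measurable_funX.
- by move=> x _; rewrite lee_fin sqr_ge0.
Qed.

Lemma nrm_sub D D' u : measurable D -> measurable D' -> D `<=` D' ->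
  sqint mu D' u -> nrm mu D u <= nrm mu D' u.
Proof.
move=> mD mD' DD' su; have su' := sqint_sub mD mD' DD' su.
rewrite ler_wsqrtr// -lee_fin ipE// ipE//; apply: ge0_subset_integral => //.
- by apply/measurable_EFinP; apply: measurable_funX; have [] := su.
- by move=> x _; rewrite lee_fin sqr_ge0.
Qed.

Lemma sqint_patch D u : measurable D -> sqint mu D u <-> sqint mu setT (u \_ D).
Proof.
move=> mD; have E : (\int[mu]_(x in D) ((u x) ^+ 2)%:E = \int[mu]_x (((u \_ D) x) ^+ 2)%:E)%E.
  rewrite integral_mkcond; apply: eq_integral => x _; rewrite !patchE.
  by case: ifPn => //; rewrite expr0n.
have mE := @measurable_restrict _ _ T R D setT u mD measurableT.
rewrite setTI in mE; rewrite /sqint E; split => -[h1 h2]; split => //.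
  by apply: mE.1.
by apply: mE.2.
Qed.

Lemma ip_patch D u v : ip mu D u v = ip mu setT (u \_ D) v.
Proof.
rewrite /ip Rintegral_mkcond; apply: eq_Rintegral => x _; rewrite !patchE.
by case: ifPn => //; rewrite mul0r.
Qed.

Lemma nrm_patch D u : nrm mu D u = nrm mu setT (u \_ D).
Proof.
rewrite /nrm /ip Rintegral_mkcond; congr (Num.sqrt _); apply: eq_Rintegral => x _.
by rewrite !patchE; case: ifPn => //; rewrite mul0r.
Qed.

Lemma sqint_indic A (c : R) : measurable A -> (mu A < +oo)%E ->
  sqint mu setT (fun x => c * \1_A x).
Proof.
move=> mA Aoo; have : sqint mu A (cst c).
  by apply: (@bounded_sqint _ _ _ _ _ mA _ `|c|) => //; exact: measurable_cst.
move/(sqint_patch (cst c) mA).1; congr (sqint mu setT _).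
apply/funext => x; rewrite patchE indicE; case: ifPn => _; first by rewrite mulr1.
by rewrite mulr0.
Qed.

Lemma nrm_indic A (c : R) : measurable A -> (mu A < +oo)%E ->
  nrm mu setT (fun x => c * \1_A x) = `|c| * Num.sqrt (fine (mu A)).
Proof.
move=> mA Aoo; have -> : (fun x => c * \1_A x) = (cst c) \_ A.
  apply/funext => x; rewrite patchE indicE; case: ifPn => _; first by rewrite mulr1.
  by rewrite mulr0.
rewrite -nrm_patch /nrm (_ : ip mu A _ _ = c ^+ 2 * fine (mu A)).
  by rewrite sqrtrM ?sqr_ge0// sqrtr_sqr.
rewrite -(Rintegral_cst _ mA); apply: eq_Rintegral => x _; by rewrite expr2.
Qed.

End restriction.

(** * Test functions and integration by parts *)

Section test_functions.
Context (R : realType) (N : nat).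
Local Notation V := 'rV[R]_N.
Local Notation mu := (@lebesgue R N).
Local Notation e_ i := (delta_mx 0 i : V).
Implicit Types (f g phi psi u v w : V -> R) (x a : V) (D Omega : set V).

Lemma closed_support_sub f x : f x != 0 -> closed_support f x.
Proof. by move=> fx; apply: subset_closure. Qed.

Lemma notin_support f x : ~ closed_support f x -> f x = 0.
Proof. by apply: contra_notP => /eqP; exact: closed_support_sub. Qed.

Lemma test_functionS Omega D phi : Omega `<=` D ->
  test_function Omega phi -> test_function D phi.
Proof. by move=> OD [h1 h2 h3]; split => //; exact: subset_trans OD. Qed.

Lemma test_smooth Omega phi : test_function Omega phi -> smooth phi.
Proof. by case. Qed.

Lemma test_continuous Omega phi : test_function Omega phi -> continuous phi.
Proof. by move=> [/smooth_continuous]. Qed.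

Lemma test_notin Omega phi x : test_function Omega phi -> ~ Omega x -> phi x = 0.
Proof. by move=> [_ _ sO] Ox; apply: notin_support => /sO. Qed.

Lemma closed_support_partial phi i : closed_support (partial i phi) `<=` closed_support phi.
Proof.
have cl : closed (closed_support phi) by exact: closed_closure.
rewrite [X in _ `<=` X](closure_id _).1//.
apply: closure_subset => x /= px; apply: contrapT => nx.
have : \forall y \near x, phi y = 0.
  have : nbhs x (~` closed_support phi).
    by apply: open_nbhs_nbhs; split => //; exact: closed_openC.
  by apply: filterS => y; exact: notin_support.
move=> n0; move/eqP : px; apply.
by rewrite /partial (@near_eq_derive _ _ _ phi (cst 0) x (e_ i) n0) derive_cst.
Qed.

Lemma test_partial Omega phi i : test_function Omega phi ->
  test_function Omega (partial i phi).
Proof.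
move=> [s c sO]; split; first exact: smooth_partial.
  apply: (subclosed_compact _ c); first exact: closed_closure.
  exact: closed_support_partial.
by apply: subset_trans sO; exact: closed_support_partial.
Qed.

Lemma closed_supportD f g :
  closed_support (fun x => f x + g x) `<=` closed_support f `|` closed_support g.
Proof.
rewrite /closed_support -closureU; apply: closure_subset => x /=.
by case: (eqVneq (f x) 0) => [->|]; [rewrite add0r; right|left].
Qed.

Lemma testD Omega phi psi : test_function Omega phi -> test_function Omega psi ->
  test_function Omega (fun x => phi x + psi x).
Proof.
move=> [s1 c1 o1] [s2 c2 o2]; split; first exact: smoothD.
  apply: (subclosed_compact _ (compactU c1 c2)); first exact: closed_closure.
  exact: closed_supportD.
by move=> x /closed_supportD[/o1|/o2].
Qed.

Lemma testZ Omega (c : R) phi : test_function Omega phi ->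
  test_function Omega (fun x => c * phi x).
Proof.
move=> [s1 c1 o1].
have sub : closed_support (fun x => c * phi x) `<=` closed_support phi.
  by apply: closure_subset => x /=; rewrite mulf_eq0 negb_or => /andP[].
split; first exact: smoothM (smooth_cst c) s1.
  by apply: (subclosed_compact _ c1) => //; exact: closed_closure.
exact: subset_trans sub o1.
Qed.

Lemma test0 Omega : test_function Omega (fun=> 0).
Proof.
have -> : (fun _ : V => 0 : R) = fun x => 0 * bump 0 0 0 x.
  by apply/funext => x; rewrite mul0r.
have e : closed_support (fun x : V => 0 * bump 0 0 0 x) = set0.
  rewrite /closed_support (_ : [set x | _] = set0) ?closure0//.
  by apply/seteqP; split => x //=; rewrite mul0r eqxx.
split; first exact: smoothM (smooth_cst 0) (smooth_bump _ _ _).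
  by rewrite e; exact: compact0.
by rewrite e.
Qed.

Lemma continuous_addl a : continuous (fun x : V => a + x).
Proof.
rewrite (_ : (fun x : V => a + x) = fun x => x + a).
  by move=> x; exact: (cvgD cvg_id (cvg_cst _)).
by apply/funext => x; rewrite addrC.
Qed.

Lemma test_translate Omega phi a : test_function Omega phi ->
  (forall x, closed_support phi (a + x) -> Omega x) ->
  test_function Omega (fun x => phi (a + x)).
Proof.
move=> [s c o] ha.
have sub : closed_support (fun x => phi (a + x)) `<=` [set x | closed_support phi (a + x)].
  have cl : closed [set x | closed_support phi (a + x)].
    apply: (@closed_comp _ _ (fun x => a + x)); last exact: closed_closure.
    by move=> x _; exact: continuous_addl.
  rewrite [X in _ `<=` X](closure_id _).1//.
  by apply: closure_subset => x /=; exact: closed_support_sub.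
split.
- have := smooth_translate a s.
  by rewrite (_ : (fun x => phi (x + a)) = fun x => phi (a + x))//; apply/funext => x; rewrite addrC.
- have ck : compact ((fun y => y - a) @` closed_support phi).
    apply: continuous_compact => //; apply: continuous_subspaceT => x.
    by exact: (cvgB cvg_id (cvg_cst a)).
  apply: (subclosed_compact _ ck); first exact: closed_closure.
  by move=> x /sub /= h; exists (a + x) => //; rewrite addrC addKr.
- by move=> x /sub /= /ha.
Qed.

Lemma partial_translateC phi a i :
  partial i (fun x => phi (a + x)) = fun x => partial i phi (a + x).
Proof.
have := partial_translate phi a i.
rewrite (_ : (fun x => phi (x + a)) = fun x => phi (a + x)); last by apply/funext => x; rewrite addrC.
by move=> ->; apply/funext => x; rewrite addrC.
Qed.

Lemma test_support_bounded Omega phi : test_function Omega phi ->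
  exists r : R, 0 < r /\ forall x, phi x != 0 -> cube r x.
Proof.
move=> [_ c _]; have [M [_ hM]] := compact_bounded c.
exists (`|M| + 2); split; first by rewrite ltr_wpDl.
move=> x /closed_support_sub sx i; apply: le_lt_trans (coord_le_norm x i) _.
have : M < `|M| + 1 by apply: le_lt_trans (ler_norm M) _; rewrite ltrDl.
by move=> /hM /(_ _ sx) /= /le_lt_trans; apply; rewrite ltrD2l ltr1n.
Qed.

Lemma test_bounded Omega phi : test_function Omega phi ->
  exists M : R, 0 < M /\ forall x, `|phi x| <= M.
Proof.
move=> tp; have [_ c _] := tp; have cp := test_continuous tp.
have cimg : compact (phi @` closed_support phi).
  by apply: continuous_compact => //; exact: continuous_subspaceT.
have [M [_ hM]] := compact_bounded cimg.
exists (`|M| + 1); split; first by rewrite ltr_wpDl.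
move=> x; have [sx|/notin_support->] := pselect (closed_support phi x); last first.
  by rewrite normr0 addr_ge0.
have /hM : M < `|M| + 1 by apply: le_lt_trans (ler_norm M) _; rewrite ltrDl.
by apply; exists x.
Qed.


Lemma test_dominated Omega phi : test_function Omega phi ->
  exists r M : R, [/\ 0 < r, 0 < M & forall x, `|phi x| <= M * \1_(cube r : set V) x].
Proof.
move=> tp; have [r [r0 rP]] := test_support_bounded tp.
have [M [M0 MP]] := test_bounded tp; exists r, M; split => // x.
have [->|/rP xr] := eqVneq (phi x) 0.
  by rewrite normr0 mulr_ge0 ?(ltW M0)// indicE.
by rewrite indicE mem_set// mulr1.
Qed.

Lemma measurable_cube (r : R) : 0 < r -> measurable (cube r : set (euclid R N)).
Proof. by move=> r0; exact/open_measurable_euclid/open_cube. Qed.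

Lemma sqint_cube (r c : R) : 0 < r ->
  sqint mu [set: euclid R N] (fun x => c * \1_(cube r : set V) x).
Proof.
move=> r0; have roo : (mu (cube r) < +oo)%E by rewrite lebesgue_cube// ltry.
exact: (@sqint_indic _ (euclid R N) R mu (cube r) c (measurable_cube r0) roo).
Qed.

Lemma test_sqintT Omega phi : test_function Omega phi -> sqint mu [set: euclid R N] phi.
Proof.
move=> tp; have [r [M [r0 M0 MP]]] := test_dominated tp.
have mphi := @continuous_measurable_euclid R N setT phi (test_continuous tp).
apply: (@le_sqint _ (euclid R N) R mu setT measurableT phi _ mphi (sqint_cube M r0)).
by move=> x _; apply: le_trans (MP x) (ler_norm _).
Qed.

Lemma test_sqint Omega phi (D : set (euclid R N)) : measurable D ->
  test_function Omega phi -> sqint mu D phi.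
Proof.
move=> mD /test_sqintT.
exact: (@sqint_sub _ (euclid R N) R mu D setT phi mD measurableT (@subsetT _ D)).
Qed.

Lemma nrm_shift (u : V -> R) a : measurable_fun [set: euclid R N] u ->
  nrm mu [set: euclid R N] (fun x => u (a + x)) = nrm mu [set: euclid R N] u.
Proof.
move=> mu_; congr (Num.sqrt _).
have m2 : measurable_fun [set: euclid R N] (fun x : euclid R N => u x * u x).
  exact: measurable_funM.
have := Rintegral_shift a m2; rewrite /ip => <-.
by apply: eq_Rintegral => x _; rewrite addrC.
Qed.

Lemma ip_shift (u v : V -> R) a : measurable_fun [set: euclid R N] u ->
  measurable_fun [set: euclid R N] v ->
  ip mu [set: euclid R N] u (fun x => v (a + x)) =
  ip mu [set: euclid R N] (fun x => u (- a + x)) v.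
Proof.
move=> mu_ mv.
have mau : measurable_fun [set: euclid R N] (fun x : euclid R N => u (- a + (x : V))).
  have := measurableT_comp mu_ (measurable_shift (- a)).
  by congr (measurable_fun _ _); apply/funext => x /=; rewrite addrC.
have m2 : measurable_fun [set: euclid R N] (fun x : euclid R N => u (- a + (x : V)) * v x).
  exact: measurable_funM.
have := Rintegral_shift a m2; rewrite /ip => <-.
by apply: eq_Rintegral => x _; rewrite addrC -(addrC a) addKr.
Qed.

(** Differentiation under the integral sign. All derivatives fall on the test function, so [U] may
    be any square integrable function. *)
Lemma is_derive_ip_shift (U : V -> R) Omega phi i (t : R) :
  sqint mu [set: euclid R N] U -> test_function Omega phi ->
  is_derive t (1 : R)
    (fun s : R => ip mu [set: euclid R N] U (fun x => phi (s *: e_ i + x)))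
    (ip mu [set: euclid R N] U (fun x => partial i phi (t *: e_ i + x))).
Proof.
move=> sU tphi; have tpp := test_partial i tphi.
have [r [M [r0 M0 MP]]] := test_dominated tpp.
pose f (s : R) (x : euclid R N) : R := U x * phi (s *: e_ i + (x : V)).
have tsh s : sqint mu [set: euclid R N] (fun x : V => phi (s *: e_ i + x)).
  by apply: (@test_sqintT setT); apply: test_translate => //; exact: test_functionS tphi.
have intf s : `]t - 1, t + 1[%classic s -> mu.-integrable [set: euclid R N] (EFin \o f s).
  move=> _; exact: (@sqint_mul_integrable _ (euclid R N) R mu setT measurableT U _ sU (tsh s)).
have ider s x : is_derive s (1 : R) (f ^~ x) (U x * partial i phi (s *: e_ i + x)).
  have d := @smooth_derivable R N phi i (s *: e_ i + (x : V)) (test_smooth tphi).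
  exact: (is_deriveZ (U x) (is_derive_along d)).
have der s x : `]t - 1, t + 1[%classic s -> [set: euclid R N] x -> derivable (f ^~ x) s 1.
  by move=> _ _; have [] := ider s x.
have d1E s x : partial1of2 f s x = U x * partial i phi (s *: e_ i + x).
  by rewrite partial1of2E; have [] := ider s x.
(* For s within 1 of t, the translates of a function supported in [cube r] are all supported in
   [cube r'], which gives a common dominating function. *)
pose r' := r + (`|t| + 1).
have r'0 : 0 < r' by rewrite ltr_wpDr// addr_ge0.
pose G (x : euclid R N) : R := `|U x| * (M * \1_(cube r' : set V) x).
have G0 x : 0 <= G x by rewrite /G !mulr_ge0 ?(ltW M0)// indicE.
have iG : mu.-integrable [set: euclid R N] (EFin \o G).
  have sN := @sqint_norm _ (euclid R N) R mu setT measurableT U sU.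
  exact: (@sqint_mul_integrable _ (euclid R N) R mu setT measurableT _ _ sN (sqint_cube M r'0)).
have Gub s x : `]t - 1, t + 1[%classic s -> [set: euclid R N] x -> `|partial1of2 f s x| <= G x.
  rewrite /= in_itv/= => /andP[s1 s2] _; rewrite d1E normrM /G ler_wpM2l//.
  apply: le_trans (MP _) _; rewrite ler_wpM2l ?(ltW M0)// !indicE.
  have [h|h] := pselect (cube r (s *: e_ i + x)); last by rewrite (memNset h).
  rewrite (mem_set h) mem_set// => j.
  have := h j; have := norm_delta i s; have := coord_le_norm (s *: e_ i) j.
  rewrite /r' !mxE; set a := s * _; set b := (x : V) 0 j => h1 h2 h3.
  have : `|s| <= `|t| + 1.
    by have := ler_norm t; have := ler_norm (- t); rewrite normrN ler_norml => ? ?; apply/andP; split; lra.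
  have := ler_normD (- a) (a + b); rewrite addKr normrN; lra.
have It : `]t - 1, t + 1[%classic t by rewrite /= in_itv/=; apply/andP; split; lra.
have D1 := @derivable_under_integral R _ (euclid R N) mu f setT measurableT t _ _ It intf der G G0 iG Gub.
have D2 := @differentiation_under_integral R _ (euclid R N) mu f setT measurableT t _ _ It intf der G G0 iG Gub.
split; first exact: D1.
rewrite -derive1E; apply: eq_trans D2 _.
by apply: eq_Rintegral => x _; rewrite d1E.
Qed.

(** Translating one factor by s is the same as translating the other by -s; differentiating this
    identity at s = 0 gives the formula, minus sign included. *)
Lemma integration_by_parts_test Omega phi psi i :
  test_function Omega phi -> test_function Omega psi ->
  ip mu [set: euclid R N] phi (partial i psi) = - ip mu [set: euclid R N] (partial i phi) psi.
Proof.
move=> tphi tpsi; have sphi := test_sqintT tphi; have spsi := test_sqintT tpsi.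
have [mphi _] := sphi; have [mpsi _] := spsi.
have d1 := is_derive_ip_shift i 0 sphi tpsi.
have d2 := is_derive_ip_shift i 0 spsi tphi.
have E : (fun s : R => ip mu [set: euclid R N] phi (fun x => psi (s *: e_ i + x))) =
    (fun s : R => ip mu [set: euclid R N] psi (fun x => phi (s *: e_ i + x))) \o -%R.
  apply/funext => s /=; rewrite ip_shift// ipC; congr (ip mu _ _ _).
  by apply/funext => x; rewrite scaleNr.
rewrite E in d1.
have d2' : is_derive (- (0 : R)) (1 : R)
    (fun s : R => ip mu [set: euclid R N] psi (fun x => phi (s *: e_ i + x)))
    (ip mu [set: euclid R N] psi (fun x => partial i phi (0 *: e_ i + x))).
  rewrite oppr0; exact: d2.
have d3 := @is_derive1_comp R _ (fun s : R => - s) 0 _ _ d2' (is_deriveNid (0 : R) (1 : R)).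
have /esym := @derive_val _ _ _ _ _ _ _ d3.
have := @derive_val _ _ _ _ _ _ _ d1 => -> /esym; rewrite mulrN1.
have E0 (h : V -> R) : (fun x : V => h (0 *: e_ i + x)) = h.
  by apply/funext => x; rewrite scale0r add0r.
rewrite !E0 => ->; rewrite ipC; reflexivity.
Qed.

End test_functions.

Lemma cst_cvg_eq (R : realType) (l c : R) : (fun _ : nat => c) @ \oo --> l -> l = c.
Proof. by move=> h; rewrite -(cvg_lim (@Rhausdorff R) h) lim_cst. Qed.

(** * Duality against test functions *)

Section hilbert.
Context d (T : measurableType d) (R : realType).
Variables (mu : {measure set T -> \bar R}) (D : set T) (mD : measurable D).
Local Notation sqint := (sqint mu D).
Local Notation ip := (ip mu D).
Local Notation nrm := (nrm mu D).
Implicit Types (f g u v w : T -> R).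

Lemma ip_dominated_cvg u (f : nat -> T -> R) g v : sqint u -> sqint v ->
  (forall n, measurable_fun D (f n)) -> measurable_fun D g ->
  (forall n x, D x -> `|f n x| <= `|v x|) ->
  (forall x, D x -> f n x @[n --> \oo] --> g x) ->
  ip u (f n) @[n --> \oo] --> ip u g.
Proof.
move=> su sv mf mg fv fg; have [mu_ _] := su.
have iv := sqint_mul_integrable mD (sqint_norm mD su) (sqint_norm mD sv).
have [||||ig _ cv] := @dominated_convergence _ _ _ mu D mD
  (fun n x => (u x * f n x)%:E) (fun x => (u x * g x)%:E) _ _ _ _ iv.
- by move=> n; apply/measurable_EFinP; exact: measurable_funM.
- by apply/measurable_EFinP; exact: measurable_funM.
- apply: aeW => x Dx; apply: cvg_EFin; first exact: nearW.
  by apply: cvgM; [exact: cvg_cst|exact: fg].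
- apply: aeW => x n Dx /=; rewrite lee_fin normrM ler_wpM2l//; exact: fv.
by apply: fine_cvg; rewrite /ip /Rintegral fineK//; exact: (integrable_fin_num mD ig).
Qed.

Lemma nrm_cvg_ip (w : nat -> T -> R) g f : (forall n, sqint (w n)) -> sqint g -> sqint f ->
  nrm (fun x => w n x - g x) @[n --> \oo] --> 0 ->
  ip (w n) f @[n --> \oo] --> ip g f.
Proof.
move=> sw sg sf wg; apply/cvgrPdist_le => e e0.
have f0 : 0 < nrm f + 1 by rewrite ltr_wpDl// nrm_ge0.
have /cvgrPdist_le/(_ (e / (nrm f + 1))) := wg; rewrite divr_gt0// => /(_ isT).
apply: filterS => n; rewrite sub0r normrN ger0_norm ?nrm_ge0// => h.
rewrite distrC -ipBl//; have swg := sqintB mD (sw n) sg.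
apply: le_trans (cauchy_schwarz mD swg sf) _.
apply: (@le_trans _ _ (e / (nrm f + 1) * (nrm f + 1))).
  by apply: ler_pM => //; rewrite ?nrm_ge0// lerDl.
by rewrite divfK ?gt_eqF.
Qed.

Lemma nrm_cvg_nrm (w : nat -> T -> R) g : (forall n, sqint (w n)) -> sqint g ->
  nrm (fun x => w n x - g x) @[n --> \oo] --> 0 -> nrm (w n) @[n --> \oo] --> nrm g.
Proof.
move=> sw sg /cvgrPdist_le wg; apply/cvgrPdist_le => e /wg; apply: filterS => n.
rewrite sub0r normrN ger0_norm ?nrm_ge0//; apply: le_trans.
by rewrite distrC; exact: nrm_dist.
Qed.

(* The representative is the limit of a minimising sequence of [|f|^2 / 2 - L f]. *)
Lemma riesz_representation (S : set (T -> R)) (L : (T -> R) -> R) (K : R) :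
  S (fun=> 0) -> (forall f, S f -> sqint f) ->
  (forall f g, S f -> S g -> S (fun x => f x + g x)) ->
  (forall (c : R) f, S f -> S (fun x => c * f x)) ->
  (forall f g, S f -> S g -> L (fun x => f x + g x) = L f + L g) ->
  (forall (c : R) f, S f -> L (fun x => c * f x) = c * L f) ->
  0 <= K -> (forall f, S f -> `|L f| <= K * nrm f) ->
  exists g, [/\ sqint g, nrm g <= K & forall f, S f -> ip g f = L f].
Proof.
move=> S0 Ssq SD SZ LD LZ K0 LK.
pose q f := ip f f / 2 - L f.
pose mid f g : T -> R := fun x => 2^-1 * (f x + g x).
(* With the factor 1/8 the parallelogram law for [q] is an equality, the linear part cancelling. The
   lower bound passed below is the minimum of n^2/2 - K n. *)
pose gap f g := ip (fun x => f x - g x) (fun x => f x - g x) / 8.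
have [|||||w [Sw wmin _ wgap]] := @nested_minimisation R (T -> R) (fun=> S) q mid gap
    (- (K ^+ 2 / 2)) 0.
- by move=> _ f.
- by move=> _ f g Sf Sg; apply: SZ; exact: SD.
- move=> f g Sf Sg; have sf := Ssq _ Sf; have sg := Ssq _ Sg.
  have sfg := sqintD mD sf sg; have sfz := sqintZ mD 2^-1 sfg; have sfb := sqintB mD sf sg.
  rewrite /q /mid /gap LZ ?LD//; last exact: SD.
  rewrite ipZl// ipZr// ipBl// !ipBr// ipDl// !ipDr// (ipC _ _ g f); lra.
- move=> f Sf; have := LK _ Sf; have := nrm_ge0 mu D f.
  rewrite /q -sqr_nrm ler_norml => n0 /andP[_ l2].
  have := sqr_ge0 (nrm f - K); nra.
- move=> n; exists (fun=> 0) => //; rewrite /q.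
  have l0 : L (fun=> 0) = 0.
    by have := LZ 0 _ S0; rewrite !mul0r.
  have i0 : ip (fun=> 0) (fun=> 0) = 0.
    transitivity (\int[mu]_(x in D) (0 : R)); last by rewrite Rintegral_cst// mul0r.
    by apply: eq_Rintegral => x _; rewrite mul0r.
  by rewrite l0 i0 mul0r subrr.
have sw n : sqint (w n) by exact: Ssq.
have [|g [sg wg _]] := sqint_complete mD sw.
  move=> e e0; have [|n0 n0P] := wgap (e ^+ 2 / 8); first by rewrite divr_gt0// exprn_gt0.
  exists n0 => n m n0n n0m; have := n0P _ _ n0n n0m; rewrite /gap -sqr_nrm.
  rewrite ltr_pM2r ?invr_gt0// => h.
  by rewrite -(@ltr_pXn2r _ 2)// ?nnegrE ?nrm_ge0// ltW.
have gL f : S f -> ip g f = L f.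
  move=> Sf; have sf := Ssq _ Sf.
  (* [w n] is minimal up to 1/(n+1) against the competitor [w n + t f]. In the limit a quadratic in
     t without constant term is nonnegative for every t, which forces its linear coefficient to
     vanish. *)
  have key t : 0 <= t * (ip g f - L f) + t ^+ 2 / 2 * ip f f.
    have st := sqintZ mD t sf.
    have le n : 0 <= t * (ip (w n) f - L f) + t ^+ 2 / 2 * ip f f + n.+1%:R^-1.
      have := wmin n (fun x => w n x + t * f x) (SD _ _ (Sw n) (SZ t _ Sf)).
      have swt := sqintD mD (sw n) st.
      rewrite /q LD ?LZ//; last exact: SZ.
      rewrite ipDl// !ipDr// !ipZl// !ipZr// (ipC _ _ f (w n)).
      set c := n.+1%:R^-1; clearbody c; nra.
    have cv : t * (ip (w n) f - L f) + t ^+ 2 / 2 * ip f f + n.+1%:R^-1 @[n --> \oo] -->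
        t * (ip g f - L f) + t ^+ 2 / 2 * ip f f + 0.
      apply: cvgD; last exact: cvg_harmonic.
      apply: cvgD; last exact: cvg_cst.
      apply: cvgM; first exact: cvg_cst.
      by apply: cvgB; [exact: nrm_cvg_ip|exact: cvg_cst].
    rewrite addr0 in cv; apply: (cvgr_to_ge cv); exact: nearW.
  set a := ip g f - L f in key; suff : a = 0 by move=> /eqP; rewrite subr_eq0 => /eqP.
  have f0 := ip_ge0 mu D f.
  have := key (- a / (ip f f + 1)).
  have -> : - a / (ip f f + 1) * a + (- a / (ip f f + 1)) ^+ 2 / 2 * ip f f =
    - (a ^+ 2 * ((ip f f + 2) / (2 * (ip f f + 1) ^+ 2))).
    by field; rewrite gt_eqF//; lra.
  rewrite oppr_ge0 => h; apply/eqP; rewrite -sqrf_eq0 eq_le sqr_ge0 andbT.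
  move: h; rewrite pmulr_lle0// divr_gt0//; first lra.
  by rewrite mulr_gt0// exprn_gt0//; lra.
exists g; split => //.
(* (g, g) is the limit of (g, w n) = L (w n), and the latter is at most K times the norm of
   [w n]. *)
have : ip g g <= K * nrm g.
  have cv1 := nrm_cvg_ip sw sg sg wg.
  have cv2 : K * nrm (w n) @[n --> \oo] --> K * nrm g.
    by apply: cvgM; [exact: cvg_cst|exact: nrm_cvg_nrm].
  apply: (ler_cvg_to cv1 cv2); apply: nearW => n.
  by rewrite ipC gL//; apply: le_trans (ler_norm _) (LK _ _).
rewrite -sqr_nrm expr2; have := nrm_ge0 mu D g; rewrite le_eqVlt => /orP[/eqP <-//|g0].
by rewrite ler_pM2r.
Qed.

Lemma ip_indic_le u (A : set T) (e : R) : measurable A -> A `<=` D -> sqint u ->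
  0 <= e -> (mu A <= e%:E)%E -> `|ip u (\1_A : T -> R)| <= nrm u * Num.sqrt e.
Proof.
move=> mA AD su e0 Ae; have Aoo : (mu A < +oo)%E by apply: le_lt_trans Ae _; rewrite ltry.
have E : (fun x => 1 * \1_A x) = (\1_A : T -> R) by apply/funext => x; rewrite mul1r.
have sA' := sqint_indic 1 mA Aoo; have nA := nrm_indic 1 mA Aoo.
rewrite E in sA' nA.
have sA := sqint_sub mD measurableT (@subsetT _ D) sA'.
apply: le_trans (cauchy_schwarz mD su sA) _; rewrite ler_wpM2l ?nrm_ge0//.
apply: le_trans (nrm_sub mD measurableT (@subsetT _ D) sA') _.
rewrite nA normr1 mul1r ler_wsqrtr// -lee_fin fineK// ge0_fin_numE//.
Qed.

(** Let A be the part of Q where the function is positive and C in [B] a slightly larger set. The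
    integral over the intersection of Q and C is 0, so the integral over A is minus that over a set
    of measure at most e, hence at most a multiple of sqrt e. The argument is run for [w] and for
    its opposite. *)
Lemma ae_eq0_of_outer_regular w (Q : set T) (B : set (set T)) :
  sqint w -> measurable Q -> Q `<=` D -> (mu Q < +oo)%E ->
  (forall A, B A -> measurable A) ->
  (forall A (e : R), measurable A -> A `<=` Q -> 0 < e ->
     exists C, [/\ B C, A `<=` C & (mu C <= mu A + e%:E)%E]) ->
  (forall A, B A -> ip w (\1_(Q `&` A) : T -> R) = 0) ->
  {ae mu, forall x, Q x -> w x = 0}.
Proof.
move=> sw mQ QD Qoo mB reg w0.
have sI A : measurable A -> A `<=` Q -> sqint (\1_A : T -> R).
  move=> mA AQ; have Aoo : (mu A < +oo)%E.
    by apply: le_lt_trans (le_measure _ _ _ _) Qoo; rewrite ?inE.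
  have := sqint_sub mD measurableT (@subsetT _ D) (sqint_indic 1 mA Aoo).
  by rewrite (_ : (fun x => 1 * _) = \1_A)//; apply/funext => x; rewrite mul1r.
suff half v : sqint v -> (forall A, B A -> ip v (\1_(Q `&` A) : T -> R) = 0) ->
    {ae mu, forall x, Q x -> v x <= 0}.
  have h1 := half w sw w0.
  have h2 : {ae mu, forall x, Q x -> - w x <= 0}.
    apply: (half (fun x => - w x) (sqintN mD sw)) => A BA.
    by rewrite ipNl ?w0 ?oppr0//; apply: sI => //; apply: measurableI => //; exact: mB.
  apply: filterS2 h1 h2 => x a b Qx.
  by apply/eqP; rewrite eq_le a//= -oppr_le0 b.
move=> sv v0; have [mv _] := sv.
pose A := Q `&` [set x | 0 < v x].
have AQ : A `<=` Q by exact: subIsetl.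
have mA : measurable A.
  rewrite (_ : A = Q `&` v @^-1` `]0, +oo[%classic).
    by apply: (measurable_funS mD QD mv) => //; exact: measurable_itv.
  by apply/seteqP; split => x [Qx h]; split => //; move: h; rewrite /= in_itv/= andbT.
have Aoo : (mu A < +oo)%E by apply: le_lt_trans (le_measure _ _ _ _) Qoo; rewrite ?inE.
have le (e : R) : 0 < e -> ip v (\1_A : T -> R) <= nrm v * Num.sqrt e.
  move=> e0; have [C [BC AC muC]] := reg A e mA AQ e0; have mC := mB _ BC.
  have mQC := measurableI _ _ mQ mC.
  have mrest := measurableD mQC mA.
  have restQ : (Q `&` C) `\` A `<=` Q by move=> x [[]].
  have E : (\1_(Q `&` C) : T -> R) = fun x => \1_A x + \1_((Q `&` C) `\` A) x.
    apply/funext => x; rewrite !indicE; have [Ax|nAx] := pselect (A x).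
      rewrite (mem_set Ax) (@mem_set _ (Q `&` C) x); last by split; [exact: AQ|exact: AC].
      by rewrite memNset ?addr0// => -[].
    rewrite (memNset nAx) add0r; congr (_%:R); congr nat_of_bool.
    by apply/idP/idP; rewrite !inE => h; [split|have [] := h].
  have := v0 C BC; rewrite E ipDr//; [|exact: sI|exact: sI].
  move=> /eqP; rewrite addr_eq0 => /eqP ->.
  apply: le_trans (ler_norm _) _; rewrite normrN; apply: ip_indic_le => //.
  - exact: subset_trans QD.
  - exact: ltW.
  rewrite measureD//; last first.
    by apply: le_lt_trans (le_measure _ _ _ _) Qoo; rewrite ?inE.
  have -> : Q `&` C `&` A = A.
    by apply/seteqP; split => x; [case|move=> Ax; split => //; split; [exact: AQ|exact: AC]].
  rewrite leeBlDr ?ge0_fin_numE// addeC; apply: le_trans muC.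
  by apply: le_measure; rewrite ?inE// => x [].
have z : ip v (\1_A : T -> R) = 0.
  apply/eqP; rewrite eq_le; apply/andP; split; last first.
    apply: Rintegral_ge0 => x Dx; rewrite indicE.
    have [Ax|nAx] := pselect (A x); last by rewrite memNset// mulr0.
    by rewrite mem_set// mulr1; have [_ /ltW] := Ax.
  apply/ler_addgt0Pr => e e0; rewrite add0r.
  have n0 : 0 < nrm v + 1 by rewrite ltr_wpDl// nrm_ge0.
  have e1 : 0 < (e / (nrm v + 1)) ^+ 2 by rewrite exprn_gt0// divr_gt0.
  apply: le_trans (le _ e1) _; rewrite sqrtr_sqr ger0_norm; last by rewrite ltW// divr_gt0.
  by rewrite mulrA ler_pdivrMr// mulrC ler_wpM2l ?(ltW e0)// lerDl.
have svA : sqint (\1_A : T -> R) by exact: sI.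
have iv := sqint_mul_integrable mD sv svA.
have [mvA _] := integrableP _ _ _ iv.
have aez : ae_eq mu D (EFin \o (fun x => v x * \1_A x)) (cst 0%E).
  apply/ae_eq_integral_abs => //.
  transitivity (\int[mu]_(x in D) (v x * \1_A x)%:E)%E; last first.
    rewrite -[LHS]fineK; first by rewrite -[fine _]/(ip v \1_A) z.
    exact: (integrable_fin_num mD iv).
  apply: eq_integral => x _ /=; rewrite indicE.
  have [Ax|nAx] := pselect (A x); last by rewrite memNset// mulr0 normr0.
  by rewrite mem_set// mulr1 ger0_norm//; have [_ /ltW] := Ax.
apply: filterS aez => x /= h Qx; rewrite leNgt; apply/negP => vx.
have := h (QD _ Qx); rewrite indicE mem_set ?mulr1//.
by move=> -[] vx0; rewrite vx0 ltxx in vx.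
Qed.

End hilbert.

(** * From test functions to boxes, Borel sets and measurable sets *)

Section fundamental_lemma.
Context (R : realType) (N : nat).
Local Notation V := 'rV[R]_N.
Local Notation mR := (measurableTypeR R).
Local Notation mu := (@lebesgue R N).

Definition tuple_box (a b : V) : set (N.-tuple mR) :=
  [set t | forall i, a 0 i < tnth t i < b 0 i].

Definition boxes : set (set (N.-tuple mR)) :=
  [set A | exists a b : V, A = tuple_box a b].

Lemma row_tuple_box (a b : V) : @tuple_of_row R N @^-1` tuple_box a b = open_box a b.
Proof. by apply/seteqP; split => x h i; have := h i; rewrite tnth_mktuple. Qed.

Lemma open_boxI (a b a' b' : V) : open_box a b `&` open_box a' b' =
  open_box (\row_i Num.max (a 0 i) (a' 0 i)) (\row_i Num.min (b 0 i) (b' 0 i)).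
Proof.
apply/seteqP; split => x; first move=> [h h'] i.
  by rewrite !mxE gt_max lt_min; have /andP[-> ->] := h i; have /andP[-> ->] := h' i.
by move=> h; split => i; have := h i; rewrite !mxE gt_max lt_min => /andP[/andP[? ?] /andP[? ?]];
  apply/andP.
Qed.

Lemma boxes_setI : setI_closed boxes.
Proof.
move=> _ _ [a [b ->]] [a' [b' ->]].
exists (\row_i Num.max (a 0 i) (a' 0 i)), (\row_i Num.min (b 0 i) (b' 0 i)).
apply: (can_inj (@preimage_row_of_tuple R N)); rewrite preimage_setI !row_tuple_box.
exact: open_boxI.
Qed.

Lemma measurable_tuple_box (a b : V) : measurable (tuple_box a b).
Proof.
have -> : tuple_box a b = \bigcap_(i in [set: 'I_N])
    ((fun t => tnth t i) @^-1` (`]a 0 i, b 0 i[%classic : set mR)).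
  apply/seteqP; split => x h i => [_|]; first by rewrite /= in_itv/=; exact: h.
  by have := h i I; rewrite /= in_itv.
apply: fin_bigcap_measurable; first exact: finite_finset.
by move=> i _; rewrite -[X in measurable X]setTI; apply: measurable_tnth => //; exact: measurable_itv.
Qed.

(** A half-space in one coordinate is a countable union of growing boxes, so the coordinate
    projections are measurable for the sigma-algebra generated by boxes. *)
Lemma boxes_generate (A : set (N.-tuple mR)) : measurable A -> <<s boxes >> A.
Proof.
move=> mA.
suff mid_ : measurable_fun [set: g_sigma_algebraType boxes]
    (id : g_sigma_algebraType boxes -> N.-tuple mR).
  by have := mid_ measurableT A mA; rewrite setTI.
apply/measurable_fun_tnthP => i.
move=> mT; apply: (measurability _ (RGenOInfty.measurableE R)) => //.
move=> _ [_ [x ->] <-]; rewrite setTI.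
pose a k : V := \row_j (if j == i then x else - k.+1%:R).
pose b k : V := \row_j k.+1%:R.
have -> : (@tnth N mR ^~ i \o id) @^-1` `]x, +oo[%classic = \bigcup_k tuple_box (a k) (b k).
  apply/seteqP; split => t.
    rewrite /= in_itv/= andbT => txy.
    exists (Num.bound `|@row_of_tuple R N t|) => // j; rewrite !mxE.
    have : `|tnth t j| < (Num.bound `|@row_of_tuple R N t|).+1%:R.
      have := coord_le_norm (@row_of_tuple R N t) j.
      have := archi_boundP (normr_ge0 (@row_of_tuple R N t)).
      rewrite mxE => h1 h2; apply: le_lt_trans h2 (lt_le_trans h1 _).
      by rewrite ler_nat.
    by rewrite ltr_norml => /andP[h1 h2]; apply/andP; split => //; case: eqP => [->|].
  by move=> [k _ /(_ i)]; rewrite !mxE eqxx /= in_itv/= andbT => /andP[].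
apply: (@bigcupT_measurable _ (g_sigma_algebraType boxes)) => k.
by apply: sub_sigma_algebra; exists (a k), (b k).
Qed.

(* The du Bois-Reymond lemma. *)
Lemma ae_eq0_of_orthogonal (Omega : set V) (w : V -> R) : open Omega ->
  sqint mu Omega w -> (forall phi, test_function Omega phi -> ip mu Omega w phi = 0) ->
  ae_on Omega (fun x => w x = 0).
Proof.
move=> oO sw w0.
have mO : measurable (Omega : set (euclid R N)) by exact: open_measurable_euclid.
have [mw _] := sw.
(* The indicator of the box is the dominated limit of the bumps, which are test functions in
   [Omega]. *)
have box0 a b : closed_box a b `<=` Omega -> ip mu Omega w (\1_(open_box a b) : V -> R) = 0.
  move=> abO.
  have [r [r0 abr]] : exists r : R, 0 < r /\ open_box a b `<=` cube r.
    have [M [_ hM]] := bounded_closed_box a b.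
    exists (`|M| + 2); split; first by rewrite ltr_wpDl.
    move=> x abx i; apply: le_lt_trans (coord_le_norm x i) _.
    have : M < `|M| + 1 by apply: le_lt_trans (ler_norm M) _; rewrite ltrDl.
    move=> /hM /(_ x) /= h; apply: le_lt_trans (h _) _; last by rewrite ltrD2l ltr1n.
    by move=> j; have /andP[h1 h2] := abx j; rewrite !ltW.
  have sc := sqint_sub mO measurableT (@subsetT _ Omega) (sqint_cube N 1 r0).
  have mb : measurable (open_box a b : set (euclid R N)).
    exact/open_measurable_euclid/open_open_box.
  have mbump n : measurable_fun (Omega : set (euclid R N)) (bump n a b : euclid R N -> R).
    exact: continuous_measurable_euclid (smooth_continuous (smooth_bump n a b)).
  have mind : measurable_fun (Omega : set (euclid R N)) (\1_(open_box a b) : euclid R N -> R).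
    exact: measurable_indic.
  have dom n x : Omega x -> `|bump n a b x| <= `|1 * \1_(cube r : set V) x : R|.
    move=> _; rewrite ger0_norm ?bump_ge0// mul1r indicE.
    have [abx|abx] := pselect (open_box a b x); last by rewrite bump_eq0.
    by rewrite (mem_set (abr _ abx)) normr1 bump_le1.
  have cvb x : Omega x -> bump n a b x @[n --> \oo] --> (\1_(open_box a b) x : R).
    by move=> _; exact: cvg_bump.
  have cv := @ip_dominated_cvg _ (euclid R N) R mu Omega mO w (fun n => bump n a b)
    (\1_(open_box a b)) _ sw sc mbump mind dom cvb.
  have z : (fun n => ip mu Omega w (bump n a b)) = fun=> 0.
    by apply/funext => n; apply: w0; exact: test_function_bump.
  rewrite z in cv; exact: cst_cvg_eq cv.
have onbox a b : closed_box a b `<=` Omega -> {ae mu, forall x, open_box a b x -> w x = 0}.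
  move=> abO; pose Q : set (euclid R N) := open_box a b.
  have mQ : measurable Q by exact/open_measurable_euclid/open_open_box.
  have Qc : open_box a b `<=` closed_box a b.
    by move=> x h i; have /andP[h1 h2] := h i; rewrite !ltW.
  have QO : Q `<=` Omega by apply: subset_trans abO; exact: Qc.
  have Qoo : (mu Q < +oo)%E.
    apply: le_lt_trans (lebesgue_bounded_lty (@bounded_closed_box R N a b)).
    exact: le_outer_measure Qc.
  (* The Borel sets, from which Lebesgue measurable sets are reached by outer approximation. *)
  pose B : set (set (euclid R N)) :=
    [set C | exists2 A : set (N.-tuple mR), measurable A & C = @tuple_of_row R N @^-1` A].
  have mB C : B C -> measurable C.
    move=> [A mA ->]; rewrite -[X in measurable X]setTI.
    exact: (measurable_tuple_of_row measurableT mA).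
  have reg A (e : R) : measurable A -> A `<=` Q -> 0 < e ->
      exists C, [/\ B C, A `<=` C & (mu C <= mu A + e%:E)%E].
    move=> mA AQ e0; have Aoo : (mu A < +oo)%E.
      by apply: le_lt_trans Qoo; exact: le_outer_measure.
    have [C [mC AC Ce]] := borel_approximation e0 Aoo.
    by exists (@tuple_of_row R N @^-1` C); split => //; exists C.
  have sI A : measurable A -> sqint mu Omega (\1_(Q `&` A) : V -> R).
    move=> mA; have mQA := measurableI _ _ mQ mA.
    have oo : (mu (Q `&` A) < +oo)%E.
      by apply: le_lt_trans Qoo; apply: le_outer_measure; exact: subIsetl.
    have := sqint_sub mO measurableT (@subsetT _ Omega) (sqint_indic 1 mQA oo).
    by rewrite (_ : (fun x => 1 * _) = \1_(Q `&` A))//; apply/funext => x; rewrite mul1r.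
  (* The sets against which [w] integrates to 0 inside the fixed box [Q] form a lambda-system, and
     boxes are stable under intersection: Dynkin's theorem extends orthogonality from boxes to Borel
     sets. *)
  pose H : set (set (N.-tuple mR)) := [set A | measurable A /\
    ip mu Omega w (\1_(Q `&` @tuple_of_row R N @^-1` A) : V -> R) = 0].
  have mP A : measurable A -> measurable (@tuple_of_row R N @^-1` A : set (euclid R N)).
    by move=> mA; apply: mB; exists A.
  have HT : <<s boxes >> `<=` H.
    apply: (@lambda_system_subset _ boxes boxes_setI setT) => //.
    - split => //.
      + split; first exact: measurableT.
        by rewrite preimage_setT setIT; exact: box0.
      + move=> A C CA [mA hA] [mC hC]; split; first exact: measurableD.
        have E : (\1_(Q `&` @tuple_of_row R N @^-1` A) : V -> R) = fun x =>
            \1_(Q `&` @tuple_of_row R N @^-1` C) x +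
            \1_(Q `&` @tuple_of_row R N @^-1` (A `\` C)) x.
          apply/funext => x; rewrite !indicE.
          have [Qx|nQ] := pselect (Q x); last first.
            by rewrite !memNset ?addr0// => -[].
          have [Cx|nC] := pselect (C (tuple_of_row x)).
            rewrite (@mem_set _ (Q `&` _ @^-1` C) x)// (@mem_set _ (Q `&` _ @^-1` A) x).
              by rewrite memNset ?addr0// => -[_ []].
            by split => //; exact: CA.
          rewrite (@memNset _ (Q `&` _ @^-1` C) x); last by case.
          rewrite add0r; congr (_%:R); congr nat_of_bool.
          by apply/idP/idP; rewrite !inE; [move=> [q h]; split => //; split|move=> [q [h _]]; split].
        move: hA; rewrite E (ipDr mO (sI _ (mP _ mC)) (sI _ (mP _ (measurableD mA mC))) sw).
        by rewrite hC add0r.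
      + move=> F ndF HF; split.
          by apply: bigcupT_measurable => k; have [] := HF k.
        have sQ := sI _ (@measurableT _ (euclid R N)).
        have mF k : measurable_fun (Omega : set (euclid R N))
            (\1_(Q `&` @tuple_of_row R N @^-1` F k) : euclid R N -> R).
          by apply: measurable_indic; apply: measurableI => //; apply: mP; have [] := HF k.
        have mU : measurable_fun (Omega : set (euclid R N))
            (\1_(Q `&` @tuple_of_row R N @^-1` (\bigcup_k F k)) : euclid R N -> R).
          apply: measurable_indic; apply: measurableI => //; apply: mP.
          by apply: bigcupT_measurable => k; have [] := HF k.
        have dom k x : Omega x -> `|\1_(Q `&` @tuple_of_row R N @^-1` F k) x : R| <=
            `|\1_(Q `&` setT) x|.
          move=> _; rewrite !indicE setIT.
          have [Qx|nQ] := pselect (Q x); last by rewrite !memNset ?normr0// => -[].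
          by rewrite (mem_set Qx) normr1; case: (_ \in _); rewrite ?normr1 ?normr0.
        have cvx x : Omega x -> (\1_(Q `&` @tuple_of_row R N @^-1` F k) x : R) @[k --> \oo] -->
            (\1_(Q `&` @tuple_of_row R N @^-1` (\bigcup_k F k)) x : R).
          move=> _; have [[Qx [k0 _ Fx]]|nU] :=
              pselect ((Q `&` @tuple_of_row R N @^-1` (\bigcup_k F k)) x).
            rewrite [X in _ --> X]indicE mem_set; last by split => //; exists k0.
            apply: cvg_near_cst; exists k0 => // k /= kk0; rewrite indicE mem_set//.
            split => //; have /subsetPset := ndF _ _ kk0; apply; exact: Fx.
          rewrite [X in _ --> X]indicE memNset//.
          apply: cvg_near_cst; apply: nearW => k; rewrite indicE memNset// => -[Qx Fx].
          by apply: nU; split => //; exists k.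
        have := @ip_dominated_cvg _ (euclid R N) R mu Omega mO w _ _ _ sw sQ mF mU dom cvx.
        rewrite (_ : (fun k => ip mu Omega w _) = fun=> 0); last first.
          by apply/funext => k; have [] := HF k.
        by move=> cv; exact: cst_cvg_eq cv.
    - move=> _ [c [c' ->]]; split; first exact: measurable_tuple_box.
      rewrite row_tuple_box open_boxI; apply: box0; apply: subset_trans abO => x h i.
      by have := h i; rewrite !mxE ge_max le_min => /andP[/andP[-> _] /andP[-> _]].
  apply: (@ae_eq0_of_outer_regular _ (euclid R N) R mu Omega mO w Q B sw mQ QO Qoo mB reg).
  by move=> _ [A mA ->]; have [] := HT A (boxes_generate mA).
(* Omega is a countable union of open boxes whose closures lie in it. *)
pose U (k : nat) : set (euclid R N) :=
  if unpickle k is Some qr then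
    if pselect (closed_box (map_mx ratr qr.1) (map_mx ratr qr.2 : V) `<=` Omega)
    then open_box (map_mx ratr qr.1) (map_mx ratr (qr.2 : 'rV[rat]_N)) else set0
  else set0.
have nU k : mu.-negligible [set x | U k x /\ w x != 0].
  rewrite /U; case: (unpickle k) => [[q q']|]; last first.
    by rewrite (_ : [set x | _] = set0)//; [exact: negligible_set0|apply/seteqP; split => x []].
  case: (pselect _) => /= sub; last first.
    by rewrite (_ : [set x | _] = set0)//; [exact: negligible_set0|apply/seteqP; split => x []].
  apply: negligibleS (onbox _ _ sub) => x /= [bx wx] /(_ bx) w0x.
  by rewrite w0x eqxx in wx.
apply: negligibleS (negligible_bigcup nU) => x /= /not_implyP[Ox /eqP wx].
have /nbhs_ballP[e /= e0 eO] : nbhs (x : V) Omega by exact: open_nbhs_nbhs.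
have e20 : 0 < e / 2 by rewrite divr_gt0.
pose h : V := const_mx (e / 4).
have e40 : 0 < e / 4 by rewrite divr_gt0.
have [q hq] := rational_dense (x - h) e40; have [q' hq'] := rational_dense (x + h) e40.
have bq j : x 0 j - e / 2 < ratr (q 0 j) < x 0 j /\ x 0 j < ratr (q' 0 j) < x 0 j + e / 2.
  have := le_lt_trans (coord_le_norm _ j) hq; have := le_lt_trans (coord_le_norm _ j) hq'.
  by rewrite !mxE !ltr_norml => /andP[? ?] /andP[? ?]; split; apply/andP; split; lra.
exists (pickle (q, q')) => //; rewrite /U pickleK; case: (pselect _) => [sub|[]] /=.
  by split => // j; rewrite !mxE; have [/andP[_ ->] /andP[->]] := bq j.
move=> y by_; apply: eO; rewrite mx_norm_ball /ball_ /=; apply: rV_norm_lt => // j.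
have := by_ j; have [/andP[h1 h2] /andP[h3 h4]] := bq j; rewrite !mxE => /andP[h5 h6].
by rewrite ltr_norml; apply/andP; split; lra.
Qed.

End fundamental_lemma.

(** The derivative is a two-sided limit, so increments to the right of 0 already determine it. *)
Lemma derive_bound (R : realType) (G : R -> R) (c K d : R) :
  is_derive (0 : R) (1 : R) G c -> 0 < d ->
  (forall t, 0 < t -> t < d -> `|G t - G 0| <= t * K) -> `|c| <= K.
Proof.
move=> [dG <-] d0 GK; rewrite leNgt; apply/negP => Kc.
have cG : (fun h : R => h^-1 *: ((G \o shift 0) (h *: 1) - G 0)) @ 0^' --> 'D_1 G 0.
  exact: dG.
move/cvgrPdist_lt : cG => /(_ (`|'D_1 G 0| - K)); rewrite subr_gt0 => /(_ Kc).
move=> /nbhs_ballP[r /= r0 rP].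
pose t := Num.min r d / 2.
have m0 : 0 < Num.min r d by rewrite lt_min r0.
have t0 : 0 < t by rewrite divr_gt0.
have tm : t < Num.min r d by rewrite ltr_pdivrMr// ltr_pMr// ltr1n.
have [tr td] : t < r /\ t < d by move: tm; rewrite lt_min => /andP[].
have := rP t; rewrite /ball/= sub0r normrN gtr0_norm// => /(_ tr).
rewrite gt_eqF// => /(_ isT); rewrite addr0 [t *: 1]mulr1.
have q : `|t^-1 *: (G t - G 0)| <= K.
  by rewrite normrZ normfV gtr0_norm// mulrC ler_pdivrMr// mulrC GK.
have := ler_distD (t^-1 *: (G t - G 0)) ('D_1 G 0) 0; rewrite !subr0 => h1 h2.
by have := le_lt_trans h1 (ltr_leD h2 q); rewrite subrK ltxx.
Qed.

(** * Weak derivatives *)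

Section ae_generic.
Context d (T : measurableType d) (R : realType).
Variables (mu : {measure set T -> \bar R}) (D : set T).
Implicit Types (P Q S : T -> Prop) (u : T -> R).

Lemma ae_in_mono2 P Q S : (forall x, D x -> P x -> Q x -> S x) ->
  {ae mu, forall x, D x -> P x} -> {ae mu, forall x, D x -> Q x} ->
  {ae mu, forall x, D x -> S x}.
Proof. by move=> h hP hQ; apply: filterS2 hP hQ => x p q Dx; exact: h (p Dx) (q Dx). Qed.

Lemma ae_in_forall (I : countType) (P : I -> T -> Prop) :
  (forall i, {ae mu, forall x, D x -> P i x}) ->
  {ae mu, forall x, D x -> forall i, P i x}.
Proof.
move=> h.
have h' (n : nat) : mu.-negligible
    [set x | ~ (forall i, unpickle n = Some i -> D x -> P i x)].
  case E : (unpickle n) => [i|].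
    have := h i; apply: negligibleS => x /= np hx; apply: np => j [<-]; exact: hx.
  have z : mu.-negligible (set0 : set T) by exact: negligible_set0.
  apply: negligibleS z => x /= np; apply: np => j; discriminate.
apply: negligibleS (negligible_bigcup h') => x /= np.
apply: contrapT => nb; apply: np => Dx i; apply: contrapT => nP; apply: nb.
exists (pickle i) => //= /(_ i); rewrite pickleK => /(_ erefl Dx); exact: nP.
Qed.

Lemma integral_sum_sqr (I : finType) (F : I -> T -> R) : measurable D ->
  (forall i, sqint mu D (F i)) ->
  (\int[mu]_(x in D) (\sum_i (F i x) ^+ 2)%:E = (\sum_i nrm mu D (F i) ^+ 2)%:E)%E.
Proof.
move=> mD sF; under eq_integral do rewrite -sumEFin.
rewrite ge0_integral_sum//; last 2 first.
- by move=> i; have [mg _] := sF i; apply/measurable_EFinP; exact: measurable_funX.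
- by move=> i x _; rewrite lee_fin sqr_ge0.
by rewrite -sumEFin; apply: eq_bigr => i _; rewrite sqr_nrm// ipE.
Qed.

Lemma integrable_sum_sqr (I : finType) (F : I -> T -> R) : measurable D ->
  (forall i, sqint mu D (F i)) ->
  mu.-integrable D (fun x => (\sum_i (F i x) ^+ 2)%:E).
Proof.
move=> mD sF; under eq_fun do rewrite -sumEFin.
by apply: integrable_sum => // i _; exact: sqint_integrable_sqr.
Qed.

Lemma integral_sqrD u (w : T -> R) : measurable D -> sqint mu D u ->
  mu.-integrable D (EFin \o w) -> (forall x, 0 <= w x) ->
  (\int[mu]_(x in D) (u x ^+ 2 + w x)%:E =
   (nrm mu D u ^+ 2)%:E + \int[mu]_(x in D) (w x)%:E)%E.
Proof.
move=> mD su iw w0; under eq_integral do rewrite EFinD.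
rewrite integralD//; last exact: sqint_integrable_sqr.
by rewrite sqr_nrm// ipE.
Qed.

End ae_generic.

Section ae_on.
Context (R : realType) (N : nat) (Omega : set 'rV[R]_N).
Implicit Types P Q S : 'rV[R]_N -> Prop.

Lemma ae_on2 P Q S : (forall x, Omega x -> P x -> Q x -> S x) ->
  ae_on Omega P -> ae_on Omega Q -> ae_on Omega S.
Proof. have h := @ae_in_mono2 _ (euclid R N) R (@lebesgue R N) Omega P Q S; exact: h. Qed.

Lemma ae_on_mono P Q : (forall x, Omega x -> P x -> Q x) -> ae_on Omega P -> ae_on Omega Q.
Proof. by move=> h hP; apply: (ae_on2 _ hP hP) => x Ox px _; exact: h. Qed.

Lemma ae_on_forall (I : countType) (P : I -> 'rV[R]_N -> Prop) :
  (forall i, ae_on Omega (P i)) -> ae_on Omega (fun x => forall i, P i x).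
Proof. have h := @ae_in_forall _ (euclid R N) R (@lebesgue R N) Omega I P; exact: h. Qed.

Lemma ae_on_true P : (forall x, Omega x -> P x) -> ae_on Omega P.
Proof. move=> h; have := @aeW _ (euclid R N) R (@lebesgue R N) _ h; exact. Qed.

End ae_on.

Section compact_margin.
Context (R : realType) (N : nat).
Local Notation V := 'rV[R]_N.

(** Each point of [K] has a neighbourhood with its own margin, half the radius of a ball inside
    [Omega]; compactness makes the margin uniform. *)
Lemma compact_margin (K Omega : set V) : compact K -> open Omega -> K `<=` Omega ->
  exists d : R, 0 < d /\ forall x y, K x -> `|x - y| < d -> Omega y.
Proof.
move=> cK oO KO.
have /compact_near_coveringP ncK := cK.
have := @ncK R (0 : R)^'+ (fun d x => forall y, `|x - y| < d -> Omega y) _ _.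
have h x : K x -> \forall x' \near x & d \near (0 : R)^'+, forall y, `|x' - y| < d -> Omega y.
  move=> /KO Ox; have /nbhs_ballP[e /= e0 eO] : nbhs x Omega by exact: open_nbhs_nbhs.
  exists (ball x (e / 2), [set d | d < e / 2]) => /=.
    split; first by apply: nbhsx_ballx; rewrite divr_gt0.
    by apply: nbhs_right_lt; rewrite divr_gt0.
  move=> [x' d] /= [bx' de] y xy; apply: eO.
  rewrite mx_norm_ball /ball_ /= in bx' *.
  by have := ler_distD x' x y; lra.
move=> /(_ _ h) [d0 /= d00 dP]; exists (d0 / 2); split; first by rewrite divr_gt0.
move=> x y Kx xy; apply: (dP (d0 / 2)) xy => //; last by rewrite divr_gt0.
by rewrite /ball_ /= sub0r normrN gtr0_norm ?divr_gt0// ltr_pdivrMr// ltr_pMr// ltr1n.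
Qed.

End compact_margin.

Section weak_derivatives.
Context (R : realType) (N : nat).
Local Notation V := 'rV[R]_N.
Local Notation mu := (@lebesgue R N).
Local Notation e_ i := (delta_mx 0 i : V).
Local Notation setE := [set: euclid R N].
Variables (Omega : set V) (oO : open Omega).
Implicit Types (u v w g phi psi : V -> R) (i : 'I_N).
Local Notation sqO := (sqint mu Omega).
Local Notation ipO := (ip mu Omega).
Local Notation nrmO := (nrm mu Omega).

Let mO : measurable (Omega : set (euclid R N)).
Proof. exact: open_measurable_euclid. Qed.

Lemma sqOD u v : sqO u -> sqO v -> sqO (fun x => u x + v x).
Proof. by move=> su sv; have h := sqintD mO su sv; exact: h. Qed.

Lemma sqOB u v : sqO u -> sqO v -> sqO (fun x => u x - v x).
Proof. by move=> su sv; have h := sqintB mO su sv; exact: h. Qed.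

Lemma test_sqO phi : test_function Omega phi -> sqO phi.
Proof. exact: test_sqint. Qed.

Lemma patch_test phi : test_function Omega phi -> phi \_ Omega = phi.
Proof.
move=> t; apply/funext => x; rewrite patchE; case: ifPn => //.
by move=> /negP; rewrite inE => /(test_notin t) ->.
Qed.

Lemma nrm_test phi : test_function Omega phi -> nrmO phi = nrm mu setE phi.
Proof. by move=> t; rewrite nrm_patch patch_test. Qed.

Lemma ip_test v phi : test_function Omega phi -> ipO v phi = ip mu setE v phi.
Proof. by move=> t; rewrite ipC ip_patch patch_test// ipC. Qed.

Lemma is_weak_partialE i u g : is_weak_partial Omega i u g <->
  forall phi, test_function Omega phi -> ipO u (partial i phi) = - ipO g phi.
Proof. by []. Qed.

(** The hypothesis says that phi |-> - (u, d_i phi) is bounded in L^2 on test functions; its Riesz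
    representative is by definition a weak derivative, and the bound [K] is inherited as a norm. *)
Lemma weak_partial_of_bound u i (K : R) : sqO u -> 0 <= K ->
  (forall phi, test_function Omega phi -> `|ipO u (partial i phi)| <= K * nrmO phi) ->
  exists g, [/\ sqO g, nrmO g <= K & is_weak_partial Omega i u g].
Proof.
move=> su K0 uK.
have [|||||g [sg gK gL]] := @riesz_representation _ (euclid R N) R mu Omega mO
    [set phi | test_function Omega phi] (fun phi => - ipO u (partial i phi)) K (test0 _)
    (fun f => @test_sqO f) _ _ _ _ K0.
- by move=> f g; exact: testD.
- by move=> c f; exact: testZ.
- move=> f g tf tg; rewrite (partialD _ (test_smooth tf) (test_smooth tg)).
  have sf := test_sqO (test_partial i tf); have sg := test_sqO (test_partial i tg).
  by rewrite (ipDr mO sf sg su) opprD.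
- move=> c f tf; rewrite (partialZ _ _ (test_smooth tf)).
  by rewrite (ipZr mO c (test_sqO (test_partial i tf)) su) mulrN.
- by move=> f tf; rewrite normrN; exact: uK.
by exists g; split => //; apply/is_weak_partialE => phi tphi; rewrite gL ?opprK.
Qed.

Lemma ae_eq_of_ip_test v w : sqO v -> sqO w ->
  (forall phi, test_function Omega phi -> ipO v phi = ipO w phi) ->
  ae_on Omega (fun x => v x = w x).
Proof.
move=> sv sw vw; have sd := sqOB sv sw.
have d0 phi : test_function Omega phi -> ipO (fun x => v x - w x) phi = 0.
  by move=> t; rewrite (ipBl mO sv sw (test_sqO t)) vw// subrr.
have h := ae_eq0_of_orthogonal oO sd d0.
by apply: ae_on_mono h => x _ /eqP; rewrite subr_eq0 => /eqP.
Qed.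

Lemma ae_eq_nrm v w : sqO v -> sqO w -> ae_on Omega (fun x => v x = w x) ->
  nrmO v = nrmO w.
Proof. by move=> sv sw vw; rewrite /nrm (ae_eq_ip mO sv sw sv sw vw vw). Qed.

(** The Riesz representative of phi |-> (w, phi) has norm at most [K] and agrees with [w] almost
    everywhere by the fundamental lemma; no separate density theorem is invoked. *)
Lemma nrm_le_dual w (K : R) : sqO w -> 0 <= K ->
  (forall phi, test_function Omega phi -> `|ipO w phi| <= K * nrmO phi) -> nrmO w <= K.
Proof.
move=> sw K0 wK.
have [||||g [sg gK gL]] := @riesz_representation _ (euclid R N) R mu Omega mO
    [set phi | test_function Omega phi] (fun phi => ipO w phi) K (test0 _)
    (fun f => @test_sqO f) _ _ _ _ K0 wK.
- by move=> f g; exact: testD.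
- by move=> c f; exact: testZ.
- by move=> f g tf tg; rewrite (ipDr mO (test_sqO tf) (test_sqO tg) sw).
- by move=> c f tf; rewrite (ipZr mO c (test_sqO tf) sw).
by rewrite -(ae_eq_nrm sg sw (ae_eq_of_ip_test sg sw gL)).
Qed.

Lemma weak_partial_unique i u g h : sqO g -> sqO h ->
  is_weak_partial Omega i u g -> is_weak_partial Omega i u h ->
  ae_on Omega (fun x => g x = h x).
Proof.
move=> sg sh /is_weak_partialE ug /is_weak_partialE uh.
apply: ae_eq_of_ip_test => // phi t; apply/eqP; rewrite -eqr_opp -ug// -uh//.
Qed.

Lemma wpartialP i u : (exists g, L2 Omega g /\ is_weak_partial Omega i u g) ->
  sqO (wpartial Omega i u) /\ is_weak_partial Omega i u (wpartial Omega i u).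
Proof.
move=> h; have := @xgetPex (V -> R) (fun=> 0)
  [set g | L2 Omega g /\ is_weak_partial Omega i u g] h.
by [].
Qed.

Lemma wpartial_unique i u g : sqO g -> is_weak_partial Omega i u g ->
  ae_on Omega (fun x => wpartial Omega i u x = g x).
Proof.
move=> sg ug; have [|s w] := @wpartialP i u; first by exists g.
exact: weak_partial_unique w ug.
Qed.

(** [wpartial] is a chosen representative; this lets its norm be computed from any weak derivative
    at hand. *)
Lemma nrm_wpartial i u g : sqO g -> is_weak_partial Omega i u g ->
  nrmO (wpartial Omega i u) = nrmO g.
Proof.
move=> sg ug; have [|s w] := @wpartialP i u; first by exists g.
exact: ae_eq_nrm (wpartial_unique sg ug).
Qed.

Lemma H1_sqO u : H1 Omega u -> sqO u. Proof. by case. Qed.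

Lemma H1_wpartial u i : H1 Omega u ->
  sqO (wpartial Omega i u) /\ is_weak_partial Omega i u (wpartial Omega i u).
Proof. by move=> [_ h]; exact: wpartialP. Qed.

Lemma is_weak_partialD i u v g h : sqO u -> sqO v -> sqO g -> sqO h ->
  is_weak_partial Omega i u g -> is_weak_partial Omega i v h ->
  is_weak_partial Omega i (fun x => u x + v x) (fun x => g x + h x).
Proof.
move=> su sv sg sh /is_weak_partialE ug /is_weak_partialE vh.
apply/is_weak_partialE => phi t.
have sp := test_sqO (test_partial i t); have st := test_sqO t.
by rewrite (ipDl mO su sv sp) (ipDl mO sg sh st) ug// vh// opprD.
Qed.

Lemma is_weak_partialB i u v g h : sqO u -> sqO v -> sqO g -> sqO h ->
  is_weak_partial Omega i u g -> is_weak_partial Omega i v h ->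
  is_weak_partial Omega i (fun x => u x - v x) (fun x => g x - h x).
Proof.
move=> su sv sg sh /is_weak_partialE ug /is_weak_partialE vh.
apply/is_weak_partialE => phi t.
have sp := test_sqO (test_partial i t); have st := test_sqO t.
by rewrite (ipBl mO su sv sp) (ipBl mO sg sh st) ug// vh// opprB opprK addrC.
Qed.

Lemma is_weak_partial_test i phi : test_function Omega phi ->
  is_weak_partial Omega i phi (partial i phi).
Proof.
move=> t; apply/is_weak_partialE => psi tpsi.
rewrite (ip_test _ (test_partial i tpsi)) (ip_test _ tpsi).
exact: integration_by_parts_test t tpsi.
Qed.

Lemma H1_test phi : test_function Omega phi -> H1 Omega phi.
Proof.
move=> t; split; first exact: test_sqO.
move=> i; exists (partial i phi); split; last exact: is_weak_partial_test.
exact: test_sqO (test_partial i t).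
Qed.

Lemma H1D u v : H1 Omega u -> H1 Omega v -> H1 Omega (fun x => u x + v x).
Proof.
move=> hu hv; have su := H1_sqO hu; have sv := H1_sqO hv.
split; first exact: sqOD su sv.
move=> i; have [sg ug] := H1_wpartial i hu; have [sh vh] := H1_wpartial i hv.
exists (fun x => wpartial Omega i u x + wpartial Omega i v x); split.
  exact: sqOD sg sh.
exact: is_weak_partialD su sv sg sh ug vh.
Qed.

Lemma H1B u v : H1 Omega u -> H1 Omega v -> H1 Omega (fun x => u x - v x).
Proof.
move=> hu hv; have su := H1_sqO hu; have sv := H1_sqO hv.
split; first exact: sqOB su sv.
move=> i; have [sg ug] := H1_wpartial i hu; have [sh vh] := H1_wpartial i hv.
exists (fun x => wpartial Omega i u x - wpartial Omega i v x); split.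
  exact: sqOB sg sh.
exact: is_weak_partialB su sv sg sh ug vh.
Qed.

Lemma nrm_wpartialD u v i : H1 Omega u -> H1 Omega v ->
  nrmO (wpartial Omega i (fun x => u x + v x)) =
  nrmO (fun x => wpartial Omega i u x + wpartial Omega i v x).
Proof.
move=> hu hv; have su := H1_sqO hu; have sv := H1_sqO hv.
have [sg ug] := H1_wpartial i hu; have [sh vh] := H1_wpartial i hv.
apply: nrm_wpartial; first exact: sqOD sg sh.
exact: is_weak_partialD su sv sg sh ug vh.
Qed.

Lemma nrm_wpartialB_test u phi i : H1 Omega u -> test_function Omega phi ->
  nrmO (wpartial Omega i (fun x => u x - phi x)) =
  nrmO (fun x => wpartial Omega i u x - partial i phi x).
Proof.
move=> hu t; have su := H1_sqO hu; have [sg ug] := H1_wpartial i hu.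
have sp := test_sqO (test_partial i t).
apply: nrm_wpartial; first exact: sqOB sg sp.
exact: is_weak_partialB su (test_sqO t) sg sp ug (is_weak_partial_test i t).
Qed.

Lemma integral_grad_sq u : H1 Omega u ->
  (\int[mu]_(x in Omega) (grad_sq Omega u x)%:E =
   (\sum_(i < N) nrmO (wpartial Omega i u) ^+ 2)%:E)%E.
Proof.
move=> hu; have sg i : sqO (wpartial Omega i u) by have [] := H1_wpartial i hu.
have h := integral_sum_sqr mO sg; exact: h.
Qed.

Lemma grad_sq_integrable u : H1 Omega u ->
  mu.-integrable Omega (EFin \o grad_sq Omega u).
Proof.
move=> hu; have sg i : sqO (wpartial Omega i u) by have [] := H1_wpartial i hu.
have h := integrable_sum_sqr mO sg; exact: h.
Qed.

Lemma H1_norm_sqE u : H1 Omega u ->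
  H1_norm_sq Omega u =
    (nrmO u ^+ 2 + \sum_(i < N) nrmO (wpartial Omega i u) ^+ 2)%:E.
Proof.
move=> hu; have su := H1_sqO hu.
have g0 x : 0 <= grad_sq Omega u x by rewrite sumr_ge0// => i _; exact: sqr_ge0.
have h := integral_sqrD mO su (grad_sq_integrable hu) g0.
by rewrite /H1_norm_sq h integral_grad_sq.
Qed.

(* This replaces the chain rule for [|u|] and Rademacher's theorem for Lipschitz
   functions. *)
Lemma difference_quotient_bound u i (K : R) phi : sqO u -> test_function Omega phi ->
  (exists2 d : R, 0 < d & forall t, 0 < t -> t < d ->
    `|ip mu setE (u \_ Omega) (fun x => phi (t *: e_ i + x)) - ipO u phi| <= t * K) ->
  `|ipO u (partial i phi)| <= K.
Proof.
move=> su t [d d0 dP].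
have sU := (@sqint_patch _ (euclid R N) R mu Omega u mO).1 su.
have dG := is_derive_ip_shift i 0 sU t.
have E0 (h : V -> R) : (fun x : V => h (0 *: e_ i + x)) = h.
  by apply/funext => x; rewrite scale0r add0r.
rewrite ip_patch; rewrite E0 in dG; apply: (derive_bound dG d0) => s s0 sd.
by rewrite E0 -(ip_patch mu Omega u phi); have h := dP s s0 sd; exact: h.
Qed.

(** Mean value theorem in the length of the translation: the derivative is - (g, translate of phi)
    as long as the translates remain test functions in [Omega]. *)
Lemma translation_bound u g i phi (t : R) : sqO u -> sqO g ->
  is_weak_partial Omega i u g -> 0 <= t ->
  (forall s, 0 <= s <= t -> test_function Omega (fun x => phi (s *: e_ i + x))) ->
  `|ip mu setE (u \_ Omega) (fun x => phi (t *: e_ i + x)) - ipO u phi| <=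
  t * (nrmO g * nrm mu setE phi).
Proof.
move=> su sg /is_weak_partialE ug t0 ht.
have E0 (h : V -> R) : (fun x : V => h (0 *: e_ i + x)) = h.
  by apply/funext => x; rewrite scale0r add0r.
have tphi : test_function Omega phi by have := ht 0; rewrite E0 lexx t0 => /(_ isT).
have sU := (@sqint_patch _ (euclid R N) R mu Omega u mO).1 su.
pose G s := ip mu setE (u \_ Omega) (fun x => phi (s *: e_ i + x)).
pose G' s := ip mu setE (u \_ Omega) (fun x => partial i phi (s *: e_ i + x)).
have dG s : is_derive s (1 : R) G (G' s) by exact: is_derive_ip_shift sU tphi.
have [sphi _] := test_sqintT tphi.
have G'le s : 0 <= s <= t -> `|G' s| <= nrmO g * nrm mu setE phi.
  move=> hs; have ts := ht _ hs.
  rewrite /G' -ip_patch -(partial_translateC phi (s *: e_ i) i) ug// normrN.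
  apply: le_trans (cauchy_schwarz mO sg (test_sqO ts)) _.
  by rewrite (nrm_test ts) (nrm_shift _ sphi).
move: t0; rewrite le_eqVlt => /orP[/eqP t0|t0].
  by rewrite -t0 mul0r E0 -ip_patch subrr normr0.
have cG : {within `[0, t], continuous G}.
  apply: continuous_subspaceT => x; apply: differentiable_continuous.
  by apply/derivable1_diffP; have [] := dG x.
have [c] := @MVT R G G' 0 t t0 (fun x _ => dG x) cG.
rewrite in_itv => /= /andP[c0 ct] Gc.
have -> : ipO u phi = G 0 by rewrite /G E0 -ip_patch.
rewrite -/(G t) Gc subr0 normrM mulrC (gtr0_norm t0) ler_wpM2l ?(ltW t0)//.
by apply: G'le; rewrite !ltW.
Qed.

End weak_derivatives.

(** * Translation estimates; absolute values and Lipschitz functions *)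

Section translations.
Context (R : realType) (N : nat).
Local Notation V := 'rV[R]_N.
Local Notation mu := (@lebesgue R N).
Local Notation e_ i := (delta_mx 0 i : V).
Local Notation setE := [set: euclid R N].
Implicit Types (u v w g phi psi : V -> R) (i : 'I_N).

Lemma margin_nbhd (K Omega : set V) : compact K -> open Omega -> K `<=` Omega ->
  exists (d : R) (W : set V), [/\ 0 < d, open W, K `<=` W &
    forall x y, W x -> `|x - y| < d -> Omega y].
Proof.
move=> cK oO KO; have [d [d0 dP]] := compact_margin cK oO KO.
have d2 : 0 < d / 2 by rewrite divr_gt0.
exists (d / 2), (\bigcup_(x in K) ball x (d / 2)); split => //.
- by apply: bigcup_open => x _; exact: ball_open.
- by move=> x Kx; exists x => //; exact: ballxx.
- move=> x y [z Kz]; rewrite mx_norm_ball /ball_ /= => zx xy; apply: (dP z) => //.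
  by have := ler_distD x z y; lra.
Qed.

Lemma measurable_shiftl u (a : V) : measurable_fun setE u ->
  measurable_fun setE (fun x => u (a + x)).
Proof.
move=> mu_; have := measurableT_comp mu_ (measurable_shift a).
by congr (measurable_fun _ _); apply/funext => x /=; rewrite addrC.
Qed.

Lemma sqint_shift u (a : V) : sqint mu setE u -> sqint mu setE (fun x => u (a + x)).
Proof.
move=> [mu_ i]; split; first exact: measurable_shiftl.
have m2 : measurable_fun setE (fun x : euclid R N => (u x ^+ 2)%:E).
  by apply/measurable_EFinP; exact: measurable_funX.
have := integral_shift a m2; under eq_integral do rewrite addrC; by move=> ->.
Qed.

Variables (Omega : set V) (oO : open Omega).
Local Notation sqO := (sqint mu Omega).
Local Notation ipO := (ip mu Omega).
Local Notation nrmO := (nrm mu Omega).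

Let mO : measurable (Omega : set (euclid R N)).
Proof. exact: open_measurable_euclid. Qed.

(** By duality it is enough to pair with test functions supported in [W]; moving the translation
    onto them reduces to [translation_bound], the margin [d] keeping them inside [Omega]. *)
Lemma translation_nrm u g i (W : set V) (d t : R) : sqO u -> sqO g ->
  is_weak_partial Omega i u g -> open W ->
  (forall x y, W x -> `|x - y| < d -> Omega y) -> 0 <= t < d ->
  nrm mu W (fun x => (u \_ Omega) (- (t *: e_ i) + x) - (u \_ Omega) x) <= t * nrmO g.
Proof.
move=> su sg ug oW WO /andP[t0 td].
have mW : measurable (W : set (euclid R N)) by exact: open_measurable_euclid.
have d0 := le_lt_trans t0 td.
have WsO : W `<=` Omega by move=> x Wx; apply: (WO x x) => //; rewrite subrr normr0.
have sU := (@sqint_patch _ (euclid R N) R mu Omega u mO).1 su.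
have [mU _] := sU.
have sS := sqint_shift (- (t *: e_ i)) sU.
have sw := @sqintB _ (euclid R N) R mu setE measurableT _ _ sS sU.
have sWw := @sqint_sub _ (euclid R N) R mu W setE _ mW measurableT (@subsetT _ W) sw.
have g0 : 0 <= t * nrmO g by rewrite mulr_ge0// nrm_ge0.
apply: (nrm_le_dual oW sWw g0) => phi tphi.
have sphi := test_sqintT tphi; have [mphi _] := sphi.
have tO := test_functionS WsO tphi.
rewrite (ip_test _ tphi) (nrm_test tphi).
rewrite (@ipBl _ (euclid R N) R mu setE measurableT _ _ _ sS sU sphi).
rewrite -(ip_shift (t *: e_ i) mU mphi) -(ip_patch mu Omega u phi) -mulrA.
apply: (translation_bound oO su sg ug t0) => s /andP[s0 st].
apply: test_translate => // x sx; apply: (WO (s *: e_ i + x)).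
  by have [_ _ sub] := tphi; exact: sub.
rewrite addrK; apply: le_lt_trans (norm_delta i s) _.
by rewrite ger0_norm//; exact: le_lt_trans st td.
Qed.

(** Converse of [translation_nrm]. The set [W] may depend on the test function as long as it
    contains its nonzero set, so the estimate is needed only away from the boundary. *)
Lemma weak_partial_of_local u i (K : R) : sqO u -> 0 <= K ->
  (forall phi, test_function Omega phi -> exists (d : R) (W : set V),
    [/\ 0 < d, measurable (W : set (euclid R N)), forall x, phi x != 0 -> W x &
     forall t, 0 < t -> t < d ->
       nrm mu W (fun x => (u \_ Omega) (- (t *: e_ i) + x) - (u \_ Omega) x) <= t * K]) ->
  exists g, [/\ sqO g, nrmO g <= K & is_weak_partial Omega i u g].
Proof.
move=> su K0 h; apply: (weak_partial_of_bound oO su K0) => phi tphi.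
have [d [W [d0 mW phiW dP]]] := h _ tphi.
have sU := (@sqint_patch _ (euclid R N) R mu Omega u mO).1 su; have [mU _] := sU.
have sphi := test_sqintT tphi; have [mphi _] := sphi.
apply: (difference_quotient_bound oO su tphi); exists d => // t t0 td.
have sS := sqint_shift (- (t *: e_ i)) sU.
have sw := @sqintB _ (euclid R N) R mu setE measurableT _ _ sS sU.
have sWw := @sqint_sub _ (euclid R N) R mu W setE _ mW measurableT (@subsetT _ W) sw.
have phiE : phi \_ W = phi.
  apply/funext => x; rewrite patchE; case: ifPn => // /negP xW.
  by apply/esym/eqP/negPn/negP => /phiW Wx; apply: xW; rewrite inE.
rewrite (ip_patch mu Omega u phi) (ip_shift (t *: e_ i) mU mphi).
rewrite -(@ipBl _ (euclid R N) R mu setE measurableT _ _ _ sS sU sphi).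
rewrite ipC -[in X in `|X|]phiE -(ip_patch mu W) ipC.
have spW := test_sqint mW tphi.
apply: le_trans (cauchy_schwarz mW sWw spW) _.
rewrite (nrm_patch mu W phi) phiE (nrm_test tphi) mulrA.
by rewrite ler_wpM2r ?nrm_ge0// dP.
Qed.

(** Translation differences of |u| are pointwise dominated by those of u, so the bound of
    [translation_nrm] for u feeds [weak_partial_of_local] for |u| with the same constant. *)
Lemma H1_abs u : H1 Omega u -> H1 Omega (fun x => `|u x|) /\
  forall i, nrmO (wpartial Omega i (fun x => `|u x|)) <= nrmO (wpartial Omega i u).
Proof.
move=> hu; have su := H1_sqO hu.
have sa : sqO (fun x => `|u x|) by have h := sqint_norm mO su; exact: h.
have key i : exists g, [/\ sqO g, nrmO g <= nrmO (wpartial Omega i u) &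
    is_weak_partial Omega i (fun x => `|u x|) g].
  have [sg ug] := H1_wpartial i hu.
  have n0 := nrm_ge0 mu Omega (wpartial Omega i u).
  apply: (weak_partial_of_local sa n0) => phi [_ cphi sphi].
  have [d [W [d0 oW KW WO]]] := margin_nbhd cphi oO sphi.
  have mW : measurable (W : set (euclid R N)) by exact: open_measurable_euclid.
  exists d, W; split => //; first by move=> x /closed_support_sub /KW.
  move=> t t0 td; have t0d : 0 <= t < d by rewrite ltW.
  apply: le_trans (translation_nrm su sg ug oW WO t0d).
  have sw (v : V -> R) : sqO v -> sqint mu W
      (fun x => (v \_ Omega) (- (t *: e_ i) + x) - (v \_ Omega) x).
    move=> sv; have sU := (@sqint_patch _ (euclid R N) R mu Omega v mO).1 sv.
    have sS := sqint_shift (- (t *: e_ i)) sU.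
    have h := @sqintB _ (euclid R N) R mu setE measurableT _ _ sS sU.
    exact: (@sqint_sub _ (euclid R N) R mu W setE _ mW measurableT (@subsetT _ W) h).
  apply: (le_nrm mW (sw _ sa) (sw _ su)) => x _.
  have E y : ((fun x => `|u x|) \_ Omega) y = `|(u \_ Omega) y|.
    by rewrite !patchE; case: ifPn => //; rewrite normr0.
  by rewrite !E ler_dist_dist.
split.
  split => // i; have [g [sg _ ug]] := key i; by exists g.
by move=> i; have [g [sg gn ug]] := key i; rewrite (nrm_wpartial oO sg ug).
Qed.

Lemma lipschitz_measurable psi (L : R) :
  (forall x y, Omega x -> Omega y -> `|psi x - psi y| <= L * `|x - y|) ->
  measurable_fun (Omega : set (euclid R N)) psi.
Proof.
move=> lip; apply: (@measurability _ _ (euclid R N) (measurableTypeR R) Omega psi _ (RGenOInfty.measurableE R)).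
move=> _ [_ [r ->] <-].
have -> : Omega `&` psi @^-1` `]r, +oo[%classic = [set x | Omega x /\ r < psi x].
  by apply/seteqP; split => x /=; rewrite in_itv/= andbT.
apply: open_measurable_euclid; rewrite openE => x [Ox rx]; rewrite /interior.
have Onx : nbhs x Omega by exact: open_nbhs_nbhs.
pose e := (psi x - r) / (`|L| + 1).
have L1 : 0 < `|L| + 1 by rewrite ltr_wpDl.
have e0 : 0 < e by rewrite divr_gt0// subr_gt0.
have : nbhs x (ball x e) by exact: nbhsx_ballx.
apply: filterS2 Onx => y Oy; rewrite mx_norm_ball /ball_/= => xy; split => //.
have := lip x y Ox Oy; rewrite ler_norml => /andP[_ h1].
have : L * `|x - y| < psi x - r.
  apply: (@le_lt_trans _ _ ((`|L| + 1) * `|x - y|)).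
    by rewrite ler_wpM2r//; have := ler_norm L; lra.
  by rewrite mulrC -ltr_pdivlMr.
by move: h1; set a := L * _ => *; lra.
Qed.

(** Translation differences are at most L t pointwise on [W], hence at most t times L sqrt(mu Omega)
    in L^2. *)
Lemma H1_lipschitz psi (L : R) : bounded_set Omega -> 0 <= L ->
  (forall x y, Omega x -> Omega y -> `|psi x - psi y| <= L * `|x - y|) ->
  H1 Omega psi.
Proof.
move=> bO L0 lip; have mpsi := lipschitz_measurable lip.
have muO : (mu Omega < +oo)%E by exact: lebesgue_bounded_lty.
have [M [_ hM]] := bO.
have bM x : Omega x -> `|x| <= `|M| + 1.
  by apply: hM; rewrite (le_lt_trans (ler_norm M))// ltrDl.
(* A base point is needed to bound psi; on the empty set everything is trivial. *)
have [[y0 Oy0]|nO] := pselect (Omega !=set0); last first.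
  have O0 : Omega = set0.
    by apply/seteqP; split => // x Ox; apply: nO; exists x.
  have s0 (v : V -> R) : sqO v by rewrite O0; split; [exact: measurable_fun_set0|rewrite integral_set0 ltry].
  split; first exact: s0.
  move=> i; exists psi; split; first exact: s0.
  by move=> phi _; rewrite O0 !Rintegral_set0 oppr0.
have sp : sqO psi.
  have h := @bounded_sqint _ (euclid R N) R mu Omega mO psi (`|psi y0| + L * ((`|M| + 1) *+ 2)) muO mpsi.
  apply: h => x Ox; have := lip x y0 Ox Oy0.
  have := bM _ Ox; have := bM _ Oy0; have := ler_normB x y0.
  have := ler_normD (psi x - psi y0) (psi y0); rewrite subrK mulr2n.
  set a := `|x - y0|; set b := `|M| => h1 h2 h3 h4 h5.
  have : L * a <= L * (b + 1 + (b + 1)) by rewrite ler_wpM2l//; lra.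
  lra.
split => // i.
have n0 : 0 <= L * Num.sqrt (fine (mu Omega)) by rewrite mulr_ge0// sqrtr_ge0.
suff [g [sg _ pg]] : exists g, [/\ sqO g, nrmO g <= L * Num.sqrt (fine (mu Omega)) & is_weak_partial Omega i psi g].
  by exists g.
apply: (weak_partial_of_local sp n0) => phi [_ cphi sphi].
have [d [W [d0 oW KW WO]]] := margin_nbhd cphi oO sphi.
have WsO : W `<=` Omega by move=> x Wx; apply: (WO x x) => //; rewrite subrr normr0.
have mW : measurable (W : set (euclid R N)) by exact: open_measurable_euclid.
exists d, W; split => //; first by move=> x /closed_support_sub /KW.
move=> t t0 td.
have sU := (@sqint_patch _ (euclid R N) R mu Omega psi mO).1 sp.
have sS := sqint_shift (- (t *: e_ i)) sU.
have sw := @sqintB _ (euclid R N) R mu setE measurableT _ _ sS sU.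
have sWw := @sqint_sub _ (euclid R N) R mu W setE _ mW measurableT (@subsetT _ W) sw.
have muWO : (mu W <= mu Omega)%E by apply: le_measure => //; rewrite inE.
have muW := le_lt_trans muWO muO.
have Lt0 : 0 <= L * t by rewrite mulr_ge0// ltW.
have [mw _] := sWw.
apply: le_trans (nrm_bounded mW Lt0 muW mw _) _.
  move=> x Wx; have Oy : Omega (- (t *: e_ i) + x).
    apply: (WO x) => //; rewrite opprD opprK addrCA subrr addr0.
    by apply: le_lt_trans (norm_delta i t) _; rewrite gtr0_norm.
  rewrite !patchE !mem_set//; last exact: WsO.
  apply: le_trans (lip _ _ Oy (WsO _ Wx)) _; rewrite ler_wpM2l//.
  rewrite addrK normrN; apply: le_trans (norm_delta i t) _.
  by rewrite gtr0_norm.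
rewrite mulrA (mulrC t) ler_wpM2l// ler_wsqrtr//.
by apply: fine_le => //; rewrite ge0_fin_numE.
Qed.

End translations.

(** * The space of functions vanishing on the boundary *)

Section parallelogram.
Context d (T : measurableType d) (R : realType).
Variables (mu : {measure set T -> \bar R}) (D : set T) (mD : measurable D).

Lemma parallelogram (u v : T -> R) : sqint mu D u -> sqint mu D v ->
  nrm mu D (fun x => 2^-1 * (u x + v x)) ^+ 2 + nrm mu D (fun x => 2^-1 * (u x - v x)) ^+ 2 =
  (nrm mu D u ^+ 2 + nrm mu D v ^+ 2) / 2.
Proof.
move=> su sv; have sa := sqintD mD su sv; have sb := sqintB mD su sv.
have ipE1 w : sqint mu D w -> nrm mu D (fun x => 2^-1 * w x) ^+ 2 = ip mu D w w / 4.
  by move=> sw; rewrite nrmZ// exprMn sqr_nrm ger0_norm ?invr_ge0//; field.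
rewrite (ipE1 _ sa) (ipE1 _ sb) !sqr_nrm (ipDr mD su sv sa) (ipBr mD su sv sb).
rewrite (ipDl mD su sv su) (ipDl mD su sv sv) (ipBl mD su sv su) (ipBl mD su sv sv).
by rewrite (ipC _ _ v u); field.
Qed.

Lemma nrm0 : nrm mu D (fun=> 0) = 0.
Proof.
have := nrmZ mD 0 (sqint0 mu D); under eq_fun do rewrite mul0r.
by rewrite normr0 mul0r.
Qed.

End parallelogram.

Section closure.
Context (R : realType) (N : nat).
Local Notation V := 'rV[R]_N.
Local Notation mu := (@lebesgue R N).
Variables (Omega : set V) (oO : open Omega).
Implicit Types (u v w g phi psi : V -> R) (i : 'I_N).
Local Notation sqO := (sqint mu Omega).
Local Notation ipO := (ip mu Omega).
Local Notation nrmO := (nrm mu Omega).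

Let mO : measurable (Omega : set (euclid R N)).
Proof. exact: open_measurable_euclid. Qed.

(** Lower semicontinuity of the norm of one partial derivative under L^2 convergence: in the dual
    formulation, replacing u by v costs the norm of v - u times that of the derivative of the test
    function. *)
Lemma weak_partial_closed u i (K : R) : sqO u -> 0 <= K ->
  (forall e : R, 0 < e -> exists v g, [/\ sqO v, sqO g, is_weak_partial Omega i v g,
    nrmO g <= K & nrmO (fun x => v x - u x) <= e]) ->
  exists g, [/\ sqO g, nrmO g <= K & is_weak_partial Omega i u g].
Proof.
move=> su K0 h; apply: (weak_partial_of_bound oO su K0) => phi t.
have st := test_sqO oO t; have sp := test_sqO oO (test_partial i t).
have n1 : 0 < nrmO (partial i phi) + 1 by rewrite ltr_wpDl// nrm_ge0.
apply/ler_addgt0Pr => e e0.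
have d0 : 0 < e / (nrmO (partial i phi) + 1) by rewrite divr_gt0.
have [v [g [sv sg /is_weak_partialE vg gK vu]]] := h _ d0.
have svu := sqOB oO sv su.
have -> : ipO u (partial i phi) =
    ipO v (partial i phi) - ipO (fun x => v x - u x) (partial i phi).
  by rewrite (ipBl mO sv su sp) opprB addrC subrK.
rewrite vg//; apply: le_trans (ler_normB _ _) _; rewrite normrN; apply: lerD.
  by apply: le_trans (cauchy_schwarz mO sg st) _; rewrite ler_wpM2r ?nrm_ge0.
apply: le_trans (cauchy_schwarz mO svu sp) _.
rewrite -[leRHS](divfK (lt0r_neq0 n1)) ler_pM ?nrm_ge0//.
by rewrite lerDl.
Qed.

Lemma H10_H1 v : H10 Omega v -> H1 Omega v. Proof. by case. Qed.

Lemma H10_approx v (e : R) : H10 Omega v -> 0 < e -> exists2 phi, test_function Omega phi &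
  nrmO (fun x => v x - phi x) <= e /\
  forall i, nrmO (fun x => wpartial Omega i v x - partial i phi x) <= e.
Proof.
move=> [hv va] e0; have [phi tphi q] := va _ (exprn_gt0 2 e0); exists phi => //.
move: q; rewrite (H1_norm_sqE oO (H1B oO hv (H1_test oO tphi))) lte_fin => lt_e.
have s0 (P : pred 'I_N) : 0 <= \sum_(i < N | P i)
    nrmO (wpartial Omega i (fun x => v x - phi x)) ^+ 2.
  by rewrite sumr_ge0// => i _; exact: sqr_ge0.
split.
  rewrite -(@ler_pXn2r _ 2)// ?nnegrE ?nrm_ge0 ?(ltW e0)//.
  by move: (s0 xpredT) lt_e; set a := _ ^+ 2; set b := \sum_(_ < _) _; clearbody a b; lra.
move=> i; rewrite -(nrm_wpartialB_test oO _ hv tphi).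
rewrite -(@ler_pXn2r _ 2)// ?nnegrE ?nrm_ge0 ?(ltW e0)//.
move: lt_e; rewrite (bigD1 i)//=; have := s0 (fun j => j != i).
have := sqr_ge0 (nrmO (fun x => v x - phi x)).
move=> h1 h2 h3; apply: le_trans (ltW h3).
by rewrite addrCA lerDl; exact: addr_ge0 h1 h2.
Qed.

Section closed.
Variables (v : V -> R) (M : R) (sv : sqO v).
Hypothesis vM : forall e : R, 0 < e -> exists phi, [/\ test_function Omega phi,
     nrmO (fun x => phi x - v x) <= e & \sum_(i < N) nrmO (partial i phi) ^+ 2 <= M].

Let mid (a b : V -> R) x := 2^-1 * (a x + b x).

Let testM a b : test_function Omega a -> test_function Omega b -> test_function Omega (mid a b).
Proof. by move=> ta tb; have h := testZ 2^-1 (testD ta tb); exact: h. Qed.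

Let partial_mid a b i : test_function Omega a -> test_function Omega b ->
  partial i (mid a b) = fun x => 2^-1 * (partial i a x + partial i b x).
Proof.
move=> ta tb; have sa := test_smooth ta; have sb := test_smooth tb.
by rewrite /mid (partialZ _ _ (smoothD sa sb)) (partialD _ sa sb).
Qed.

(* Convex combinations are implicit in the minimisation: the near-minimisers of
   the Dirichlet energy among the test functions close to [v] have Cauchy
   gradients, so no weak compactness is needed. *)
Let cauchy_approximation : exists w : nat -> V -> R,
  [/\ forall n, test_function Omega (w n),
      nrmO (fun x => w n x - v x) @[n --> \oo] --> 0 &
      forall i (e : R), 0 < e -> exists n0, forall n m, (n0 <= n)%N -> (n0 <= m)%N ->
        nrmO (fun x => partial i (w n) x - partial i (w m) x) < e].
Proof.
pose C n : set (V -> R) := [set phi | test_function Omega phi /\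
  nrmO (fun x => phi x - v x) <= n.+1%:R^-1].
pose q phi := \sum_(i < N) nrmO (partial i phi) ^+ 2.
pose gap (a b : V -> R) :=
  \sum_(i < N) nrmO (fun x => 2^-1 * (partial i a x - partial i b x)) ^+ 2.
have decr n : C n.+1 `<=` C n.
  by move=> a [ta na]; split => //; apply: le_trans na _; rewrite lef_pV2 ?posrE// ler_nat.
have cmid n a b : C n a -> C n b -> C n (mid a b).
  move=> [ta na] [tb nb]; split; first exact: testM.
  have sav := sqOB oO (test_sqO oO ta) sv; have sbv := sqOB oO (test_sqO oO tb) sv.
  have -> : (fun x => mid a b x - v x) =
      fun x => 2^-1 * (a x - v x) + 2^-1 * (b x - v x).
    by apply/funext => x; rewrite /mid; field.
  apply: le_trans (nrmD mO (sqintZ mO _ sav) (sqintZ mO _ sbv)) _.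
  rewrite (nrmZ mO _ sav) (nrmZ mO _ sbv) ger0_norm ?invr_ge0//.
  by move: na nb; set d := n.+1%:R^-1; clearbody d; lra.
have par a b : C 0%N a -> C 0%N b -> q (mid a b) + gap a b <= (q a + q b) / 2.
  move=> [ta _] [tb _]; rewrite le_eqVlt; apply/orP; left; apply/eqP.
  transitivity (\sum_(i < N) (nrmO (partial i a) ^+ 2 + nrmO (partial i b) ^+ 2) / 2); last first.
    by rewrite -mulr_suml big_split.
  rewrite /q /gap -big_split; apply: eq_bigr => i _; rewrite (partial_mid i ta tb).
  have h := parallelogram mO (test_sqO oO (test_partial i ta)) (test_sqO oO (test_partial i tb)).
  exact: h.
have q0 a : C 0%N a -> 0 <= q a by move=> _; rewrite /q sumr_ge0// => i _; exact: sqr_ge0.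
have qM n : exists2 a, C n a & q a <= M.
  have n1 : 0 < n.+1%:R^-1 :> R by rewrite invr_gt0.
  by have [phi [t h1 h2]] := vM n1; exists phi.
have [w [Cw _ _ gw]] := nested_minimisation decr cmid par q0 qM.
exists w; split => [n||i e e0]; first by have [] := Cw n.
  apply/cvgrPdist_lt => e e0; have [n0 n0P] := inv_natS_lt e0.
  exists n0 => // n /= n0n; rewrite sub0r normrN ger0_norm ?nrm_ge0//.
  have [_ h] := Cw n; apply: le_lt_trans h (le_lt_trans _ n0P).
  by rewrite lef_pV2 ?posrE// ler_nat.
have e2 : 0 < (e / 2) ^+ 2 by rewrite exprn_gt0// divr_gt0.
have [n0 n0P] := gw _ e2; exists n0 => n m n0n n0m.
have [tn _] := Cw n; have [tm _] := Cw m.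
have sd := sqOB oO (test_sqO oO (test_partial i tn)) (test_sqO oO (test_partial i tm)).
have : nrmO (fun x => 2^-1 * (partial i (w n) x - partial i (w m) x)) ^+ 2 < (e / 2) ^+ 2.
  apply: le_lt_trans (n0P n m n0n n0m); rewrite /gap (bigD1 i)//= lerDl sumr_ge0// => j _.
  exact: sqr_ge0.
rewrite ltr_pXn2r ?nnegrE ?nrm_ge0 ?divr_ge0 ?(ltW e0)//.
rewrite (nrmZ mO _ sd) ger0_norm ?invr_ge0//; set c := nrm _ _ _; lra.
Qed.

(** The Cauchy gradients have limits [g i], and integration by parts passes to the limit, so these
    are the weak derivatives of v and the approximation holds in the H^1 norm. *)
Lemma H10_closed : H10 Omega v.
Proof.
have [w [tw wv wc]] := cauchy_approximation.
have sw n := test_sqO oO (tw n); have sp n i := test_sqO oO (test_partial i (tw n)).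
have /choice[g gP] : forall i, exists g, sqO g /\
    nrmO (fun x => partial i (w n) x - g x) @[n --> \oo] --> 0.
  move=> i; have h := sqint_complete mO (fun n => sp n i) (wc i).
  by have [g [sg gc _]] := h; exists g.
have wg i : is_weak_partial Omega i v (g i).
  have [sg gc] := gP i; apply/is_weak_partialE => phi t.
  have st := test_sqO oO t; have spt := test_sqO oO (test_partial i t).
  have c1 := nrm_cvg_ip mO sw sv spt wv.
  have c2 := nrm_cvg_ip mO (fun n => sp n i) sg st gc.
  have c3 : (fun n => - ipO (partial i (w n)) phi) @ \oo --> - ipO (g i) phi by exact: cvgN.
  have E : (fun n => ipO (w n) (partial i phi)) = fun n => - ipO (partial i (w n)) phi.
    by apply/funext => n; have /is_weak_partialE -> := is_weak_partial_test i (tw n).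
  by rewrite E in c1; exact: (@cvg_unique _ (@Rhausdorff R) _ _ _ _ c1 c3).
have hv : H1 Omega v.
  by split => // i; have [sg _] := gP i; exists (g i).
split => // e e0.
(* The squared H^1 norm has N + 1 terms: d <= 1 gives d^2 <= d, and d <= e/(N+2) makes (N+1) d
   smaller than e. *)
pose d := Num.min 1 (e / (N.+2)%:R).
have d0 : 0 < d by rewrite lt_min ltr01 divr_gt0.
have dE : d ^+ 2 *+ N.+1 < e.
  have d1 : d <= 1 by rewrite ge_min lexx.
  have d2 : d <= e / N.+2%:R by rewrite ge_min lexx orbT.
  apply: (@le_lt_trans _ _ (d *+ N.+1)); first by rewrite lerMn2r expr2 ler_piMl ?orbT// ltW.
  apply: (@lt_le_trans _ _ (d *+ N.+2)); first by rewrite ltr_pMn2l.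
  by rewrite -mulr_natr -ler_pdivlMr.
have near_v : \forall n \near \oo, nrmO (fun x => w n x - v x) <= d.
  move/cvgrPdist_le : wv => /(_ d d0); apply: filterS => n.
  by rewrite sub0r normrN ger0_norm ?nrm_ge0.
have near_g : \forall n \near \oo, forall i, nrmO (fun x => partial i (w n) x - g i x) <= d.
  apply: filter_forall => i; have [_ /cvgrPdist_le /(_ d d0)] := gP i; apply: filterS => n.
  by rewrite sub0r normrN ger0_norm ?nrm_ge0.
have [n nv ng] : exists2 n, nrmO (fun x => w n x - v x) <= d &
    forall i, nrmO (fun x => partial i (w n) x - g i x) <= d.
  by have [n [] ] := filter_ex (filterI near_v near_g); exists n.
exists (w n) => //; have t := tw n.
rewrite (H1_norm_sqE oO (H1B oO hv (H1_test oO t))) lte_fin.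
apply: le_lt_trans dE; rewrite mulrS; apply: lerD.
  by rewrite nrm_subC ler_pXn2r ?nnegrE ?nrm_ge0 ?(ltW d0).
have -> : d ^+ 2 *+ N = \sum_(i < N) d ^+ 2 by rewrite sumr_const card_ord.
apply: ler_sum => i _; have [sg _] := gP i.
have wp := is_weak_partialB oO sv (sw n) sg (sp n i) (wg i) (is_weak_partial_test i t).
rewrite (nrm_wpartial oO (sqOB oO sg (sp n i)) wp) nrm_subC.
by rewrite ler_pXn2r ?nnegrE ?nrm_ge0 ?(ltW d0).
Qed.

End closed.

Lemma H10_test phi : test_function Omega phi -> H10 Omega phi.
Proof.
move=> t; apply: (@H10_closed phi (\sum_(i < N) nrmO (partial i phi) ^+ 2) (test_sqO oO t)).
move=> e e0; exists phi; split => //.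
rewrite (_ : (fun x => _) = fun=> 0); last by apply/funext => x; rewrite subrr.
by rewrite (nrm0 mu mO); exact: ltW.
Qed.

End closure.

(** * Averaging kernels and mollification *)

Section kernel_bound.
Context d (T : measurableType d) (R : realType).
Variables (mu : {measure set T -> \bar R}).

Lemma kernel_bound (u rho : T -> R) (c : R) :
  mu.-integrable setT (EFin \o (fun y => u y * rho y)) ->
  mu.-integrable setT (EFin \o rho) -> (forall y, 0 <= rho y) ->
  \int[mu]_y rho y = 1 -> (forall y, rho y != 0 -> `|u y| <= c) ->
  `|\int[mu]_y (u y * rho y)| <= c.
Proof.
move=> iu ir r0 r1 uc; apply: le_trans (le_normr_Rintegral measurableT iu) _.
have -> : c = \int[mu]_y (c * rho y) by rewrite RintegralZl// r1 mulr1.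
apply: le_Rintegral => //.
- by have := integrable_norm iu.
- by have := integrableZl measurableT c ir; apply: eq_integrable.
- move=> y _; rewrite normrM (ger0_norm (r0 y)).
  have [->|/uc h] := eqVneq (rho y) 0; first by rewrite !mulr0.
  by rewrite ler_wpM2r.
Qed.

End kernel_bound.

Section shifts.
Context (R : realType) (N : nat).
Local Notation V := 'rV[R]_N.
Local Notation mu := (@lebesgue R N).
Local Notation e_ i := (delta_mx 0 i : V).
Local Notation setE := [set: euclid R N].
Implicit Types (u v w phi rho : V -> R) (i : 'I_N).

(** A translation is a composition of translations along the axes. Used with [P] an L^2 estimate and
    with [P] a uniform one. *)
Lemma coordinate_induction (P : V -> R -> Prop) (K : 'I_N -> R) : P 0 0 ->
  (forall a b c d, P a c -> P b d -> P (a + b) (c + d)) ->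
  (forall i t, P (t *: e_ i) (`|t| * K i)) ->
  forall a, P a (\sum_(i < N) `|a 0 i| * K i).
Proof.
move=> P0 PD PZ a; rewrite {1}(row_sum_delta a).
by elim/big_ind2 : _ => // *; exact: PD.
Qed.

Lemma nrm_shift_test Omega phi a : test_function Omega phi ->
  nrm mu setE (fun x => phi (a + x) - phi x) <=
  \sum_(i < N) `|a 0 i| * nrm mu setE (partial i phi).
Proof.
move=> tO; have t : test_function setT phi by exact: test_functionS tO.
have sphi := test_sqintT t; have [mphi _] := sphi.
have sS b := sqint_shift b sphi.
have sB b := @sqintB _ (euclid R N) R mu setE measurableT _ _ (sS b) sphi.
(* [translation_nrm] gives translations in the negative direction, here with the whole space as
   domain and any margin; the positive direction follows from translation invariance. *)
have neg i s : 0 <= s -> nrm mu setE (fun x => phi (- (s *: e_ i) + x) - phi x) <=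
    s * nrm mu setE (partial i phi).
  move=> s0; have s1 : 0 <= s < s + 1 by rewrite s0 ltrDl ltr01.
  have tr : forall x y : V, setT x -> `|x - y| < s + 1 -> setT y by [].
  have sp := test_sqintT (test_partial i t).
  have := translation_nrm openT sphi sp (is_weak_partial_test i t) openT tr s1.
  by rewrite patch_setT.
apply: (coordinate_induction (P := fun a c =>
    nrm mu setE (fun x => phi (a + x) - phi x) <= c)).
- rewrite (_ : (fun x => _) = fun=> 0); last by apply/funext => x; rewrite add0r subrr.
  by rewrite (@nrm0 _ (euclid R N) R mu setE measurableT).
- move=> b b' c c' hb hb'.
  have E : nrm mu setE (fun x => phi (b + (b' + x)) - phi (b' + x)) =
      nrm mu setE (fun x => phi (b + x) - phi x).
    have [mB _] := sB b; exact: nrm_shift b' mB.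
  have := @nrm_triangle _ (euclid R N) R mu setE measurableT
    (fun x => phi (b' + x)) (fun x => phi (b + (b' + x))) phi
    (sqint_shift b' (sS b)) (sS b') sphi.
  rewrite E (_ : (fun x => phi (b + (b' + x)) - phi x) = fun x => phi (b + b' + x) - phi x); last first.
    by apply/funext => x; rewrite addrA.
  by move=> /le_trans; apply; exact: lerD hb hb'.
- move=> i s; have [s0|s0] := leP 0 s; last first.
    rewrite ltr0_norm// -[X in X *: _]opprK scaleNr; apply: neg.
    by rewrite oppr_ge0 ltW.
  have [mB _] := sB (s *: e_ i).
  rewrite -(nrm_shift (- (s *: e_ i)) mB).
  under eq_fun do rewrite addNKr.
  rewrite nrm_subC ger0_norm//; exact: neg.
Qed.

Lemma test_lipschitz Omega phi : test_function Omega phi ->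
  exists2 L : R, 0 <= L & forall x y, `|phi x - phi y| <= L * `|x - y|.
Proof.
move=> t; have /choice[K KP] : forall i, exists K : R, 0 < K /\ forall x, `|partial i phi x| <= K.
  by move=> i; exact: test_bounded (test_partial i t).
exists (\sum_(i < N) K i) => [|x y]; first by rewrite sumr_ge0// => i _; have [/ltW] := KP i.
have key a : forall z, `|phi (a + z) - phi z| <= \sum_(i < N) `|a 0 i| * K i.
  apply: (coordinate_induction (P := fun a c => forall z, `|phi (a + z) - phi z| <= c)).
  - by move=> z; rewrite add0r subrr normr0.
  - move=> b b' c c' hb hb' z; rewrite -addrA.
    apply: le_trans (ler_distD (phi (b' + z)) _ _) _; exact: lerD (hb _) (hb' _).
  - move=> i s z.
    have dG (r : R) : is_derive r (1 : R) (fun r : R => phi (r *: e_ i + z))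
        (partial i phi (r *: e_ i + z)).
      have d := @smooth_derivable R N phi i (r *: e_ i + z) (test_smooth t).
      exact: is_derive_along d.
    have cG (A : set R) : {within A, continuous (fun r : R => phi (r *: e_ i + z))}.
      apply: continuous_subspaceT => r; apply: differentiable_continuous.
      by apply/derivable1_diffP; have [] := dG r.
    have bnd (p q : R) : p < q -> `|phi (q *: e_ i + z) - phi (p *: e_ i + z)| <= (q - p) * K i.
      move=> pq; have [c _ ->] := @MVT R _ _ p q pq (fun r _ => dG r) (cG _).
      have [_ KP2] := KP i.
      by rewrite normrM mulrC gtr0_norm ?subr_gt0// ler_wpM2l ?KP2// subr_ge0 ltW.
    have E0 : phi z = phi (0 *: e_ i + z) by rewrite scale0r add0r.
    rewrite [X in _ - X]E0; have [s0|s0|->] := ltgtP s 0.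
    + by rewrite distrC (ltr0_norm s0) -[- s]add0r; exact: bnd.
    + by rewrite (gtr0_norm s0) -[X in _ <= X * _]subr0; exact: bnd.
    + by rewrite subrr normr0 mul0r.
have := key (x - y) y; rewrite subrK => /le_trans; apply.
rewrite mulr_suml; apply: ler_sum => i _; rewrite mulrC ler_wpM2l//.
  by have [/ltW] := KP i.
exact: coord_le_norm.
Qed.

Lemma lipschitz_partial (h : V -> R) (L : R) i x :
  derivable h x (e_ i) -> 0 <= L ->
  (forall x y, `|h x - h y| <= L * `|x - y|) -> `|partial i h x| <= L.
Proof.
move=> dh L0 lip; apply: (derive_bound (derive_line dh) ltr01) => t t0 _.
apply: le_trans (lip _ _) _; rewrite scale0r add0r addrK mulrC ler_wpM2r//.
by apply: le_trans (norm_delta i t) _; rewrite gtr0_norm.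
Qed.

Lemma integrable_test Omega phi : test_function Omega phi ->
  mu.-integrable setE (EFin \o phi).
Proof.
move=> t; have [r [r0 rP]] := test_support_bounded t.
have h := @sqint_mul_integrable _ (euclid R N) R mu setE measurableT _ _
  (test_sqintT t) (@sqint_cube R N r 1 r0).
have E : phi = (fun x => phi x * (1 * \1_(cube r : set V) x)).
  apply/funext => x; have [->|/rP xr] := eqVneq (phi x) 0; first by rewrite mul0r.
  by rewrite indicE mem_set// !mulr1.
rewrite E; exact: h.
Qed.

Lemma smooth_kernel (h : R) : 0 < h -> exists rho : V -> R,
  [/\ test_function setT rho, forall y, 0 <= rho y, forall y, rho y != 0 -> `|y| <= h &
      \int[mu]_(y in setE) rho y = 1].
Proof.
move=> h0; pose b : V := const_mx h; pose f := bump 0 (- b) b.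
have tf : test_function setT f by exact: test_function_bump.
have boxE : open_box (- b) b = cube h.
  by apply/seteqP; split => x hx i; have := hx i; rewrite !mxE ltr_norml.
have if_ := integrable_test tf.
have f0 y : 0 <= f y by exact: bump_ge0.
pose c := \int[mu]_(y in setE) f y.
have cE : (c%:E = \int[mu]_(y in setE) (f y)%:E)%E.
  by rewrite /c /Rintegral fineK//; exact: integrable_fin_num.
(* A zero integral would make the bump vanish almost everywhere, although it is positive on a cube
   of positive volume. *)
have c0 : 0 < c.
  rewrite lt0r Rintegral_ge0 ?andbT//; apply/eqP => cz.
  have [mf _] := test_sqintT tf.
  have : (\int[mu]_(y in setE) `|(f y)%:E| = 0)%E.
    under eq_integral do rewrite gee0_abs ?lee_fin//.
    by rewrite -cE cz.
  have mEf : measurable_fun setE (EFin \o f) by exact/measurable_EFinP.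
  move/(ae_eq_integral_abs mu measurableT mEf) => ae0.
  have : mu.-negligible (cube h : set (euclid R N)).
    apply: negligibleS ae0 => y hy /= /(_ I) /eqP; rewrite eqe gt_eqF//.
    by apply: bump_gt0; rewrite boxE.
  move/(negligibleP mu (@measurable_cube R N h h0)) => hz.
  have /eqP := etrans (esym (@lebesgue_cube R N h h0)) hz.
  by rewrite eqe expf_eq0 mulrn_eq0 /= gt_eqF// andbF.
exists (fun y => c^-1 * f y); split.
- exact: testZ.
- by move=> y; rewrite mulr_ge0// invr_ge0 ltW.
- move=> y; rewrite mulf_eq0 negb_or => /andP[_ fy].
  have hb : ~ open_box (- b) b y -> f y = 0 by exact: bump_eq0.
  have : cube h y by rewrite -boxE; apply: contrapT => /hb z; rewrite z eqxx in fy.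
  by move=> hy; apply: rV_norm_le => [|i]; [exact: ltW|exact/ltW/hy].
- by rewrite (@RintegralZl _ (euclid R N) R mu setE f c^-1 measurableT if_) mulVf ?gt_eqF.
Qed.

End shifts.

Section convolution.
Context (R : realType) (N : nat).
Local Notation V := 'rV[R]_N.
Local Notation mu := (@lebesgue R N).
Local Notation e_ i := (delta_mx 0 i : V).
Local Notation setE := [set: euclid R N].
Implicit Types (u v phi rho : V -> R) (i : 'I_N).
Variables (w : V -> R) (sw : sqint mu setE w).

(** Convolution with the reflected kernel, that is the average of w(x + y) with weight rho(y), see
    [convE]. The variable x sits in the kernel, so derivatives fall on [rho] with a minus sign. *)
Definition conv rho (x : V) : R := ip mu setE w (fun y => rho (- x + y)).

Let shiftT rho a : test_function setT rho -> test_function setT (fun y => rho (a + y)).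
Proof. by move=> t; exact: test_translate. Qed.

(** Cauchy-Schwarz and the L^2 continuity of translations of [rho]. The constant depends on [w] only
    through its norm, which makes mollified bounded sequences equi-Lipschitz. *)
Lemma conv_lipschitz rho x y : test_function setT rho ->
  `|conv rho x - conv rho y| <=
  nrm mu setE w * \sum_(i < N) `|(x - y) 0 i| * nrm mu setE (partial i rho).
Proof.
move=> t; have s a := test_sqintT (shiftT a t).
rewrite -(@ipBr _ (euclid R N) R mu setE measurableT _ _ _ (s (- x)) (s (- y)) sw).
have sB := @sqintB _ (euclid R N) R mu setE measurableT _ _ (s (- x)) (s (- y)).
apply: le_trans (@cauchy_schwarz _ (euclid R N) R mu setE measurableT _ _ sw sB) _.
rewrite ler_wpM2l ?nrm_ge0//; have [mB _] := sB.
rewrite -(nrm_shift x mB).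
have -> : (fun z => rho (- x + (x + z)) - rho (- y + (x + z))) =
    fun z => rho z - rho ((x - y) + z).
  by apply/funext => z; rewrite addKr addrA (addrC (- y)).
by rewrite nrm_subC; exact: nrm_shift_test t.
Qed.

Lemma continuous_conv rho : test_function setT rho -> continuous (conv rho).
Proof.
move=> t x; apply/(@cvgrPdist_lt R R V (nbhs x) (nbhs_filter x)) => e e0.
pose C := nrm mu setE w * \sum_(i < N) nrm mu setE (partial i rho) + 1.
have C0 : 0 < C.
  by rewrite ltr_wpDl// mulr_ge0 ?nrm_ge0// sumr_ge0// => i _; exact: nrm_ge0.
have : nbhs x (ball x (e / C)) by apply: nbhsx_ballx; rewrite divr_gt0.
apply: filterS => y; rewrite mx_norm_ball /ball_/= => xy.
apply: le_lt_trans (conv_lipschitz x y t) _.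
apply: (@le_lt_trans _ _ (`|x - y| * C)); last by rewrite -ltr_pdivlMr.
rewrite /C mulrDr mulr1 mulrCA; apply: ler_wpDr => //.
rewrite ler_wpM2l ?nrm_ge0// mulr_sumr ler_sum// => i _.
by rewrite ler_wpM2r ?nrm_ge0// coord_le_norm.
Qed.

Lemma is_derive_conv rho i x : test_function setT rho ->
  is_derive x (e_ i) (conv rho) (conv (fun y => -1 * partial i rho y) x).
Proof.
move=> t; apply: is_derive_line.
have sp := test_sqintT (shiftT (- x) (test_partial i t)).
have dG : is_derive (- 0) (1 : R)
    (fun s : R => ip mu setE w (fun z => rho (- x + (s *: e_ i + z))))
    (ip mu setE w (fun z => partial i rho (- x + (- 0 *: e_ i + z)))).
  have := is_derive_ip_shift i (- 0) sw (shiftT (- x) t).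
  by rewrite partial_translateC.
have dN : is_derive (0 : R) (1 : R) (@GRing.opp R) (-1) by exact: is_deriveNid.
have := @is_derive1_comp R _ _ _ _ _ dG dN.
have -> : (fun s : R => ip mu setE w (fun z => rho (- x + (s *: e_ i + z)))) \o -%R =
    (fun s : R => conv rho (s *: e_ i + x)).
  apply/funext => s /=; rewrite /conv; congr (ip _ _ _ _); apply/funext => z.
  by rewrite opprD scaleNr addrCA addrA.
rewrite oppr0 scale0r; under [in ip _ _ _ _]eq_fun do rewrite add0r.
by rewrite /conv (@ipZr _ (euclid R N) R mu setE measurableT _ _ _ sp sw) mulrC.
Qed.

(** Convolutions of [w] with test functions form a class stable under partial derivatives. *)
Lemma smooth_conv rho : test_function setT rho -> smooth (conv rho).
Proof.
move=> t; apply: (@smooth_coind R N [set h | exists2 rho, test_function setT rho & h = conv rho]).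
- move=> _ [r tr ->]; split; first exact: continuous_conv.
  by move=> i x; have [] := is_derive_conv i x tr.
- move=> _ i [r tr ->]; exists (fun y => -1 * partial i r y).
    by apply: testZ; exact: test_partial.
  by apply/funext => x; rewrite /partial; have [_ ->] := is_derive_conv i x tr.
- by exists rho.
Qed.

Lemma convE rho x : test_function setT rho ->
  conv rho x = \int[mu]_(y in setE) (w (x + y) * rho y).
Proof.
move=> t; have [mw _] := sw; have [mr _] := test_sqintT t.
by rewrite /conv (ip_shift (- x) mw mr) opprK.
Qed.

End convolution.

Section lipschitz_compact_support.
Context (R : realType) (N : nat).
Local Notation V := 'rV[R]_N.
Local Notation mu := (@lebesgue R N).
Local Notation e_ i := (delta_mx 0 i : V).
Local Notation setE := [set: euclid R N].

(** The support lies in the set of differences of [K] and a closed box of radius h, compact as a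
    continuous image of a product. *)
Lemma test_conv (w rho : V -> R) (h : R) (K Omega : set V) : 0 <= h -> sqint mu setE w ->
  test_function setT rho -> (forall y, rho y != 0 -> `|y| <= h) ->
  compact K -> (forall x, w x != 0 -> K x) ->
  (forall x y, K x -> `|x - y| <= h -> Omega y) -> test_function Omega (conv w rho).
Proof.
move=> h0 sw t rh cK wK KO.
pose b : V := const_mx h.
pose Kh : set V := (fun p => p.1 - p.2) @` (K `*` closed_box (- b) b).
have cKh : compact Kh.
  apply: continuous_compact; last exact: compact_setX cK (@compact_closed_box _ _ _ _).
  by apply: continuous_subspaceT => -[x y]; apply: cvgB; [exact: cvg_fst|exact: cvg_snd].
have sub : closed_support (conv w rho) `<=` Kh.
  have clK : closed Kh := compact_closed (@norm_hausdorff _ _) cKh.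
  rewrite [X in _ `<=` X](closure_id _).1//; apply: closure_subset => x /= cx.
  have [y [wy ry]] : exists y, w y != 0 /\ rho (- x + y) != 0.
    apply: contrapT => ne; move: cx; rewrite /conv /ip.
    rewrite (@eq_Rintegral _ (euclid R N) R mu setE (fun=> 0)) ?Rintegral_cst ?mul0r ?eqxx// => y _.
    apply/eqP; rewrite mulf_eq0 -[_ || _]negbK negb_or; apply/negP => /andP[h1 h2].
    by apply: ne; exists y.
  exists (y, - x + y); last by rewrite /= opprD opprK addrCA subrr addr0.
  split; first exact: wK.
  move=> i; have := le_trans (coord_le_norm _ i) (rh _ ry).
  by rewrite ler_norml !mxE.
split; first exact: smooth_conv.
  by apply: (subclosed_compact _ cKh sub); exact: closed_closure.
move=> _ /sub [[x y] /= [Kx yb] <-]; apply: (KO x) => //.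
rewrite opprB addrCA subrr addr0; apply: rV_norm_le => //.
by move=> i; have := yb i; rewrite ler_norml !mxE.
Qed.

(** Mollification at scale h moves a Lipschitz function by at most L h and keeps its Lipschitz
    constant, so the mollified functions are test functions with gradients bounded by L, and
    [H10_closed] applies. *)
Lemma H10_lipschitz (w : V -> R) (L : R) (K Omega : set V) : open Omega ->
  bounded_set Omega -> compact K -> K `<=` Omega -> (forall x, w x != 0 -> K x) -> 0 <= L ->
  (forall x y, `|w x - w y| <= L * `|x - y|) -> H10 Omega w.
Proof.
move=> oO bO cK KO wK L0 lip.
have muO : (mu Omega < +oo)%E by exact: lebesgue_bounded_lty.
have mO : measurable (Omega : set (euclid R N)) by exact: open_measurable_euclid.
have sO : sqint mu Omega w.
  by have := H1_lipschitz oO bO L0 (fun x y _ _ => lip x y); exact: H1_sqO.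
have wO : w \_ Omega = w.
  apply/funext => x; rewrite patchE; case: ifPn => // /negP xO.
  by apply/esym/eqP/negPn/negP => /wK /KO Ox; apply: xO; rewrite inE.
have sw : sqint mu setE w.
  by rewrite -wO; exact: (@sqint_patch _ (euclid R N) R mu Omega w mO).1 sO.
have [mw _] := sw.
have [d [d0 dK]] := compact_margin cK oO KO.
pose s := Num.sqrt (fine (mu Omega)).
have s0 : 0 <= s by exact: sqrtr_ge0.
apply: (@H10_closed R N Omega oO w (\sum_(i < N) (L * s) ^+ 2) sO) => e e0.
(* h < d keeps the mollified support in [Omega]; the second bound makes the L^2 error L h s at most
   e. *)
pose h := Num.min (d / 2) (e / (L * s + 1)).
have Ls1 : 0 < L * s + 1 by rewrite ltr_wpDl// mulr_ge0.
have h0 : 0 < h by rewrite lt_min !divr_gt0.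
have hd : h < d by rewrite gt_min ltr_pdivrMr// ltr_pMr// ltr1n.
have he : L * h * s <= e.
  have : h <= e / (L * s + 1) by rewrite ge_min lexx orbT.
  rewrite ler_pdivlMr// => hLs; apply: le_trans hLs.
  by rewrite mulrDr mulr1 mulrAC mulrC lerDl ltW.
have [rho [t r0 rh r1]] := smooth_kernel N h0.
have ir := integrable_test t.
have tc : test_function Omega (conv w rho).
  by apply: (test_conv (ltW h0) sw t rh cK wK) => // x y Kx xy; apply: (dK x) => //; exact: le_lt_trans hd.
have iS x : mu.-integrable setE (EFin \o (fun y => w (x + y) * rho y)).
  exact: (@sqint_mul_integrable _ (euclid R N) R mu setE measurableT _ _ (sqint_shift x sw) (test_sqintT t)).
have iC c : mu.-integrable setE (EFin \o (fun y => c * rho y)).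
  exact: (integrableZl measurableT c ir).
exists (conv w rho); split => //.
  have Lh0 : 0 <= L * h by rewrite mulr_ge0// ltW.
  have mc := @continuous_measurable_euclid R N Omega _ (continuous_conv sw t).
  have md := measurable_funB mc (sO.1).
  apply: le_trans (nrm_bounded mO Lh0 muO md _) he => x _.
  change (`|conv w rho x - w x| <= L * h).
  have -> : w x = \int[mu]_(y in setE) (w x * rho y).
    by rewrite (@RintegralZl _ (euclid R N) R mu setE rho (w x) measurableT ir) r1 mulr1.
  rewrite (convE sw x t) -(RintegralB measurableT (iS x) (iC (w x))).
  under eq_Rintegral do rewrite -mulrBl.
  have iB : mu.-integrable setE (EFin \o (fun y => (w (x + y) - w x) * rho y)).
    have := integrableB measurableT (iS x) (iC (w x)).
    by apply: eq_integrable => // y _ /=; rewrite mulrBl.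
  apply: (kernel_bound iB ir r0 r1) => y ry.
  by apply: le_trans (lip _ _) _; rewrite ler_wpM2l// (addrC x) addrK rh.
apply: ler_sum => i _.
have sp := test_sqO oO (test_partial i tc); have [mp _] := sp.
rewrite ler_pXn2r ?nnegrE ?nrm_ge0 ?mulr_ge0//.
apply: (nrm_bounded mO L0 muO mp) => x _.
have dc := @smooth_derivable R N _ i x (test_smooth tc).
apply: (lipschitz_partial dc L0) => y z.
rewrite (convE sw y t) (convE sw z t) -(RintegralB measurableT (iS y) (iS z)).
under eq_Rintegral do rewrite -mulrBl.
have iB : mu.-integrable setE (EFin \o (fun x => (w (y + x) - w (z + x)) * rho x)).
  have := integrableB measurableT (iS y) (iS z).
  by apply: eq_integrable => // a _ /=; rewrite mulrBl.
apply: (kernel_bound iB ir r0 r1) => a _.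
by apply: le_trans (lip _ _) _; rewrite opprD addrACA subrr addr0.
Qed.

End lipschitz_compact_support.

(** * Boundary values of |u| and Poincare's inequality *)

Section sobolev_operations.
Context (R : realType) (N : nat).
Local Notation V := 'rV[R]_N.
Local Notation mu := (@lebesgue R N).
Local Notation setE := [set: euclid R N].
Variables (Omega : set V) (oO : open Omega).
Implicit Types (u v w g phi psi : V -> R) (i : 'I_N).
Local Notation sqO := (sqint mu Omega).
Local Notation ipO := (ip mu Omega).
Local Notation nrmO := (nrm mu Omega).
Local Notation wpO i := (wpartial Omega i).

Let mO : measurable (Omega : set (euclid R N)).
Proof. exact: open_measurable_euclid. Qed.

Lemma H10_closed_H10 v (M : 'I_N -> R) : sqO v ->
  (forall e : R, 0 < e -> exists w, [/\ H10 Omega w, nrmO (fun x => w x - v x) <= e &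
    forall i, nrmO (wpO i w) <= M i]) -> H10 Omega v.
Proof.
move=> sv h.
apply: (@H10_closed R N Omega oO v (\sum_(i < N) (M i + 1) ^+ 2) sv) => e e0.
have e2 : 0 < e / 2 by rewrite divr_gt0.
have [w [hw we wM]] := h _ e2.
have d0 : 0 < Num.min (e / 2) 1 by rewrite lt_min e2 ltr01.
have [phi t [pe pM]] := H10_approx oO hw d0; exists phi.
have sw := H1_sqO (H10_H1 hw); have st := test_sqO oO t; split => //.
  apply: le_trans (nrm_triangle mO st sw sv) _; rewrite (nrm_subC mu Omega phi).
  have : Num.min (e / 2) 1 <= e / 2 by rewrite ge_min lexx.
  by move: pe we; set a := nrm _ _ _; set b := nrm _ _ _; set c := Num.min _ _;
    clearbody a b c; lra.
apply: ler_sum => i _; have sp := test_sqO oO (test_partial i t).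
have [sg _] := H1_wpartial i (H10_H1 hw).
have n0 := nrm_ge0 mu Omega (wpO i w).
rewrite ler_pXn2r ?nnegrE ?nrm_ge0//; last by rewrite addr_ge0//; exact: le_trans (wM i).
have := nrm_dist mO sp sg; rewrite nrm_subC ler_norml => /andP[_ h1].
have h2 := pM i; have h3 := wM i.
have : Num.min (e / 2) 1 <= 1 by rewrite ge_min lexx orbT.
by move: h1 h2 h3; set a := nrm _ _ _; set b := nrm _ _ _; set c := Num.min _ _;
  set k := nrm _ _ _; clearbody a b c k; lra.
Qed.

Lemma is_weak_partial_patch i u g : is_weak_partial Omega i u g ->
  is_weak_partial Omega i (u \_ Omega) g.
Proof.
move=> h phi t; rewrite -h//; apply: eq_Rintegral => x xO.
by rewrite patchE xO.
Qed.

(** For phi close to u - psi, the functions |psi + phi| - psi are close to |u| - psi since the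
    absolute value is 1-Lipschitz. They are bounded by |phi|, hence supported in the support of
    phi. *)
Lemma H10_abs psi u (L : R) : bounded_set Omega -> 0 <= L ->
  (forall x y, Omega x -> Omega y -> `|psi x - psi y| <= L * `|x - y|) ->
  (forall x, Omega x -> 0 <= psi x) -> H1 Omega u ->
  H10 Omega (fun x => u x - psi x) -> H10 Omega (fun x => `|u x| - psi x).
Proof.
move=> bO L0 lip psi0 hu hd.
have hpsi := H1_lipschitz oO bO L0 lip.
have [hau _] := H1_abs oO hu.
have su := H1_sqO hu; have sau := H1_sqO hau; have sp := H1_sqO hpsi.
have sv := sqOB oO sau sp.
pose v0 x := u x - psi x.
apply: (H10_closed_H10 (M := fun i => nrmO (wpO i psi) * 2 + nrmO (wpO i v0) + 1) sv) => e e0.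
have d0 : 0 < Num.min e 1 by rewrite lt_min e0 ltr01.
have [phi t [pe pM]] := H10_approx oO hd d0.
have st := test_sqO oO t; have hphi := H1_test oO t.
have hpp := H1D oO hpsi hphi; have [happ appM] := H1_abs oO hpp.
have hw := H1B oO happ hpsi.
pose w0 x := `|psi x + phi x| - psi x.
have w0phi x : Omega x -> `|w0 x| <= `|phi x|.
  move=> Ox; rewrite /w0 -{2}(ger0_norm (psi0 _ Ox)).
  by apply: le_trans (ler_dist_dist _ _) _; rewrite addrAC subrr add0r.
have [Lp Lp0 Lpl] := test_lipschitz t.
have [_ cK KO] := t.
have hw10 : H10 Omega (w0 \_ Omega).
  apply: (H10_lipschitz oO bO cK KO (L := Lp + (L + L))).
  - move=> x; rewrite patchE; case: ifPn => [|_]; last by rewrite eqxx.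
    rewrite inE => Ox wx; apply: closed_support_sub; apply: contra_neq wx => p0.
    by apply/eqP; rewrite -normr_le0; apply: le_trans (w0phi _ Ox) _; rewrite p0 normr0.
  - by rewrite !addr_ge0.
  (* psi is Lipschitz inside [Omega] only. Across the boundary the bound of w0 by |phi| is used, phi
     being Lipschitz everywhere and zero at y. *)
  - have half x y : Omega x -> ~ Omega y -> `|w0 x| <= (Lp + (L + L)) * `|x - y|.
      move=> Ox nOy; apply: le_trans (w0phi _ Ox) _.
      have := Lpl x y; rewrite (test_notin t nOy) subr0 => /le_trans; apply.
      by rewrite ler_wpM2r// lerDl addr_ge0.
    move=> x y; rewrite !patchE; case: ifPn; case: ifPn; rewrite ?inE ?notin_setE => Oy Ox.
    + have -> : w0 x - w0 y =
          (`|psi x + phi x| - `|psi y + phi y|) - (psi x - psi y) by rewrite /w0; ring.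
      apply: le_trans (ler_normB _ _) _.
      have h1 := ler_dist_dist (psi x + phi x) (psi y + phi y).
      have h2 := lip _ _ Ox Oy; have h3 := Lpl x y.
      have h4 : `|psi x + phi x - (psi y + phi y)| <= `|psi x - psi y| + `|phi x - phi y|.
        by rewrite opprD addrACA; exact: ler_normD.
      by rewrite !mulrDl; lra.
    + by rewrite subr0; exact: half.
    + by rewrite sub0r normrN (distrC x); exact: half.
    + by rewrite subrr normr0 mulr_ge0// !addr_ge0.
exists (w0 \_ Omega); split => //.
  have sw := H1_sqO (H10_H1 hw10).
  have s1 := sqOB oO sw sv; have s2 := sqOB oO (H1_sqO (H10_H1 hd)) st.
  have : Num.min e 1 <= e by rewrite ge_min lexx.
  move=> /(le_trans pe) /(fun h => le_trans _ h); apply.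
  apply: (le_nrm mO s1 s2) => x Ox; rewrite patchE mem_set// /w0.
  rewrite opprB addrA subrK.
  by apply: le_trans (ler_dist_dist _ _) _; rewrite distrC opprD addrA.
move=> i; have [sgp wgp] := H1_wpartial i hpsi; have [sga wga] := H1_wpartial i happ.
have wB := is_weak_partialB oO (H1_sqO happ) sp sga sgp wga wgp.
rewrite (nrm_wpartial oO (sqOB oO sga sgp) (is_weak_partial_patch wB)).
apply: le_trans (nrmB mO sga sgp) _.
have spp := test_sqO oO (test_partial i t).
have h1 := appM i.
have wD := is_weak_partialD oO sp st sgp spp wgp (is_weak_partial_test i t).
rewrite (nrm_wpartial oO (sqOD oO sgp spp) wD) in h1.
have h2 := nrmD mO sgp spp.
have [sg0 _] := H1_wpartial i (H10_H1 hd).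
have := nrm_dist mO spp sg0; rewrite nrm_subC ler_norml => /andP[_ h3].
have h4 : nrmO (fun x => wpO i v0 x - partial i phi x) <= 1.
  by apply: le_trans (pM i) _; rewrite ge_min lexx orbT.
rewrite -/v0 in h3.
move: h1 h2 h3 h4; rewrite /v0.
set a := nrm _ _ _; set b := nrm _ _ _; set c := nrm _ _ _; set k := nrm _ _ _.
set m := nrm _ _ _; set n := nrm _ _ _; clearbody a b c k m n; lra.
Qed.

Section poincare.
Variables (r : R) (r0 : 0 < r) (Or : Omega `<=` cube r) (N0 : (0 < N)%N).

(** Translating by the side 2r of the cube in every coordinate moves the support off itself, so
    |phi| is dominated by the translation difference. A coordinate must exist for this, whence
    [N0]. *)
Lemma poincare_test phi : test_function Omega phi ->
  nrmO phi <= r *+ 2 * \sum_(i < N) nrmO (partial i phi).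
Proof.
move=> t; pose a : V := const_mx (- (r *+ 2)).
have sphi := test_sqintT t.
have sB := @sqintB _ (euclid R N) R mu setE measurableT _ _ (sqint_shift a sphi) sphi.
rewrite (nrm_test t).
have h : nrm mu setE phi <= nrm mu setE (fun x => phi (a + x) - phi x).
  apply: (@le_nrm _ (euclid R N) R mu setE measurableT _ _ sphi sB) => x _.
  have [->|px] := eqVneq (phi x) 0; first by rewrite normr0.
  have xr : cube r x by apply: Or; apply: contrapT => /(test_notin t) /eqP; exact/negP.
  have -> : phi (a + x) = 0; last by rewrite sub0r normrN.
  apply: (test_notin t) => /Or /(_ (Ordinal N0)); have := xr (Ordinal N0).
  by rewrite !mxE !ltr_norml mulr2n => /andP[? ?] /andP[? ?]; lra.
apply: le_trans h _; apply: le_trans (nrm_shift_test a t) _.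
rewrite mulr_sumr; apply: ler_sum => i _.
rewrite mxE normrN ger0_norm ?mulrn_wge0 ?(ltW r0)// (nrm_test (test_partial i t)).
exact: lexx.
Qed.

Lemma poincare v : H10 Omega v -> nrmO v <= r *+ 2 * \sum_(i < N) nrmO (wpO i v).
Proof.
move=> hv; apply/ler_addgt0Pr => e e0.
have r20 : 0 <= r *+ 2 by rewrite mulrn_wge0// ltW.
have k0 : 0 < 1 + r *+ 2 * N%:R :> R by rewrite ltr_wpDr// mulr_ge0.
have [phi t [pe pM]] := H10_approx oO hv (divr_gt0 e0 k0).
have st := test_sqO oO t; have sv := H1_sqO (H10_H1 hv).
have := nrm_dist mO sv st; rewrite ler_norml => /andP[_ h1].
have h2 := poincare_test t.
have h3 : \sum_(i < N) nrmO (partial i phi) <=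
    \sum_(i < N) nrmO (wpO i v) + N%:R * (e / (1 + r *+ 2 * N%:R)).
  rewrite -[N in N%:R * _]card_ord mulr_natl -sumr_const -big_split/= ler_sum// => i _.
  have spp := test_sqO oO (test_partial i t); have [sg _] := H1_wpartial i (H10_H1 hv).
  have := nrm_dist mO spp sg; rewrite nrm_subC ler_norml => /andP[_ h3].
  by have := pM i; move: h3; set a := nrm _ _ _; set b := nrm _ _ _; set c := nrm _ _ _;
    set k := e / _; clearbody a b c k; lra.
have h4 : r *+ 2 * \sum_(i < N) nrmO (partial i phi) <=
    r *+ 2 * (\sum_(i < N) nrmO (wpO i v) + N%:R * (e / (1 + r *+ 2 * N%:R))).
  by rewrite ler_wpM2l.
have h5 : e / (1 + r *+ 2 * N%:R) + r *+ 2 * (N%:R * (e / (1 + r *+ 2 * N%:R))) = e.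
  have ke : e / (1 + r *+ 2 * N%:R) * (1 + r *+ 2 * N%:R) = e by rewrite divfK// lt0r_neq0.
  by move: ke; set k := e / _; clearbody k => ke; rewrite -[RHS]ke; ring.
rewrite mulrDr in h4; move: h1 h2 h4 h5 pe.
set a := nrm _ _ _; set b := nrm _ _ _; set c := nrm _ _ _; set k := e / _.
set p := _ * \sum_(_ < _) _; set q := _ * \sum_(_ < _) _; set s := _ * (_ * _).
clearbody a b c k p q s; lra.
Qed.

End poincare.

End sobolev_operations.

(** * Compactness *)

Section kernel_tonelli.
Context d (T : measurableType d) (R : realType).
Variable mu : {measure set T -> \bar R}.
Implicit Types (u rho : T -> R).

Lemma integrable_bounded_mul u rho (c : R) : measurable_fun setT u ->
  (forall x, `|u x| <= c) -> mu.-integrable setT (EFin \o rho) ->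
  mu.-integrable setT (EFin \o (fun x => u x * rho x)).
Proof.
move=> mu_ uc ir; have mr : measurable_fun setT rho.
  by apply/measurable_EFinP; exact: measurable_int ir.
have ic := integrableZl measurableT c ir.
apply: le_integrable ic => //; first by apply/measurable_EFinP; exact: measurable_funM.
move=> x _ /=; rewrite lee_fin !normrM ler_wpM2r//.
by apply: le_trans (uc x) _; exact: ler_norm.
Qed.

(** The variance of [u] under the probability density [rho] is nonnegative. *)
Lemma kernel_jensen u rho : mu.-integrable setT (EFin \o (fun y => u y * rho y)) ->
  mu.-integrable setT (EFin \o (fun y => u y ^+ 2 * rho y)) ->
  mu.-integrable setT (EFin \o rho) -> (forall y, 0 <= rho y) ->
  \int[mu]_y rho y = 1 ->
  (\int[mu]_y (u y * rho y)) ^+ 2 <= \int[mu]_y (u y ^+ 2 * rho y).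
Proof.
move=> i1 i2 ir r0 r1; set m := \int[mu]_y (u y * rho y).
have iZ := integrableZl measurableT (2 * m) i1.
have iB := integrableB measurableT i2 iZ.
have iM := integrableZl measurableT (m ^+ 2) ir.
have : 0 <= \int[mu]_y ((u y - m) ^+ 2 * rho y).
  by apply: Rintegral_ge0 => y _; rewrite mulr_ge0// sqr_ge0.
have -> : (fun y => (u y - m) ^+ 2 * rho y) =
    (fun y => (u y ^+ 2 * rho y - 2 * m * (u y * rho y)) + m ^+ 2 * rho y).
  by apply/funext => y; ring.
rewrite (@RintegralD _ _ _ mu _ _ _ measurableT iB iM).
rewrite (@RintegralB _ _ _ mu _ _ _ measurableT i2 iZ).
rewrite (@RintegralZl _ _ _ mu _ _ (2 * m) measurableT i1).
rewrite (@RintegralZl _ _ _ mu _ _ (m ^+ 2) measurableT ir) r1 mulr1 -/m.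
by rewrite (_ : _ + m ^+ 2 = \int[mu]_y (u y ^+ 2 * rho y) - m ^+ 2) ?subr_ge0//; ring.
Qed.

(** Since |f n - g| <= 2 |v|, its square is at most 2 |v| times |f n - g|, which reduces the claim
    to convergence of an inner product. *)
Lemma nrm_dominated_cvg D (f : nat -> T -> R) (g v : T -> R) : measurable D -> sqint mu D v ->
  (forall n, measurable_fun D (f n)) -> measurable_fun D g ->
  (forall n x, D x -> `|f n x| <= `|v x|) ->
  (forall x, D x -> f n x @[n --> \oo] --> g x) ->
  nrm mu D (fun x => f n x - g x) @[n --> \oo] --> 0.
Proof.
move=> mD sv mf mg fv fg.
have gv x : D x -> `|g x| <= `|v x|.
  move=> Dx; have c : (fun n => `|f n x|) @ \oo --> `|g x| by exact: cvg_norm (fg x Dx).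
  by apply: (cvgr_to_le c); apply: nearW => n; exact: fv.
pose v2 (x : T) : R := 2 * `|v x|.
have sv2 : sqint mu D v2 by have h := sqintZ mD 2 (sqint_norm mD sv); exact: h.
have fgv2 n x : D x -> `|f n x - g x| <= v2 x.
  move=> Dx; apply: le_trans (ler_normB _ _) _; rewrite /v2 mulrC mulr_natr mulr2n.
  by rewrite lerD ?fv ?gv.
have v20 x : 0 <= v2 x by rewrite mulr_ge0.
have md n : measurable_fun D (fun x => f n x - g x) by exact: measurable_funB.
have mn n : measurable_fun D (fun x => `|f n x - g x|) by exact: measurableT_comp.
have sn n : sqint mu D (fun x => f n x - g x).
  by apply: (le_sqint mD (md n) sv2) => x Dx; rewrite (ger0_norm (v20 x)); exact: fgv2.
have : ip mu D v2 (fun x => `|f n x - g x|) @[n --> \oo] --> ip mu D v2 (fun=> 0).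
  apply: (@ip_dominated_cvg _ T R mu D mD v2 (fun n x => `|f n x - g x|) (fun=> 0) v2 sv2 sv2 mn).
  - exact: measurable_cst.
  - by move=> n x Dx; rewrite normr_id (ger0_norm (v20 x)); exact: fgv2.
  - move=> x Dx.
    have h1 : (fun n => f n x - g x) @ \oo --> g x - g x by exact: cvgB (fg x Dx) (cvg_cst _).
    have h2 : (fun n => `|f n x - g x|) @ \oo --> `|g x - g x| by exact: cvg_norm h1.
    by rewrite subrr normr0 in h2.
have -> : ip mu D v2 (fun=> 0) = 0.
  rewrite -[RHS](mul0r (ip mu D v2 (fun=> 0))) -(ipZr mD 0 (sqint0 mu D) sv2).
  by congr (ip _ _ _ _); apply/funext => x; rewrite mul0r.
move=> c0; apply/cvgrPdist_lt => e e0.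
have /cvgrPdist_lt/(_ _ (exprn_gt0 2 e0)) := c0.
apply: filterS => n; rewrite !sub0r !normrN => h.
rewrite (ger0_norm (nrm_ge0 _ _ _)) -(@ltr_pXn2r _ 2)// ?nnegrE ?nrm_ge0 ?(ltW e0)//.
apply: le_lt_trans h; apply: le_trans (ler_norm _); rewrite sqr_nrm.
apply: le_Rintegral => //.
- exact: sqint_mul_integrable.
- have h1 := sqint_mul_integrable mD sv2 (sqint_norm mD (sn n)); exact: h1.
- move=> x Dx; rewrite -expr2 -real_normK ?num_real// expr2 ler_wpM2r//; exact: fgv2.
Qed.

End kernel_tonelli.

Section tonelli.
Context d1 d2 (T1 : measurableType d1) (T2 : measurableType d2) (R : realType).
Variables (m1 : {sigma_finite_measure set T1 -> \bar R})
  (m2 : {sigma_finite_measure set T2 -> \bar R}).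

(** An average of functions has L^2 norm at most the largest of their norms: Jensen's inequality
    inside, then Tonelli's theorem. *)
Lemma kernel_tonelli (a : T1 * T2 -> R) (rho : T2 -> R) (c : T1 -> R) (B : R) :
  measurable_fun setT a -> measurable_fun setT c ->
  m2.-integrable setT (EFin \o rho) -> (forall y, 0 <= rho y) ->
  \int[m2]_y rho y = 1 -> 0 <= B ->
  (forall x, m2.-integrable setT (EFin \o (fun y => a (x, y) * rho y))) ->
  (forall x, m2.-integrable setT (EFin \o (fun y => a (x, y) ^+ 2 * rho y))) ->
  (forall x, c x = \int[m2]_y (a (x, y) * rho y)) ->
  (forall y, rho y != 0 -> (\int[m1]_x (a (x, y) ^+ 2)%:E <= B%:E)%E) ->
  (\int[m1]_x (c x ^+ 2)%:E <= B%:E)%E.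
Proof.
move=> ma mc ir r0 r1 B0 i1 i2 cE aB.
have mr : measurable_fun setT rho by apply/measurable_EFinP; exact: measurable_int ir.
pose f (p : T1 * T2) : \bar R := (a p ^+ 2 * rho p.2)%:E.
have mf : measurable_fun setT f.
  apply/measurable_EFinP; apply: measurable_funM; first exact: measurable_funX.
  exact: measurableT_comp mr measurable_snd.
have f0 p : (0 <= f p)%E by rewrite lee_fin mulr_ge0// sqr_ge0.
apply: (@le_trans _ _ (\int[m1]_x \int[m2]_y f (x, y))%E).
  apply: ge0_le_integral => //.
  - by move=> x _; rewrite lee_fin sqr_ge0.
  - by apply/measurable_EFinP; exact: measurable_funX.
  -   have h := measurable_fun_fubini_tonelli_F (m2 := m2) f mf f0; exact: h.
  - move=> x _; have fn := integrable_fin_num measurableT (i2 x).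
    rewrite -[leRHS]fineK//= lee_fin cE.
    exact: (kernel_jensen (i1 x) (i2 x) ir r0 r1).
have := fubini_tonelli (m1 := m1) (m2 := m2) f mf f0; rewrite /fubini_F => ->.
apply: (@le_trans _ _ (\int[m2]_y (B%:E * (rho y)%:E))%E).
  apply: ge0_le_integral => //.
  - by move=> y _; exact: integral_ge0.
  - have h := measurable_fun_fubini_tonelli_G (m1 := m1) f mf f0; exact: h.
  - by apply: measurable_funeM; apply/measurable_EFinP.
  - move=> y _; rewrite /f /=.
    have -> : (\int[m1]_x (a (x, y) ^+ 2 * rho y)%:E =
        (rho y)%:E * \int[m1]_x (a (x, y) ^+ 2)%:E)%E.
      under eq_integral do rewrite mulrC EFinM.
      rewrite ge0_integralZl_EFin//.
        by move=> x _; rewrite lee_fin sqr_ge0.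
      apply/measurable_EFinP; apply: measurable_funX.
      exact: measurableT_comp ma (measurable_pair2 y).
    have [->|ry] := eqVneq (rho y) 0; first by rewrite mul0e mule0.
    by rewrite muleC lee_wpmul2r ?lee_fin// aB.
rewrite ge0_integralZl_EFin//; last 2 first.
- by move=> y _; rewrite lee_fin.
- by apply/measurable_EFinP.
have := integrable_fin_num measurableT ir => fn.
have : (\int[m2]_y (rho y)%:E)%E = 1%E by rewrite -(fineK fn) -[fine _]/(Rintegral _ _ _) r1.
by move=> ->; rewrite mule1.
Qed.

End tonelli.

Section mollification_error.
Context (R : realType) (N : nat).
Local Notation V := 'rV[R]_N.
Local Notation mu := (@lebesgue R N).
Local Notation setE := [set: euclid R N].

(** The error is the average over y of the translation differences phi(x + y) - phi(x), each of L^2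
    norm at most |y| times the sum of the gradient norms. *)
Lemma nrm_conv_sub (Omega : set V) (phi rho : V -> R) (h : R) :
  test_function Omega phi -> test_function setT rho -> (forall y, 0 <= rho y) ->
  (forall y, rho y != 0 -> `|y| <= h) -> \int[mu]_(y in setE) rho y = 1 -> 0 <= h ->
  nrm mu setE (fun x => conv phi rho x - phi x) <=
  h * \sum_(i < N) nrm mu setE (partial i phi).
Proof.
move=> tO t r0 rh r1 h0; set S := \sum_(i < N) _.
have S0 : 0 <= S by rewrite sumr_ge0// => i _; exact: nrm_ge0.
have sphi := test_sqintT tO; have ir := integrable_test t.
have [M [M0 MP]] := test_bounded tO.
have cphi := test_continuous tO.
pose a (p : euclid R N * euclid R N) : R := phi ((p.1 : V) + (p.2 : V)) - phi (p.1 : V).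
have mcoord (i : 'I_N) := @measurable_coord R N i.
have ma : measurable_fun setT a.
  apply: measurable_funB.
    apply: (@measurable_continuous_comp R N _ (euclid R N * euclid R N)%type setT
      (fun p => (p.1 : V) + (p.2 : V)) phi) => // i.
    under eq_fun do rewrite mxE.
    apply: measurable_funD.
      exact: measurableT_comp (mcoord i) measurable_fst.
    exact: measurableT_comp (mcoord i) measurable_snd.
  have mphi := @continuous_measurable_euclid R N setT phi cphi.
  exact: measurableT_comp mphi measurable_fst.
pose c (x : euclid R N) : R := conv phi rho x - phi x.
have mc : measurable_fun setT c.
  have m1 := @continuous_measurable_euclid R N setT _ (continuous_conv sphi t).
  have m2 := @continuous_measurable_euclid R N setT phi cphi.
  exact: measurable_funB m1 m2.
have may (x : euclid R N) : measurable_fun setT (fun y : euclid R N => a (x, y)).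
  exact: measurableT_comp ma (measurable_pair1 x).
have aM (p : euclid R N * euclid R N) : `|a p| <= M + M.
  by apply: le_trans (ler_normB _ _) _; exact: lerD (MP _) (MP _).
have i1 (x : euclid R N) : mu.-integrable setT (EFin \o (fun y => a (x, y) * rho y)).
  exact: (@integrable_bounded_mul _ (euclid R N) R mu _ rho _ (may x) (fun y => aM (x, y)) ir).
have may2 (x : euclid R N) : measurable_fun setT (fun y : euclid R N => a (x, y) ^+ 2).
  have := may x; exact: measurable_funX.
have aM2 (p : euclid R N * euclid R N) : `|a p ^+ 2| <= (M + M) ^+ 2.
  have M2 : 0 <= M + M by rewrite addr_ge0 ?ltW.
  by rewrite normrX ler_pXn2r ?nnegrE.
have i2 (x : euclid R N) : mu.-integrable setT (EFin \o (fun y => a (x, y) ^+ 2 * rho y)).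
  exact: (@integrable_bounded_mul _ (euclid R N) R mu _ rho _ (may2 x) (fun y => aM2 (x, y)) ir).
have cE (x : euclid R N) : c x = \int[mu]_(y in setT) (a (x, y) * rho y).
  rewrite /c (convE sphi x t).
  have E : phi x = \int[mu]_(y in setE) (phi x * rho y).
    by rewrite (@RintegralZl _ (euclid R N) R mu setE rho (phi x) measurableT ir) r1 mulr1.
  rewrite [in X in _ - X]E.
  have iS : mu.-integrable setE (EFin \o (fun y => phi ((x : V) + y) * rho y)).
    exact: (@sqint_mul_integrable _ (euclid R N) R mu setE measurableT _ _
      (sqint_shift x sphi) (test_sqintT t)).
  have iC := integrableZl measurableT (phi x) ir.
  rewrite -(@RintegralB _ (euclid R N) R mu setE _ _ measurableT iS iC).
  by apply: eq_Rintegral => y _; rewrite /a mulrBl.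
have B0 : 0 <= (h * S) ^+ 2 by exact: sqr_ge0.
have aB (y : euclid R N) : rho y != 0 -> (\int[mu]_x (a (x, y) ^+ 2)%:E <= ((h * S) ^+ 2)%:E)%E.
  move=> ry; have sB := @sqintB _ (euclid R N) R mu setE measurableT _ _ (sqint_shift y sphi) sphi.
  have E : (\int[mu]_x (a (x, y) ^+ 2)%:E =
      (nrm mu setE (fun x => phi ((y : V) + x) - phi x) ^+ 2)%:E)%E.
    rewrite sqr_nrm (@ipE _ (euclid R N) R mu setE measurableT _ sB).
    by apply: eq_integral => x _; rewrite /a /= (addrC (y : V) x).
  rewrite E lee_fin ler_pXn2r ?nnegrE ?nrm_ge0 ?mulr_ge0//.
  apply: le_trans (nrm_shift_test y tO) _; rewrite /S mulr_sumr; apply: ler_sum => i _.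
  rewrite ler_wpM2r ?nrm_ge0//.
  by apply: le_trans (coord_le_norm _ i) _; exact: rh.
have key := @kernel_tonelli _ _ (euclid R N) (euclid R N) R mu mu a rho c _ ma mc ir r0 r1 B0 i1 i2 cE aB.
have sc : sqint mu setE c by split => //; exact: le_lt_trans key (ltry _).
move: key; rewrite -(@ipE _ (euclid R N) R mu setE measurableT _ sc) -sqr_nrm lee_fin.
by rewrite ler_pXn2r ?nnegrE ?nrm_ge0 ?mulr_ge0.
Qed.

End mollification_error.

Section rellich.
Context (R : realType) (N : nat).
Local Notation V := 'rV[R]_N.
Local Notation mu := (@lebesgue R N).
Local Notation setE := [set: euclid R N].
Variables (Omega : set V) (oO : open Omega) (bO : bounded_set Omega).
Implicit Types (u v w g phi psi : V -> R) (i : 'I_N).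
Local Notation sqO := (sqint mu Omega).
Local Notation nrmO := (nrm mu Omega).

Let mO : measurable (Omega : set (euclid R N)).
Proof. exact: open_measurable_euclid. Qed.

Let muO : (mu Omega < +oo)%E.
Proof. exact: lebesgue_bounded_lty. Qed.

Lemma cvg_of_cauchy (a : nat -> R) : (forall e : R, 0 < e -> exists n0, forall n m,
    (n0 <= n)%N -> (n0 <= m)%N -> `|a n - a m| < e) -> cvgn a.
Proof.
move=> ca; apply/cauchy_cvgP/cauchy_exP => e e0; have [n0 n0P] := ca e e0.
by exists (a n0); exists n0 => // n /= n0n; exact: n0P.
Qed.

Lemma incr_ge (s : nat -> nat) : (forall n, (s n < s n.+1)%N) -> forall n, (n <= s n)%N.
Proof. by move=> si; elim=> // n IH; exact: leq_ltn_trans IH (si n). Qed.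

(** One subsequence serves all scales: the mollified values at rational points are extracted
    simultaneously, the uniform Lipschitz bound extends convergence to all points, and boundedness
    gives L^2 convergence at each scale. The mollification error is uniform in n. *)
Lemma rellich_test (phi : nat -> V -> R) (A : R) :
  (forall n, test_function Omega (phi n)) -> (forall n, nrmO (phi n) <= A) ->
  (forall n, \sum_(i < N) nrmO (partial i (phi n)) <= A) ->
  exists s : nat -> nat, (forall n, (s n < s n.+1)%N) /\
    forall e : R, 0 < e -> exists n0, forall n m, (n0 <= n)%N -> (n0 <= m)%N ->
      nrmO (fun x => phi (s n) x - phi (s m) x) < e.
Proof.
move=> t pA dA.
have A0 : 0 <= A by apply: le_trans (pA 0%N); exact: nrm_ge0.
have /choice[rho rhoP] : forall k : nat, exists rho : V -> R,
    [/\ test_function setT rho, forall y, 0 <= rho y,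
        forall y, rho y != 0 -> `|y| <= k.+1%:R^-1 & \int[mu]_(y in setE) rho y = 1].
  by move=> k; apply: smooth_kernel; rewrite invr_gt0.
have tr k : test_function setT (rho k) by have [] := rhoP k.
have sT n := test_sqintT (t n).
have pAT n : nrm mu setE (phi n) <= A by rewrite -(nrm_test (t n)).
pose c n k x : R := conv (phi n) (rho k) x.
pose B k : R := A * nrm mu setE (rho k).
have cB n k x : `|c n k x| <= B k.
  have trx : test_function setT (fun y => rho k (- x + y)) by exact: test_translate.
  apply: le_trans (@cauchy_schwarz _ (euclid R N) R mu setE measurableT _ _ (sT n) (test_sqintT trx)) _.
  have [mr _] := test_sqintT (tr k).
  by rewrite (nrm_shift (- x) mr) ler_wpM2r ?nrm_ge0.
pose L k : R := A * \sum_(i < N) nrm mu setE (partial i (rho k)).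
have L0 k : 0 <= L k by rewrite mulr_ge0// sumr_ge0// => i _; exact: nrm_ge0.
have cL n k x y : `|c n k x - c n k y| <= L k * `|x - y|.
  apply: le_trans (conv_lipschitz (sT n) x y (tr k)) _.
  apply: (@le_trans _ _ (A * \sum_(i < N) `|(x - y) 0 i| * nrm mu setE (partial i (rho k)))).
    by rewrite ler_wpM2r// sumr_ge0// => i _; rewrite mulr_ge0 ?nrm_ge0.
  rewrite /L -mulrA ler_wpM2l// mulr_suml ler_sum// => i _; rewrite mulrC.
  by rewrite ler_wpM2l ?nrm_ge0// coord_le_norm.
(* [j] codes a scale together with a rational point. *)
pose a n (j : nat) : R := if unpickle j is Some (k, q) then
  c n k (map_mx ratr (q : 'rV[rat]_N)) else 0.
pose Ba (j : nat) : R := if unpickle j is Some (k, q) then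
  let _ : 'rV[rat]_N := q in B k else 0.
have aB n j : `|a n j| <= Ba j.
  by rewrite /a /Ba; case: unpickle => [[k q]|]; [exact: cB|rewrite normr0].
have [s [si sc]] := diagonal_extraction aB.
exists s; split => // e e0.
have cq k (q : 'rV[rat]_N) : cvgn (fun n => c (s n) k (map_mx ratr q)).
  by have := sc (pickle (k, q)); rewrite /a pickleK.
have cx k x : cvgn (fun n => c (s n) k x).
  apply: cvg_of_cauchy => d d0.
  have L1 : 0 < L k + 1 by rewrite ltr_wpDl.
  have [q xq] := rational_dense x (divr_gt0 (divr_gt0 d0 (ltr0n R 3)) L1).
  have /cvg_cauchy/cauchy_ballP/(_ _ (divr_gt0 d0 (ltr0n R 3))) := cq k q.
  move=> /= [[P Q] /= [[n1 _ P1] [n2 _ P2]] PQ].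
  exists (maxn n1 n2) => n m; rewrite !geq_max => /andP[n1n n2n] /andP[n1m n2m].
  have h1 := PQ (c (s n) k (map_mx ratr q), c (s m) k (map_mx ratr q)) (conj (P1 _ n1n) (P2 _ n2m)); rewrite /ball/= in h1.
  have h2 := cL (s n) k x (map_mx ratr q).
  have h3 := cL (s m) k (map_mx ratr q) x; rewrite distrC in h3.
  have h4 : L k * `|x - map_mx ratr q| < d / 3.
    rewrite ltr_pdivlMr// in xq; apply: le_lt_trans xq.
    by rewrite mulrC ler_wpM2l// lerDl.
  have E : `|map_mx ratr q - x| = `|x - map_mx ratr q| by exact: distrC.
  have h5 := ler_distD (c (s n) k (map_mx ratr q)) (c (s n) k x) (c (s m) k x).
  have h6 := ler_distD (c (s m) k (map_mx ratr q)) (c (s n) k (map_mx ratr q)) (c (s m) k x).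
  rewrite (distrC (c (s m) k x)) in h3; rewrite E in h3.
  move: h1 h2 h3 h4 h5 h6; rewrite /=.
  move: (c (s n) k x) (c (s m) k x) (c (s n) k _) (c (s m) k _) (L k * _) => a1 a2 a3 a4 a5.
  by lra.
pose g k x : R := limn (fun n => c (s n) k x).
have mc n k : measurable_fun (Omega : set (euclid R N)) (c n k).
  exact: @continuous_measurable_euclid R N Omega _ (continuous_conv (sT n) (tr k)).
have mg k : measurable_fun (Omega : set (euclid R N)) (g k).
  have h := @measurable_fun_cvg _ (euclid R N) R Omega (fun n => c (s n) k) (g k)
    (fun n => mc (s n) k).
  by apply: h => x _; exact: cx.
have sB k : sqO (cst (B k)).
  have h := @bounded_sqint _ (euclid R N) R mu Omega mO (cst (B k)) `|B k| muO (measurable_cst _).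
  by apply: h.
have cg k : nrmO (fun x => c (s n) k x - g k x) @[n --> \oo] --> 0.
  have h := @nrm_dominated_cvg _ (euclid R N) R mu Omega (fun n => c (s n) k) (g k) (cst (B k))
    mO (sB k) (fun n => mc (s n) k) (mg k).
  apply: h => [n x _|x _]; last exact: cx.
  by apply: le_trans (cB _ _ _) _; exact: ler_norm.
(* Four errors, each below e/5: mollification of either term, and the distance of either mollified
   term to its limit. *)
have e5 : 0 < e / 5 by rewrite divr_gt0.
have A1 : 0 < A + 1 by rewrite ltr_wpDl.
have [k kP] := inv_natS_lt (divr_gt0 e5 A1).
have /cvgrPdist_lt/(_ _ e5)[n0 _ n0P] := cg k.
have sc_ n : sqO (c n k).
  have h := @bounded_sqint _ (euclid R N) R mu Omega mO (c n k) (B k) muO (mc n k).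
  by apply: h => x _; exact: cB.
have sg : sqO (g k).
  have h := @bounded_sqint _ (euclid R N) R mu Omega mO (g k) (B k) muO (mg k).
  apply: h => x _; have cn : (fun n => `|c (s n) k x|) @ \oo --> `|g k x| by exact: cvg_norm (cx k x).
  by apply: (cvgr_to_le cn); apply: nearW => n; exact: cB.
have sp n := test_sqO oO (t n).
have close n : nrmO (fun x => c n k x - phi n x) < e / 5.
  have [t' r0 rh r1] := rhoP k; have k0 : 0 <= k.+1%:R^-1 :> R by rewrite invr_ge0.
  have [_ cK _] := t n.
  have tc : test_function setT (c n k).
    exact: (test_conv k0 (sT n) t' rh cK (fun x => @closed_support_sub R N (phi n) x) (fun _ _ _ _ => I)).
  have sC := @sqintB _ (euclid R N) R mu setE measurableT _ _ (test_sqintT tc) (sT n).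
  apply: le_lt_trans (@nrm_sub _ (euclid R N) R mu Omega setE _ mO measurableT (@subsetT _ _) sC) _.
  apply: le_lt_trans (nrm_conv_sub (t n) t' r0 rh r1 k0) _.
  have -> : \sum_(i < N) nrm mu setE (partial i (phi n)) = \sum_(i < N) nrmO (partial i (phi n)).
    by apply: eq_bigr => i _; rewrite (nrm_test (test_partial i (t n))).
  apply: (@le_lt_trans _ _ (k.+1%:R^-1 * A)); first by rewrite ler_wpM2l// dA.
  rewrite ltr_pdivlMr// in kP; apply: le_lt_trans kP; rewrite ler_wpM2l// lerDl//.
exists n0 => n m n0n n0m.
have h1 := n0P _ n0n; have h2 := n0P _ n0m.
rewrite sub0r normrN (ger0_norm (nrm_ge0 _ _ _)) in h1.
rewrite sub0r normrN (ger0_norm (nrm_ge0 _ _ _)) in h2.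
have h3 := close (s n); have h4 := close (s m).
have t1 := nrm_triangle mO (sp (s n)) (sc_ (s n)) (sp (s m)).
have t2 := nrm_triangle mO (sc_ (s n)) sg (sp (s m)).
have t3 := nrm_triangle mO sg (sc_ (s m)) (sp (s m)).
rewrite nrm_subC in h3; rewrite nrm_subC in h2.
move: h1 h2 h3 h4 t1 t2 t3.
set q1 := nrm _ _ _; set q2 := nrm _ _ _; set q3 := nrm _ _ _; set q4 := nrm _ _ _.
set q5 := nrm _ _ _; set q6 := nrm _ _ _; set q7 := nrm _ _ _.
clearbody q1 q2 q3 q4 q5 q6 q7; lra.
Qed.

(** Test functions within 1/(n+1) in H^1 satisfy bounds of the same kind, and [n <= s n] makes the
    approximation error vanish along the subsequence. *)
Lemma rellich (v : nat -> V -> R) (A : R) :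
  (forall n, H10 Omega (v n)) -> (forall n, nrmO (v n) <= A) ->
  (forall n, \sum_(i < N) nrmO (wpartial Omega i (v n)) <= A) ->
  exists (s : nat -> nat) w, [/\ forall n, (n <= s n)%N, sqO w,
    nrmO (fun x => v (s n) x - w x) @[n --> \oo] --> 0 &
    ae_on Omega (fun x => v (s n) x @[n --> \oo] --> w x)].
Proof.
move=> hv vA dA.
have /choice[phi phiP] : forall n, exists phi, test_function Omega phi /\
    nrmO (fun x => v n x - phi x) <= n.+1%:R^-1 /\
    forall i, nrmO (fun x => wpartial Omega i (v n) x - partial i phi x) <= n.+1%:R^-1.
  move=> n; have n1 : 0 < n.+1%:R^-1 :> R by rewrite invr_gt0.
  by have [phi t h] := H10_approx oO (hv n) n1; exists phi.
have t n : test_function Omega (phi n) by have [] := phiP n.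
have sv n := H1_sqO (H10_H1 (hv n)); have sp n := test_sqO oO (t n).
have le1 n : n.+1%:R^-1 <= 1 :> R by rewrite invf_le1 ?ltr0n// ler1n.
have pA n : nrmO (phi n) <= A + 1 + N%:R.
  have [_ [h _]] := phiP n; have := nrm_dist mO (sp n) (sv n).
  rewrite nrm_subC ler_norml => /andP[_ h2]; have := vA n; have := le1 n.
  have : 0 <= N%:R :> R by [].
  move: h h2; set a := nrm _ _ _; set b := nrm _ _ _; set c := nrm _ _ _.
  by set k := n.+1%:R^-1; clearbody a b c k; lra.
have pdA n : \sum_(i < N) nrmO (partial i (phi n)) <= A + 1 + N%:R.
  have : \sum_(i < N) nrmO (partial i (phi n)) <=
      \sum_(i < N) (nrmO (wpartial Omega i (v n)) + 1).
    apply: ler_sum => i _; have [_ [_ h]] := phiP n.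
    have spp := test_sqO oO (test_partial i (t n)); have [sg _] := H1_wpartial i (H10_H1 (hv n)).
    have := nrm_dist mO spp sg; rewrite nrm_subC ler_norml => /andP[_ h3].
    move: (h i) h3 (le1 n); set a := nrm _ _ _; set b := nrm _ _ _; set c := nrm _ _ _.
    by set k := n.+1%:R^-1; clearbody a b c k; lra.
  rewrite big_split/= sumr_const card_ord => /le_trans; apply.
  by have := dA n; lra.
have [s [si sc]] := rellich_test t pA pdA.
have cv (e : R) : 0 < e -> exists n0, forall n m, (n0 <= n)%N -> (n0 <= m)%N ->
    nrmO (fun x => v (s n) x - v (s m) x) < e.
  move=> e0; have e3 : 0 < e / 3 by rewrite divr_gt0.
  have [n1 n1P] := sc _ e3; have [n2 n2P] := inv_natS_lt e3.
  exists (maxn n1 n2) => n m; rewrite !geq_max => /andP[n1n n2n] /andP[n1m n2m].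
  have small k : (n2 <= k)%N -> nrmO (fun x => v (s k) x - phi (s k) x) < e / 3.
    move=> n2k; have [_ [h _]] := phiP (s k); apply: le_lt_trans h (le_lt_trans _ n2P).
    by rewrite lef_pV2 ?posrE// ler_nat ltnS (leq_trans n2k)// incr_ge.
  have h1 := small n n2n; have h2 := small m n2m; have h3 := n1P _ _ n1n n1m.
  have t1 := nrm_triangle mO (sv (s n)) (sp (s n)) (sv (s m)).
  have t2 := nrm_triangle mO (sp (s n)) (sp (s m)) (sv (s m)).
  rewrite nrm_subC in h2; move: h1 h2 h3 t1 t2.
  set q1 := nrm _ _ _; set q2 := nrm _ _ _; set q3 := nrm _ _ _; set q4 := nrm _ _ _.
  by set q5 := nrm _ _ _; clearbody q1 q2 q3 q4 q5; lra.
have h := @sqint_complete _ (euclid R N) R mu Omega mO (fun n => v (s n)) (fun n => sv (s n)) cv.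
have [w [sw wc [s' [si' wae]]]] := h.
exists (fun n => s (s' n)), w; split => //.
- by move=> n; apply: leq_trans (incr_ge si' n) _; exact: incr_ge.
- apply/cvgrPdist_lt => e e0; have /cvgrPdist_lt/(_ _ e0)[n0 _ n0P] := wc.
  exists n0 => // n /= n0n; apply: n0P => /=; exact: leq_trans n0n (incr_ge si' n).
Qed.

End rellich.

(** * Superposition operators *)

Section caratheodory.
Context d (T : measurableType d) (R : realType).
Local Notation mR := (measurableTypeR R).
Variable f : T -> R -> R.
Hypotheses (mf : forall s, measurable_fun setT (f ^~ s)) (cf : forall x, continuous (f x)).

Let grid n (s : R) : R := (Num.floor (n.+1%:R * s))%:~R / n.+1%:R.

Let cvg_grid s : grid n s @[n --> \oo] --> s.
Proof.
apply/cvgrPdist_lt => e e0; have [n0 n0P] := inv_natS_lt e0; exists n0 => // n /= n0n.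
have n1 : 0 < n.+1%:R :> R by [].
have /andP[h1 h2] := floor_itv (n.+1%:R * s).
have g1 : grid n s <= s by rewrite /grid ler_pdivrMr// (mulrC s).
have g2 : s < grid n s + n.+1%:R^-1.
  rewrite /grid -[X in _ + X]mul1r -mulrDl ltr_pdivlMr// (mulrC s).
  by move: h2; rewrite intrD.
have g3 : n.+1%:R^-1 <= n0.+1%:R^-1 :> R by rewrite lef_pV2 ?posrE// ler_nat.
rewrite ger0_norm ?subr_ge0//; move: g2 g3 n0P.
set a := n.+1%:R^-1; set b := n0.+1%:R^-1; set c := grid n s; clearbody a b c; lra.
Qed.

(** With s rounded down to the grid of mesh 1/(n+1), the function is a countable patchwork of
    functions of x alone; continuity in s lets the mesh tend to 0. *)
Lemma measurable_caratheodory : measurable_fun setT (fun p : T * mR => f p.1 p.2).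
Proof.
have mg n : measurable_fun setT (fun p : T * mR => f p.1 (grid n p.2)).
  move=> _ A mA; rewrite setTI.
  have -> : (fun p : T * mR => f p.1 (grid n p.2)) @^-1` A =
      \bigcup_(z in [set: int]) (((f ^~ (z%:~R / n.+1%:R)) @^-1` A) `*`
        [set s : mR | z%:~R <= n.+1%:R * s < (z + 1)%:~R]).
    apply/seteqP; split => [[x s] /= fxs|[x s] /= [z _ [/= fz zs]]].
      by exists (Num.floor (n.+1%:R * s)) => //; split => //=; exact: floor_itv.
    by rewrite /grid (floor_def zs).
  apply: countable_bigcupT_measurable => [|z]; first exact: countableP.
  apply: measurableX.
    by rewrite -[X in measurable X]setTI; exact: mf.
  have -> : [set s : mR | z%:~R <= n.+1%:R * s < (z + 1)%:~R] =
      `[z%:~R / n.+1%:R, (z + 1)%:~R / n.+1%:R[%classic.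
    by apply/seteqP; split => s /=; rewrite in_itv/= ler_pdivrMr// ltr_pdivlMr// (mulrC s).
  exact: measurable_itv.
have key x (s : R) : f x (grid n s) @[n --> \oo] --> f x s.
  by apply: continuous_cvg; [exact: cf|exact: cvg_grid].
apply: (@measurable_fun_cvg _ (T * mR)%type R setT
  (fun n p => f p.1 (grid n p.2)) (fun p => f p.1 p.2) mg) => -[x s] _ /=.
exact: key.
Qed.

(** Tonelli's theorem applied to the positive and negative parts of f cut off to the region between
    the graphs of a and b. *)
Lemma measurable_integral_between (a b : T -> R) :
  measurable_fun setT a -> measurable_fun setT b ->
  measurable_fun setT (fun x => \int[lebesgue_measure]_(s in `[a x, b x]) f x s).
Proof.
move=> ma mb; pose E := [set p : T * mR | a p.1 <= (p.2 : R) <= b p.1].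
have m1 : measurable_fun setT (fun p : T * mR => a p.1).
  exact: measurableT_comp ma measurable_fst.
have m2 : measurable_fun setT (fun p : T * mR => b p.1).
  exact: measurableT_comp mb measurable_fst.
have mE : measurable E.
  have -> : E = (setT `&` (fun p : T * mR => a p.1 <= (p.2 : R)) @^-1` [set true]) `&`
      (setT `&` (fun p : T * mR => (p.2 : R) <= b p.1) @^-1` [set true]).
    apply/seteqP; split => p /=; first by move=> /andP[h1 h2].
    by move=> [[_ h1] [_ h2]]; apply/andP; split.
  apply: measurableI.
    exact: (measurable_fun_ler m1 measurable_snd).
  exact: (measurable_fun_ler measurable_snd m2).
pose h : T * mR -> \bar R := (fun p => (f p.1 p.2)%:E) \_ E.
have mh : measurable_fun setT h.
  have r := @measurable_restrict _ _ _ _ E setT (fun p : T * mR => (f p.1 p.2)%:E) mE measurableT.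
  rewrite setTI in r; apply/r; apply: measurable_funTS.
  by apply/measurable_EFinP; exact: measurable_caratheodory.
pose L : {sigma_finite_measure set mR -> \bar R} := @lebesgue_measure R.
have mFp := measurable_fun_fubini_tonelli_F (m2 := L) _ (measurable_funepos mh)
  (fun p => funepos_ge0 h p).
have mFn := measurable_fun_fubini_tonelli_F (m2 := L) _ (measurable_funeneg mh)
  (fun p => funeneg_ge0 h p).
have mB := emeasurable_funB mFp mFn.
have := measurableT_comp (fine_measurable measurableT) mB.
congr (measurable_fun _ _); apply/funext => x /=.
rewrite /Rintegral integral_mkcond integralE; congr fine.
have hE s : h (x, s) = ((EFin \o f x) \_ `[a x, b x]) s.
  rewrite /h !patchE (_ : ((x, s) \in E) = (s \in `[a x, b x]%classic))//.
by congr (_ - _)%E; apply: eq_integral => s _; rewrite ?funeposE ?funenegE hE.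
Qed.

End caratheodory.

Section continuous_primitive.
Context (R : realType) (h : R -> R) (ch : continuous h).
Local Notation mu := (@lebesgue_measure R).

Let P t : R := if 0 <= t then \int[mu]_(s in `[0, t]) h s else - \int[mu]_(s in `[t, 0]) h s.

Let ih (a b : R) : mu.-integrable `[a, b] (EFin \o h).
Proof.
apply: continuous_compact_integrable; first exact: segment_compact.
exact: continuous_subspaceT.
Qed.

(** On [-K, K] the primitive, defined by cases on the sign of t, is a single integral from -K minus
    a constant, whose continuity is known. *)
Let PE (K t : R) : - K <= t <= K -> 0 <= K -> P t =
  parameterized_integral mu (- K) t h - parameterized_integral mu (- K) 0 h.
Proof.
move=> /andP[Kt tK] K0; rewrite /P /parameterized_integral.
have Kn : - K <= 0 by rewrite oppr_le0.
case: ifPn => [t0|]; last rewrite -ltNge => t0.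
  rewrite (@Rintegral_itvB R h (BLeft (- K)) (BRight t) 0 (ih (- K) t)); rewrite ?bnd_simp//.
  rewrite Rintegral_itv_obnd_cbnd//; apply: integrableS (ih 0 t) => //.
  by apply: subset_itvr; rewrite bnd_simp.
rewrite -opprB; congr (- _).
rewrite (@Rintegral_itvB R h (BLeft (- K)) (BRight 0) t (ih (- K) 0)); rewrite ?bnd_simp//; last exact: ltW.
rewrite Rintegral_itv_obnd_cbnd//; apply: integrableS (ih t 0) => //.
by apply: subset_itvr; rewrite bnd_simp.
Qed.

Lemma continuous_primitive : continuous P.
Proof.
move=> t0; pose K := `|t0| + 1.
have K0 : 0 <= K by rewrite addr_ge0.
have tK : `|t0| < K by rewrite ltrDl.
have tI : t0 \in `]- K, K[ by rewrite in_itv/= -ltr_norml.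
have KK : - K <= K by rewrite (le_trans _ K0)// oppr_le0.
have := parameterized_integral_continuous KK (ih (- K) K).
move/(continuous_subspaceW (@subset_itv_oo_cc _ _ (- K) K)).
rewrite continuous_open_subspace; last exact: interval_open.
move=> /(_ t0); rewrite inE/= => /(_ tI) cQ.
rewrite /continuous_at (PE _ K0); last by rewrite -ler_norml ltW.
have cQ' : (fun t => parameterized_integral mu (- K) t h - parameterized_integral mu (- K) 0 h) @ t0
    --> parameterized_integral mu (- K) t0 h - parameterized_integral mu (- K) 0 h.
  exact: cvgB cQ (cvg_cst _).
apply: cvg_trans cQ'; apply: near_eq_cvg.
have : \forall t \near t0, `]- K, K[%classic t.
  by apply: open_nbhs_nbhs; split => //; exact: interval_open.
apply: filterS => t; rewrite /= in_itv/= => /andP[h1 h2].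
by rewrite (PE _ K0)// !ltW.
Qed.

End continuous_primitive.

Section nonlinearity.
Context (R : realType) (N : nat).
Local Notation V := 'rV[R]_N.
Local Notation mu := (@lebesgue R N).
Variables (Omega : set V) (mO : measurable (Omega : set (euclid R N))).
Implicit Types (f : V -> R -> R) (u : V -> R).

(** f is set to 0 over the null set where it may fail to be continuous; completeness of the Lebesgue
    measure transfers measurability back. *)
Lemma measurable_primitive f u : caratheodory_fun Omega f -> measurable_on Omega u ->
  measurable_on Omega (fun x => primitive f x (u x)).
Proof.
move=> [mf [A [mA A0 badA]]] mu_.
pose D : set (euclid R N) := Omega `\` A.
have mD : measurable D by exact: measurableD.
have DO : D `<=` Omega by move=> x [].
pose f' (x : euclid R N) (s : R) : R := ((f ^~ s) \_ D) x.
have mf' s : measurable_fun setT (f' ^~ s).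
  have r := @measurable_restrict _ _ (euclid R N) R D setT (f ^~ s) mD measurableT.
  rewrite setTI in r; apply/r; exact: measurable_funS mO DO (mf s).
have cf' x : continuous (f' x).
  have [xD|xD] := boolP (x \in D).
    have -> : f' x = f x by apply/funext => s; rewrite /f' patchE xD.
    apply: contrapT => nc; rewrite inE in xD; have [Ox nA] := xD.
    by apply/nA/badA => /(_ Ox).
  have -> : f' x = cst 0 by apply/funext => s; rewrite /f' patchE (negbTE xD).
  exact: cst_continuous.
pose u' : euclid R N -> R := u \_ D.
have mu' : measurable_fun setT u'.
  have r := @measurable_restrict _ _ (euclid R N) R D setT u mD measurableT.
  rewrite setTI in r; apply/r; exact: measurable_funS mO DO mu_.
have m0 : measurable_fun [set: euclid R N] (cst (0 : R)) by exact: measurable_cst.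
have mi1 := @measurable_integral_between _ (euclid R N) R f' mf' cf' _ _ m0 mu'.
have mi2 := @measurable_integral_between _ (euclid R N) R f' mf' cf' _ _ mu' m0.
have mb : measurable_fun setT (fun x => 0 <= u' x) by exact: measurable_fun_ler m0 mu'.
have mP := measurable_fun_ifT mb mi1 (measurable_funN mi2).
have mPO := @measurable_funTS _ _ _ _ (Omega : set (euclid R N)) _ mP.
have h := @ae_measurable_fun _ (euclid R N) R mu (@lebesgue_complete R N) Omega
  (EFin \o (fun x => if 0 <= u' x then \int[lebesgue_measure]_(s in `[0, u' x]) f' x s
    else - \int[lebesgue_measure]_(s in `[u' x, 0]) f' x s))
  (EFin \o (fun x => primitive f x (u x))).
apply/measurable_EFinP; apply: h; last by apply/measurable_EFinP.
exists A; split => // x /= nE; apply: contrapT => nA; apply: nE => Ox.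
have xD : x \in D by rewrite inE.
have fE : f' x = f x by apply/funext => s; rewrite /f' patchE xD.
by rewrite /primitive fE /u' patchE xD.
Qed.

Lemma continuous_primitive_ae f : caratheodory_fun Omega f ->
  ae_on Omega (fun x => continuous (primitive f x)).
Proof. by move=> [_ cf]; apply: ae_on_mono cf => x _; exact: continuous_primitive. Qed.

End nonlinearity.

(** * Minimisation *)

Section integral_split.
Context d (T : measurableType d) (R : realType).
Variables (mu : {measure set T -> \bar R}) (D : set T) (mD : measurable D).
Implicit Types (h r e : T -> R).

(** [r] may have infinite integral. In that case the sum has a negative part of finite integral and
    a positive part of infinite integral, so both sides are +oo. *)
Lemma integralD_ge0r h r : mu.-integrable D (EFin \o h) -> measurable_fun D r ->
  (forall x, D x -> 0 <= r x) ->
  (\int[mu]_(x in D) (h x + r x)%:E =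
   (\int[mu]_(x in D) h x)%:E + \int[mu]_(x in D) (r x)%:E)%E.
Proof.
move=> ih mr r0.
have hE : ((\int[mu]_(x in D) h x)%:E = \int[mu]_(x in D) (h x)%:E)%E.
  by rewrite /Rintegral fineK//; exact: (integrable_fin_num mD ih).
have mh : measurable_fun D h by apply/measurable_EFinP; exact: measurable_int ih.
have mEr : measurable_fun D (EFin \o r) by exact/measurable_EFinP.
have ir_of : (\int[mu]_(x in D) (r x)%:E < +oo)%E -> mu.-integrable D (EFin \o r).
  move=> rlt; apply/integrableP; split => //.
  rewrite (eq_integral (fun x => (r x)%:E))// => x /set_mem Dx /=.
  by rewrite ger0_norm// r0.
rewrite hE; have [/ir_of ir|] := ltP (\int[mu]_(x in D) (r x)%:E)%E +oo%E.
  by rewrite -integralD//; apply: eq_integral.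
rewrite leye_eq => /eqP roo; rewrite roo addey; last first.
  by rewrite -hE.
have mhr : measurable_fun D (EFin \o (fun x => h x + r x)).
  by apply/measurable_EFinP; exact: measurable_funD.
have /integrableP[_ habs] := ih.
have neg : (\int[mu]_(x in D) ((fun x => (h x + r x)%:E) ^\- x) < +oo)%E.
  apply: le_lt_trans habs; apply: ge0_le_integral => //.
  - exact: measurable_funeneg.
  - by apply: measurableT_comp => //; exact/measurable_EFinP.
  - move=> x Dx; rewrite funenegE /= -EFin_max lee_fin ge_max normr_ge0 andbT.
    by have := ler_norm (- h x); rewrite normrN; have := r0 x Dx; lra.
(* r is at most the positive part of h + r plus |h|; a finite integral of the former would make that
   of r finite. *)
have pos : (\int[mu]_(x in D) ((fun x => (h x + r x)%:E) ^\+ x) = +oo)%E.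
  apply/eqP; rewrite -leye_eq leNgt; apply/negP => plt.
  have : (\int[mu]_(x in D) (r x)%:E < +oo)%E; last by rewrite roo ltxx.
  apply: (@le_lt_trans _ _ (\int[mu]_(x in D) ((fun x => (h x + r x)%:E) ^\+ x + `|(h x)%:E|))%E).
    apply: ge0_le_integral => //.
    - apply: emeasurable_funD; first exact: measurable_funepos.
      by apply: measurableT_comp => //; exact/measurable_EFinP.
    - move=> x Dx; rewrite funeposE /= -EFin_max -EFinD lee_fin.
      have : h x + r x <= Num.max (h x + r x) 0 by rewrite le_max lexx.
      by have := ler_norm (- h x); rewrite normrN; lra.
  rewrite ge0_integralD//; first exact: lte_add_pinfty.
    exact: measurable_funepos.
  by apply: measurableT_comp => //; exact/measurable_EFinP.
rewrite integralE pos addye//; apply/eqP => h1.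
by move: neg; rewrite -[X in (X < _)%E]oppeK h1.
Qed.

Lemma integral_split e h r : measurable_fun D e -> mu.-integrable D (EFin \o h) ->
  measurable_fun D r -> (forall x, D x -> 0 <= r x) ->
  {ae mu, forall x, D x -> e x = h x + r x} ->
  (\int[mu]_(x in D) (e x)%:E =
   (\int[mu]_(x in D) h x)%:E + \int[mu]_(x in D) (r x)%:E)%E.
Proof.
move=> me ih mr r0 ae; rewrite -integralD_ge0r//.
have mh : measurable_fun D h by apply/measurable_EFinP; exact: measurable_int ih.
apply: ae_eq_integral => //; first exact/measurable_EFinP.
  by apply/measurable_EFinP; exact: measurable_funD.
by apply: filterS ae => x hx Dx; rewrite hx.
Qed.

Lemma ae_le_integral h r : measurable_fun D h -> measurable_fun D r ->
  (forall x, D x -> 0 <= h x) -> (forall x, D x -> 0 <= r x) ->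
  {ae mu, forall x, D x -> h x <= r x} ->
  (\int[mu]_(x in D) (h x)%:E <= \int[mu]_(x in D) (r x)%:E)%E.
Proof.
move=> mh mr h0 r0 hr; apply: ae_ge0_le_integral => //.
- by apply/measurable_EFinP.
- by apply/measurable_EFinP.
Qed.

Lemma Rintegral_sum (I : Type) (s : seq I) (h : I -> T -> R) :
  (forall i, mu.-integrable D (EFin \o h i)) ->
  mu.-integrable D (EFin \o (fun x => \sum_(i <- s) h i x)) /\
  \int[mu]_(x in D) (\sum_(i <- s) h i x) = \sum_(i <- s) \int[mu]_(x in D) h i x.
Proof.
move=> ih; elim: s => [|i s [IH1 IH2]].
  split; last by under eq_Rintegral do rewrite big_nil; rewrite big_nil Rintegral_cst// mul0r.
  rewrite (_ : EFin \o _ = cst 0%E); first exact: integrable0.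
  by apply/funext => x /=; rewrite big_nil.
have E : (fun x => \sum_(j <- i :: s) h j x) = fun x => h i x + \sum_(j <- s) h j x.
  by apply/funext => x; rewrite big_cons.
rewrite E big_cons -IH2; split; last exact: RintegralD.
by have := integrableD mD (ih i) IH1; apply: eq_integrable.
Qed.

End integral_split.

Section ip_limits.
Context d (T : measurableType d) (R : realType).
Variables (mu : {measure set T -> \bar R}) (D : set T) (mD : measurable D).
Local Notation sqint := (sqint mu D).
Local Notation nrm := (nrm mu D).
Local Notation ip := (ip mu D).

Lemma mul_bounded_sqint (b u : T -> R) (M : R) : measurable_fun D b -> 0 <= M ->
  (forall x, `|b x| <= M) -> sqint u ->
  sqint (fun x => b x * u x) /\ nrm (fun x => b x * u x) <= M * nrm u.
Proof.
move=> mb M0 bM su; have [mu_ _] := su.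
have mbu : measurable_fun D (fun x => b x * u x) by exact: measurable_funM.
have le x : D x -> `|b x * u x| <= `| M * u x |.
  by move=> _; rewrite !normrM ler_wpM2r// (ger0_norm M0).
have sM := sqintZ mD M su; have sbu := le_sqint mD mbu sM le.
split => //; apply: le_trans (le_nrm mD sbu sM le) _.
by rewrite (nrmZ mD _ su) ger0_norm.
Qed.

Lemma nrm_cvg_ip2 (u w : nat -> T -> R) (u0 w0 : T -> R) :
  (forall n, sqint (u n)) -> (forall n, sqint (w n)) -> sqint u0 -> sqint w0 ->
  nrm (fun x => u n x - u0 x) @[n --> \oo] --> 0 ->
  nrm (fun x => w n x - w0 x) @[n --> \oo] --> 0 ->
  ip (u n) (w n) @[n --> \oo] --> ip u0 w0.
Proof.
move=> su sw su0 sw0 cu cw.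
have nw := nrm_cvg_nrm mD sw sw0 cw.
have c1 : (fun n => nrm (fun x => u n x - u0 x) * nrm (w n) +
    nrm u0 * nrm (fun x => w n x - w0 x)) @ \oo --> 0 * nrm w0 + nrm u0 * 0.
  by apply: cvgD; apply: cvgM => //; exact: cvg_cst.
rewrite mul0r mulr0 addr0 in c1.
apply/cvgrPdist_lt => e e0; have /cvgrPdist_lt/(_ _ e0) := c1; apply: filterS => n.
rewrite sub0r normrN => /(le_lt_trans (ler_norm _)); apply: le_lt_trans.
have sd1 := sqintB mD (su n) su0; have sd2 := sqintB mD (sw n) sw0.
have -> : ip u0 w0 - ip (u n) (w n) =
    - (ip (fun x => u n x - u0 x) (w n) + ip u0 (fun x => w n x - w0 x)).
  by rewrite (ipBl mD (su n) su0 (sw n)) (ipBr mD (sw n) sw0 su0); ring.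
rewrite normrN; apply: le_trans (ler_normD _ _) _; apply: lerD.
  exact: cauchy_schwarz.
exact: cauchy_schwarz.
Qed.

End ip_limits.

Lemma sum_affine (R : realFieldType) (I : finType) (X q : I -> R) (a s : R) :
  \sum_j (q j + a * s) * X j = \sum_j X j * q j + a * (s * \sum_j X j).
Proof.
rewrite mulrA mulr_sumr -big_split; apply: eq_bigr => j _ /=.
by rewrite mulrDl (mulrC (q j)).
Qed.

Lemma sum_quadratic (R : realFieldType) (I : finType) (X q : I -> R) :
  \sum_j (X j ^+ 2 - 2 * X j * q j) = \sum_j X j ^+ 2 - 2 * \sum_j X j * q j.
Proof.
rewrite mulr_sumr -sumrB; apply: eq_bigr => j _.
by rewrite mulrA.
Qed.

Lemma young_square (R : realFieldType) (e x k : R) : 0 < e ->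
  e / 4 * x ^+ 2 - k ^+ 2 / e <= e / 2 * x ^+ 2 - k * x.
Proof.
move=> e0; have : 0 <= (e * x / 2 - k) ^+ 2 / e by rewrite divr_ge0 ?sqr_ge0// ltW.
have -> : (e * x / 2 - k) ^+ 2 / e = e / 4 * x ^+ 2 - k * x + k ^+ 2 / e.
  by field; rewrite lt0r_neq0.
by set z := k ^+ 2 / e; clearbody z; lra.
Qed.

(** Here s1 is the sum of the X j ^ 2, s2 that of the X j * q j, s3 the squared gradient norm of u,
    s4 = (v, b v), s7 the linear term in the norm of v, s5 its Poincare bound, s6 the Young
    remainder and s8 the potential of u. *)
Lemma coercivity_arith (R : realFieldType) (e s1 s2 s3 s4 s5 s6 s7 s8 a0 : R) :
  s1 - 2 * s2 <= s3 -> s8 <= 2^-1 * s4 + s7 + a0 -> e * s1 <= s1 - s4 -> s7 <= s5 ->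
  e / 4 * s1 - s6 <= e / 2 * s1 - (s2 + s5) ->
  e / 4 * s1 - (s6 + a0) <= 2^-1 * s3 - s8.
Proof. by move=> *; lra. Qed.

(** Here x, a and c are the norms of v, psi and 1; y1 and y2 are those of b psi and b u; p1, p2, p3
    are the pieces of (u, b u), and p4 is the integral of |u|. *)
Lemma potential_arith (R : realFieldType) (M C a c p1 p2 p3 p4 x y1 y2 : R) :
  0 <= M * a ^+ 2 -> p2 <= x * y1 -> p3 <= a * y2 -> x * y1 <= x * (M * a) ->
  a * y2 <= a * (M * (x + a)) -> C * p4 <= C * ((x + a) * c) ->
  2^-1 * (p1 + p2 + p3) + C * p4 <=
  2^-1 * p1 + (M * a + C * c) * x + (M * a ^+ 2 + C * c * a).
Proof. by move=> *; lra. Qed.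

(** * Energy and residual of one component *)

Section component.
Context (R : realType) (N : nat).
Local Notation V := 'rV[R]_N.
Local Notation mu := (@lebesgue R N).
Variables (Omega : set V) (oO : open Omega) (bO : bounded_set Omega).
Implicit Types (u v w psi : V -> R).
Local Notation sqO := (sqint mu Omega).
Local Notation ipO := (ip mu Omega).
Local Notation nrmO := (nrm mu Omega).
Local Notation wpO i := (wpartial Omega i).

Let mO : measurable (Omega : set (euclid R N)).
Proof. exact: open_measurable_euclid. Qed.

Let muO : (mu Omega < +oo)%E.
Proof. exact: lebesgue_bounded_lty. Qed.

Lemma sqO_cst (c : R) : sqO (cst c).
Proof.
have h := @bounded_sqint _ (euclid R N) R mu Omega mO (cst c) `|c| muO (measurable_cst _).
by apply: h.
Qed.

Definition clip (M t : R) : R := Num.min (Num.max t (- M)) M.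

Lemma clip_le (M t : R) : 0 <= M -> `|clip M t| <= M.
Proof.
move=> M0; rewrite /clip ler_norml le_min ge_min lexx orbT andbT le_max lexx orbT /=.
by rewrite (le_trans _ M0)// oppr_le0.
Qed.

Lemma clip_id (M t : R) : `|t| <= M -> clip M t = t.
Proof.
by rewrite ler_norml => /andP[h1 h2]; rewrite /clip (max_idPl h1) (min_idPl h2).
Qed.

(* The bound of (A2) extends to negative arguments by (A1). *)
Lemma condA2_bounded f : condA1 Omega f -> condA2 Omega f ->
  exists (b : V -> R) (M C e : R), [/\ measurable_on Omega b,
    [/\ 0 <= M, forall x, `|b x| <= M, 0 <= C & 0 < e],
    ae_on Omega (fun x => forall t, primitive f x t <= b x / 2 * t ^+ 2 + C * `|t|) &
    forall v, H10 Omega v -> e * (\sum_(j < N) nrmO (wpO j v) ^+ 2) <=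
      \sum_(j < N) nrmO (wpO j v) ^+ 2 - ipO v (fun x => b x * v x)].
Proof.
move=> A1 [b0 [[mb0 [M0 bM0]] [[C [C0 bC]] [e [e0 he]]]]].
(* The bound on [b0] holds only almost everywhere; the clipped coefficient is bounded at every point
   and agrees with it almost everywhere. *)
pose M := `|M0|; pose b x := clip M (b0 x).
have M_0 : 0 <= M by exact: normr_ge0.
have bM x : `|b x| <= M by exact: clip_le.
have mb : measurable_on Omega b.
  have mc (c : R) : measurable_fun (Omega : set (euclid R N)) (cst c) by exact: measurable_cst.
  exact: (measurable_minr (measurable_maxr mb0 (mc (- M))) (mc M)).
have bb0 : ae_on Omega (fun x => b0 x = b x).
  apply: ae_on_mono bM0 => x _ h; rewrite /b clip_id//.
  by apply: le_trans h _; exact: ler_norm.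
exists b, M, C, e; split => //; first by split => //; exact: ltW.
  have h1 : ae_on Omega (fun x => forall t, 0 <= t -> primitive f x t <= b x / 2 * t ^+ 2 + C * t).
    by apply: ae_on2 bb0 bC => x _ <-.
  apply: ae_on2 A1 h1 => x _ a1 a2 t; have [t0|t0] := leP 0 t.
    by rewrite ger0_norm//; exact: a2.
  have nt : 0 <= - t by rewrite oppr_ge0 ltW.
  have := a1 _ nt; rewrite opprK => /le_trans; apply.
  by apply: le_trans (a2 _ nt) _; rewrite sqrrN ltr0_norm.
move=> v hv; have := he v hv; have h1 := H10_H1 hv; have sv := H1_sqO h1.
have gE : \int[mu]_(x in Omega) grad_sq Omega v x = \sum_(j < N) nrmO (wpO j v) ^+ 2.
  by rewrite /Rintegral (integral_grad_sq oO h1).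
have ig := grad_sq_integrable oO h1.
have [sbv _] := @mul_bounded_sqint _ (euclid R N) R mu Omega mO b v M mb M_0 bM sv.
have ib := @sqint_mul_integrable _ (euclid R N) R mu Omega mO _ _ sv sbv.
have [mv _] := sv.
rewrite gE (_ : \int[mu]_(x in Omega) (grad_sq Omega v x - b0 x * v x ^+ 2) =
  \int[mu]_(x in Omega) (grad_sq Omega v x - v x * (b x * v x))).
  by rewrite (@RintegralB _ (euclid R N) R mu Omega _ _ mO ig ib) gE.
have mg : measurable_fun (Omega : set (euclid R N)) (grad_sq Omega v).
  by apply/measurable_EFinP; exact: measurable_int ig.
have m1 : measurable_fun (Omega : set (euclid R N))
    (fun x => (grad_sq Omega v x - b0 x * v x ^+ 2)%:E).
  apply/measurable_EFinP; have m2 := measurable_funX 2 mv.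
  exact: (measurable_funB mg (measurable_funM mb0 m2)).
have m2 : measurable_fun (Omega : set (euclid R N))
    (fun x => (grad_sq Omega v x - v x * (b x * v x))%:E).
  apply/measurable_EFinP; exact: (measurable_funB mg (measurable_funM mv (measurable_funM mb mv))).
congr fine; apply: (@ae_eq_integral _ (euclid R N) R mu Omega _ _ mO m1 m2).
have : ae_on Omega (fun x => (grad_sq Omega v x - b0 x * v x ^+ 2)%:E =
    (grad_sq Omega v x - v x * (b x * v x))%:E).
  by apply: ae_on_mono bb0 => x _ ->; congr (_ - _)%:E; ring.
exact.
Qed.

Variables (f : V -> R -> R) (cf : caratheodory_fun Omega f) (A1 : condA1 Omega f).
Variables (b : V -> R) (M C e : R) (mb : measurable_on Omega b).
Hypotheses (M0 : 0 <= M) (bM : forall x, `|b x| <= M) (C0 : 0 <= C) (e0 : 0 < e).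
Hypothesis fb : ae_on Omega (fun x => forall t, primitive f x t <= b x / 2 * t ^+ 2 + C * `|t|).
Hypothesis eb : forall v, H10 Omega v -> e * (\sum_(j < N) nrmO (wpO j v) ^+ 2) <=
      \sum_(j < N) nrmO (wpO j v) ^+ 2 - ipO v (fun x => b x * v x).

(** Written with inner products so that continuity under L^2 convergence is inherited from them; the
    constant 1 is square integrable as [Omega] is bounded. *)
Definition potential u : R := 2^-1 * ipO u (fun x => b x * u x) + C * ipO (fun x => `|u x|) (cst 1).

Definition energy u : R := 2^-1 * (\sum_(j < N) nrmO (wpO j u) ^+ 2) - potential u.

(* The maximum only matters on the null set where the bound of (A2) fails. *)
Definition residual u (x : V) : R :=
  Num.max 0 (b x / 2 * u x ^+ 2 + C * `|u x| - primitive f x (u x)).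

Definition energy_density u (x : V) : R :=
  2^-1 * grad_sq Omega u x - (2^-1 * (u x * (b x * u x)) + C * (`|u x| * 1)).

Let sb u : sqO u -> sqO (fun x => b x * u x).
Proof.
by move=> su; have [] := @mul_bounded_sqint _ (euclid R N) R mu Omega mO b u M mb M0 bM su.
Qed.

Let nb u : sqO u -> nrmO (fun x => b x * u x) <= M * nrmO u.
Proof.
by move=> su; have [] := @mul_bounded_sqint _ (euclid R N) R mu Omega mO b u M mb M0 bM su.
Qed.

Lemma energy_densityP u : H1 Omega u ->
  mu.-integrable Omega (EFin \o energy_density u) /\
  \int[mu]_(x in Omega) energy_density u x = energy u.
Proof.
move=> hu; have su := H1_sqO hu; have ig := grad_sq_integrable oO hu.
have ib := @sqint_mul_integrable _ (euclid R N) R mu Omega mO _ _ su (sb su).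
have sa := @sqint_norm _ (euclid R N) R mu Omega mO _ su.
have ia := @sqint_mul_integrable _ (euclid R N) R mu Omega mO _ _ sa (sqO_cst 1).
have ig2 := @integrableZl _ (euclid R N) R mu Omega mO 2^-1 _ ig.
have ib2 := @integrableZl _ (euclid R N) R mu Omega mO 2^-1 _ ib.
have ia2 := @integrableZl _ (euclid R N) R mu Omega mO C _ ia.
have iD := @integrableD _ (euclid R N) R mu Omega mO _ _ ib2 ia2.
have iB := @integrableB _ (euclid R N) R mu Omega mO _ _ ig2 iD.
split; first exact: iB.
rewrite (@RintegralB _ (euclid R N) R mu Omega _ _ mO ig2 iD).
rewrite (@RintegralD _ (euclid R N) R mu Omega _ _ mO ib2 ia2).
rewrite (@RintegralZl _ (euclid R N) R mu Omega _ _ mO ig).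
rewrite (@RintegralZl _ (euclid R N) R mu Omega _ _ mO ib).
rewrite (@RintegralZl _ (euclid R N) R mu Omega _ _ mO ia).
by rewrite [\int[mu]_(x in Omega) grad_sq _ _ _]/Rintegral (integral_grad_sq oO hu).
Qed.

Lemma measurable_residual u : measurable_on Omega u -> measurable_on Omega (residual u).
Proof.
move=> mu_; have mP := measurable_primitive mO cf mu_.
have m0 (c : R) : measurable_fun (Omega : set (euclid R N)) (cst c) by exact: measurable_cst.
have mn : measurable_fun (Omega : set (euclid R N)) (fun x => `|u x|) by exact: measurableT_comp.
have mb2 := measurable_funM mb (m0 2^-1).
have m1 := measurable_funM mb2 (measurable_funX 2 mu_).
have m2 := measurable_funM (m0 C) mn.
exact: (measurable_maxr (m0 0) (measurable_funB (measurable_funD m1 m2) mP)).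
Qed.

Lemma residual_ge0 u x : 0 <= residual u x.
Proof. by rewrite /residual le_max lexx. Qed.

Lemma energy_density_split u : ae_on Omega (fun x =>
  2^-1 * grad_sq Omega u x - primitive f x (u x) = energy_density u x + residual u x).
Proof.
apply: ae_on_mono fb => x _ h; rewrite /residual /energy_density max_r ?subr_ge0//.
by field.
Qed.

(** All terms but the primitive are even in u, and (A1) says that the primitive does not decrease
    from u to |u|. *)
Lemma residual_abs u : ae_on Omega (fun x => residual (fun x => `|u x|) x <= residual u x).
Proof.
apply: ae_on_mono A1 => x _ a1; rewrite /residual normr_id real_normK ?num_real//.
rewrite ge_max le_max lexx /= le_max; apply/orP; right; rewrite lerD2l lerN2.
have [u0|u0] := leP 0 (u x); first by rewrite ger0_norm.
by rewrite ltr0_norm//; have := a1 (- u x); rewrite opprK oppr_ge0; apply; exact: ltW.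
Qed.

Lemma residual_cvg (u : nat -> V -> R) w :
  ae_on Omega (fun x => u n x @[n --> \oo] --> w x) ->
  ae_on Omega (fun x => residual (u n) x @[n --> \oo] --> residual w x).
Proof.
move=> cu; apply: ae_on2 cu (continuous_primitive_ae cf) => x _ cux cp.
have c1 : primitive f x (u n x) @[n --> \oo] --> primitive f x (w x).
  by apply: continuous_cvg; [exact: cp|exact: cux].
have c2 : `|u n x| @[n --> \oo] --> `|w x| by exact: cvg_norm.
have c3 : (u n x ^+ 2) @[n --> \oo] --> w x ^+ 2.
  by under eq_fun do rewrite expr2; rewrite expr2; exact: cvgM.
have c4 : (b x / 2 * u n x ^+ 2 + C * `|u n x| - primitive f x (u n x)) @[n --> \oo] -->
    b x / 2 * w x ^+ 2 + C * `|w x| - primitive f x (w x).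
  by apply: cvgB => //; apply: cvgD; apply: cvgM => //; exact: cvg_cst.
have E (t : R) : Num.max 0 t = (t + `|t|) / 2.
  have [t0|t0] := leP 0 t; first by rewrite ger0_norm//; field.
  by rewrite ltr0_norm// subrr mul0r.
rewrite /residual; under eq_fun do rewrite E; rewrite E.
by apply: cvgM; [apply: cvgD => //; exact: cvg_norm|exact: cvg_cst].
Qed.

Lemma energy_abs u : H1 Omega u -> energy (fun x => `|u x|) <= energy u.
Proof.
move=> hu; have [_ le] := H1_abs oO hu; rewrite /energy /potential.
have -> : ipO (fun x => `|u x|) (fun x => b x * `|u x|) = ipO u (fun x => b x * u x).
  apply: eq_Rintegral => x _; rewrite mulrCA -expr2 real_normK ?num_real//; ring.
have -> : (fun x => `| `|u x| |) = fun x => `|u x| by apply/funext => x; rewrite normr_id.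
have gen (a c p : R) : a <= c -> 2^-1 * a - p <= 2^-1 * c - p by move=> h; lra.
apply: gen; apply: ler_sum => j _.
by rewrite ler_pXn2r ?nnegrE ?nrm_ge0.
Qed.

Lemma potential_cvg (u : nat -> V -> R) w : (forall n, sqO (u n)) -> sqO w ->
  nrmO (fun x => u n x - w x) @[n --> \oo] --> 0 ->
  potential (u n) @[n --> \oo] --> potential w.
Proof.
move=> su sw cu.
have cb : nrmO (fun x => b x * u n x - b x * w x) @[n --> \oo] --> 0.
  apply/cvgrPdist_lt => d d0.
  have M1 : 0 < M + 1 by rewrite ltr_wpDl.
  have /cvgrPdist_lt/(_ _ (divr_gt0 d0 M1)) := cu; apply: filterS => n.
  rewrite !sub0r !normrN !(ger0_norm (nrm_ge0 _ _ _)) => h.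
  have sd := sqOB oO (su n) sw.
  rewrite (_ : (fun x => _) = fun x => b x * (u n x - w x)); last first.
    by apply/funext => x; rewrite mulrBr.
  apply: le_lt_trans (nb sd) _; rewrite ltr_pdivlMr// in h; apply: le_lt_trans h.
  by rewrite mulrC ler_wpM2l ?nrm_ge0// lerDl.
have ca : nrmO (fun x => `|u n x| - `|w x|) @[n --> \oo] --> 0.
  apply/cvgrPdist_lt => d d0; have /cvgrPdist_lt/(_ _ d0) := cu; apply: filterS => n.
  rewrite !sub0r !normrN !(ger0_norm (nrm_ge0 _ _ _)); apply: le_lt_trans.
  have sd := sqOB oO (su n) sw.
  have sa1 := @sqint_norm _ (euclid R N) R mu Omega mO _ (su n).
  have sa2 := @sqint_norm _ (euclid R N) R mu Omega mO _ sw.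
  by apply: (le_nrm mO (sqOB oO sa1 sa2) sd) => x _; exact: ler_dist_dist.
have c1 := nrm_cvg_ip2 mO su (fun n => sb (su n)) sw (sb sw) cu cb.
have c2 := nrm_cvg_ip mO (fun n => @sqint_norm _ (euclid R N) R mu Omega mO _ (su n))
  (@sqint_norm _ (euclid R N) R mu Omega mO _ sw) (sqO_cst 1) ca.
by apply: cvgD; apply: cvgM => //; exact: cvg_cst.
Qed.

Section coercivity.
Variables (r : R) (r0 : 0 < r) (Or : Omega `<=` cube r) (N0 : (0 < N)%N).

(** Everything is expanded in v = u - psi, since (A2) speaks of H^1_0 only. It leaves e/2 times the
    squared gradient norm of v; the terms linear in v are turned into gradient norms by Poincare's
    inequality, and Young's inequality absorbs them at the cost of e/4. *)
Lemma energy_coercive psi : H1 Omega psi -> exists c : R, forall u, H1 Omega u ->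
  H10 Omega (fun x => u x - psi x) ->
  e / 4 * (\sum_(j < N) nrmO (wpO j (fun x => u x - psi x)) ^+ 2) - c <= energy u.
Proof.
move=> hpsi; have sp := H1_sqO hpsi.
pose q j := nrmO (wpO j psi); pose np := nrmO psi; pose n1 := nrmO (cst 1).
(* [a1] and [a0] are the coefficient of the norm of v and the constant in the bound on the
   potential; [k j] below is the total coefficient of X j. *)
pose a1 := M * np + C * n1; pose a0 := M * np ^+ 2 + C * n1 * np.
have np0 : 0 <= np by exact: nrm_ge0.
have n10 : 0 <= n1 by exact: nrm_ge0.
have q0 j : 0 <= q j by exact: nrm_ge0.
have a10 : 0 <= a1 by rewrite /a1 addr_ge0// mulr_ge0.
pose k j := q j + a1 * (r *+ 2).
exists (\sum_(j < N) (k j ^+ 2 / e) + a0) => u hu hv.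
set v := fun x => u x - psi x; have h1v := H10_H1 hv; have sv := H1_sqO h1v.
have su := H1_sqO hu.
pose X j := nrmO (wpO j v); have X0 j : 0 <= X j by exact: nrm_ge0.
have uE : u = fun x => v x + psi x by apply/funext => x; rewrite /v subrK.
(* The norm of a sum is at least |X - q|, and (X - q)^2 >= X^2 - 2 X q. *)
have gle : \sum_(j < N) (X j ^+ 2 - 2 * X j * q j) <= \sum_(j < N) nrmO (wpO j u) ^+ 2.
  apply: ler_sum => j _; rewrite {1}uE (nrm_wpartialD oO j h1v hpsi).
  have [sg _] := H1_wpartial j h1v; have [sh _] := H1_wpartial j hpsi.
  have sgh := sqOD oO sg sh.
  have t1 : X j <= nrmO (fun x => wpO j v x + wpO j psi x) + q j.
    have := nrmB mO sgh sh; rewrite (_ : (fun x => _ - _) = wpO j v)//.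
    by apply/funext => x; rewrite addrK.
  have t2 : q j <= nrmO (fun x => wpO j v x + wpO j psi x) + X j.
    have := nrmB mO sgh sg; rewrite (_ : (fun x => _ - _) = wpO j psi)//.
    by apply/funext => x; rewrite addrAC subrr add0r.
  have t3 := nrm_ge0 mu Omega (fun x => wpO j v x + wpO j psi x).
  move: t1 t2 t3 (X0 j) (q0 j); set y := nrm _ _ _; set a := X j; set c := q j.
  by clearbody y a c => *; nra.
have nv0 : 0 <= nrmO v by exact: nrm_ge0.
have nu : nrmO u <= nrmO v + np.
  by rewrite {1}uE; have h := nrmD mO sv sp; exact: h.
have pot : potential u <= 2^-1 * ipO v (fun x => b x * v x) + a1 * nrmO v + a0.
  have bE : (fun x => b x * u x) = fun x => b x * v x + b x * psi x.
    by apply/funext => x; rewrite uE mulrDr.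
  have i1 : ipO u (fun x => b x * u x) = ipO v (fun x => b x * v x) +
      ipO v (fun x => b x * psi x) + ipO psi (fun x => b x * u x).
    rewrite {1}uE (ipDl mO sv sp (sb su)) bE (ipDr mO (sb sv) (sb sp) sv).
    by rewrite -bE.
  have i2 := le_trans (ler_norm _) (cauchy_schwarz mO sv (sb sp)).
  have i3 := le_trans (ler_norm _) (cauchy_schwarz mO sp (sb su)).
  have sa := @sqint_norm _ (euclid R N) R mu Omega mO _ su.
  have i4 := le_trans (ler_norm _) (cauchy_schwarz mO sa (sqO_cst 1)).
  have na : nrmO (fun x => `|u x|) <= nrmO u.
    by apply: (le_nrm mO sa su) => x _; rewrite normr_id.
  have j2 : nrmO v * nrmO (fun x => b x * psi x) <= nrmO v * (M * np).
    by rewrite ler_wpM2l// nb.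
  have j3 : np * nrmO (fun x => b x * u x) <= np * (M * (nrmO v + np)).
    rewrite ler_wpM2l//; apply: le_trans (nb su) _; by rewrite ler_wpM2l.
  have j4 : C * ipO (fun x => `|u x|) (cst 1) <= C * ((nrmO v + np) * n1).
    rewrite ler_wpM2l//; apply: le_trans i4 _; rewrite ler_wpM2r//.
    exact: le_trans na nu.
  have npv : 0 <= M * np ^+ 2 by rewrite mulr_ge0// sqr_ge0.
  by rewrite /potential i1; exact: (potential_arith _ npv i2 i3 j2 j3 j4).
have key := eb hv; have poin := poincare oO r0 Or N0 hv.
have a1v : a1 * nrmO v <= a1 * (r *+ 2 * \sum_(j < N) X j) by rewrite ler_wpM2l.
have young j : e / 4 * X j ^+ 2 - k j ^+ 2 / e <= e / 2 * X j ^+ 2 - k j * X j.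
  exact: young_square.
have ysum : e / 4 * (\sum_(j < N) X j ^+ 2) - \sum_(j < N) (k j ^+ 2 / e) <=
    e / 2 * (\sum_(j < N) X j ^+ 2) - \sum_(j < N) k j * X j.
  rewrite !mulr_sumr -!sumrB; exact: ler_sum.
have ksum := sum_affine X q a1 (r *+ 2).
have gE := sum_quadratic X q.
rewrite gE in gle; rewrite ksum in ysum; rewrite /energy.
exact: (coercivity_arith gle pot key a1v ysum).
Qed.

End coercivity.

End component.

Section finite_limits.
Context (R : realType).

Lemma cvg_finite_sum (I : Type) (s : seq I) (P : pred I) (a : I -> nat -> R) (l : I -> R) :
  (forall i, a i n @[n --> \oo] --> l i) ->
  \sum_(i <- s | P i) a i n @[n --> \oo] --> \sum_(i <- s | P i) l i.
Proof.
move=> al; elim: s => [|i s IH].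
  by rewrite big_nil; under eq_fun do rewrite big_nil; exact: cvg_cst.
rewrite big_cons; under eq_fun do rewrite big_cons.
by case: (P i) => //; exact: cvgD.
Qed.

Lemma cvg_finite_prod (I : Type) (s : seq I) (P : pred I) (a : I -> nat -> R) (l : I -> R) :
  (forall i, a i n @[n --> \oo] --> l i) ->
  \prod_(i <- s | P i) a i n @[n --> \oo] --> \prod_(i <- s | P i) l i.
Proof.
move=> al; elim: s => [|i s IH].
  by rewrite big_nil; under eq_fun do rewrite big_nil; exact: cvg_cst.
rewrite big_cons; under eq_fun do rewrite big_cons.
by case: (P i) => //; exact: cvgM.
Qed.

(** Only [n <= s n] is asked: it suffices for tails and is stable under composition of
    extractions. *)
Lemma cvg_subseq (T : topologicalType) (a : nat -> T) (l : T) (s : nat -> nat) :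
  (forall n, (n <= s n)%N) -> a n @[n --> \oo] --> l -> a (s n) @[n --> \oo] --> l.
Proof.
move=> ns al A /al [n0 _ n0P]; exists n0 => // n /= n0n; apply: n0P => /=.
exact: leq_trans n0n (ns n).
Qed.

End finite_limits.

(** * The vector problem on an abstract admissible class *)

Section vector_minimisation.
Context (R : realType) (N d : nat).
Local Notation V := 'rV[R]_N.
Local Notation mu := (@lebesgue R N).
Variables (Omega : set V) (oO : open Omega) (bO : bounded_set Omega) (N0 : (0 < N)%N).
Implicit Types (u : 'I_d -> V -> R).
Local Notation sqO := (sqint mu Omega).
Local Notation nrmO := (nrm mu Omega).
Local Notation wpO i := (wpartial Omega i).

Let mO : measurable (Omega : set (euclid R N)).
Proof. exact: open_measurable_euclid. Qed.

Lemma bounded_sub_cube : exists r : R, 0 < r /\ Omega `<=` cube r.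
Proof.
have [M [_ hM]] := bO; exists (`|M| + 2); split; first by rewrite ltr_wpDl.
move=> x Ox i; apply: le_lt_trans (coord_le_norm x i) _.
have h : `|x| <= `|M| + 1 by apply: hM => //; rewrite (le_lt_trans (ler_norm M))// ltrDl.
by apply: le_lt_trans h _; rewrite ltrD2l ltr1n.
Qed.

Lemma rellich_vector (v : 'I_d -> nat -> V -> R) :
  (forall i n, H10 Omega (v i n)) ->
  (forall i, exists A : R, forall n, nrmO (v i n) <= A /\
    \sum_(j < N) nrmO (wpO j (v i n)) <= A) ->
  exists (s : nat -> nat) (w : 'I_d -> V -> R), (forall n, (n <= s n)%N) /\
    forall i, [/\ sqO (w i), nrmO (fun x => v i (s n) x - w i x) @[n --> \oo] --> 0 &
      ae_on Omega (fun x => v i (s n) x @[n --> \oo] --> w i x)].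
Proof.
move=> hv vA.
suff [s [ns sP]] : exists s : nat -> nat, (forall n, (n <= s n)%N) /\
    forall i, i \in enum 'I_d -> exists w : V -> R, [/\ sqO w,
      nrmO (fun x => v i (s n) x - w x) @[n --> \oo] --> 0 &
      ae_on Omega (fun x => v i (s n) x @[n --> \oo] --> w x)].
  have /choice[w wP] : forall i, exists w : V -> R, [/\ sqO w,
      nrmO (fun x => v i (s n) x - w x) @[n --> \oo] --> 0 &
      ae_on Omega (fun x => v i (s n) x @[n --> \oo] --> w x)].
    by move=> i; apply: sP; rewrite mem_enum.
  by exists s, w.
(* Successive extraction, one component at a time; earlier limits survive further extraction. *)
elim: (enum 'I_d) => [|i l [s [ns sP]]]; first by exists id.
have [A AP] := vA i.
have [s1 [w [ns1 sw wc wae]]] := rellich oO bO (fun n => hv i (s n))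
  (fun n => (AP (s n)).1) (fun n => (AP (s n)).2).
exists (fun n => s (s1 n)); split; first by move=> n; exact: leq_trans (ns1 n) (ns _).
move=> j; rewrite inE => /orP[/eqP ->|jl]; first by exists w.
have [w' [sw' wc' wae']] := sP j jl; exists w'; split => //.
  exact: (cvg_subseq ns1 wc').
by apply: ae_on_mono wae' => x _ h; exact: (cvg_subseq ns1 h).
Qed.

Variables (f : 'I_d -> V -> R -> R) (b : 'I_d -> V -> R) (M C e : 'I_d -> R).
Hypotheses (cf : forall i, caratheodory_fun Omega (f i)) (A1 : forall i, condA1 Omega (f i)).
Hypothesis bP : forall i, [/\ measurable_on Omega (b i),
    [/\ 0 <= M i, forall x, `|b i x| <= M i, 0 <= C i & 0 < e i],
    ae_on Omega (fun x => forall t, primitive (f i) x t <= b i x / 2 * t ^+ 2 + C i * `|t|) &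
    forall v : V -> R, H10 Omega v -> e i * (\sum_(j < N) nrmO (wpO j v) ^+ 2) <=
      \sum_(j < N) nrmO (wpO j v) ^+ 2 - ip mu Omega v (fun x => b i x * v x)].
Variables (k : nat) (gamma : {set 'I_d} -> R) (c : R).
Hypotheses (c0 : 0 <= c) (gamma0 : forall J : {set 'I_d}, #|J| = k -> 0 <= gamma J).

Definition coupling (y : 'I_d -> R) : R :=
  c * \sum_(J : {set 'I_d} | #|J| == k) gamma J * \prod_(j in J) y j ^+ 2.

Definition total_residual u (x : V) : R :=
  coupling (fun i => u i x) + \sum_(i < d) residual (f i) (b i) (C i) (u i) x.

Definition total_energy u : R := \sum_(i < d) energy Omega (b i) (C i) (u i).

(** A finite number plus a nonnegative, possibly infinite, integral: the sum is always meaningful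
    and never -oo. *)
Definition functional u : \bar R :=
  ((total_energy u)%:E + \int[mu]_(x in Omega) (total_residual u x)%:E)%E.

Lemma coupling_ge0 y : 0 <= coupling y.
Proof.
rewrite mulr_ge0// sumr_ge0// => J /eqP /gamma0 g0; rewrite mulr_ge0// prodr_ge0// => j _.
exact: sqr_ge0.
Qed.

Lemma coupling_cvg (y : nat -> 'I_d -> R) (l : 'I_d -> R) :
  (forall i, y n i @[n --> \oo] --> l i) -> coupling (y n) @[n --> \oo] --> coupling l.
Proof.
move=> yl; apply: cvgM; first exact: cvg_cst.
apply: (@cvg_finite_sum R _ _ _ (fun J n => gamma J * \prod_(j in J) y n j ^+ 2)) => J.
apply: cvgM; first exact: cvg_cst.
apply: (@cvg_finite_prod R _ _ _ (fun j n => y n j ^+ 2)) => j.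
by under eq_fun do rewrite expr2; rewrite expr2; exact: cvgM.
Qed.

Lemma total_residual_ge0 u x : 0 <= total_residual u x.
Proof.
by rewrite addr_ge0 ?coupling_ge0// sumr_ge0// => i _; exact: residual_ge0.
Qed.

Lemma measurable_coupling u : (forall i, measurable_on Omega (u i)) ->
  measurable_on Omega (fun x => coupling (fun i => u i x)).
Proof.
move=> mu_; rewrite /measurable_on /coupling.
have mc (a : R) : measurable_fun (Omega : set (euclid R N)) (cst a) by exact: measurable_cst.
apply: (measurable_funM (mc c)).
under eq_fun do rewrite -big_filter.
apply: (@measurable_sum _ (euclid R N) R Omega {set 'I_d} _
  (fun J x => gamma J * \prod_(j in J) u j x ^+ 2)) => J.
apply: (measurable_funM (mc (gamma J))).
under eq_fun do rewrite -big_filter.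
apply: (@measurable_prod _ (euclid R N) R Omega 'I_d _ (fun j x => u j x ^+ 2)) => j _.
exact: measurable_funX (mu_ j).
Qed.

Lemma measurable_total_residual u : (forall i, measurable_on Omega (u i)) ->
  measurable_on Omega (total_residual u).
Proof.
move=> mu_; have m1 := measurable_coupling mu_.
have m2 i : measurable_on Omega (residual (f i) (b i) (C i) (u i)).
  by have [mb _ _ _] := bP i; exact: (measurable_residual oO (cf i) (C i) mb (mu_ i)).
have m3 := @measurable_sum _ (euclid R N) R Omega 'I_d (index_enum 'I_d) _ m2.
exact: (measurable_funD m1 m3).
Qed.

Lemma total_residual_abs u : ae_on Omega (fun x =>
  total_residual (fun i x => `|u i x|) x <= total_residual u x).
Proof.
have h : ae_on Omega (fun x => forall i : 'I_d,
    residual (f i) (b i) (C i) (fun x => `|u i x|) x <= residual (f i) (b i) (C i) (u i) x).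
  by apply: ae_on_forall => i; exact: residual_abs (A1 i) _ _ _.
apply: ae_on_mono h => x _ h; apply: lerD; last by apply: ler_sum => i _.
rewrite le_eqVlt; apply/orP; left; apply/eqP; congr (_ * _).
by apply: eq_bigr => J _; congr (_ * _); apply: eq_bigr => j _; rewrite real_normK ?num_real.
Qed.

Lemma total_residual_cvg (u : nat -> 'I_d -> V -> R) (w : 'I_d -> V -> R) :
  (forall i, ae_on Omega (fun x => u n i x @[n --> \oo] --> w i x)) ->
  ae_on Omega (fun x => total_residual (u n) x @[n --> \oo] --> total_residual w x).
Proof.
move=> h; have h1 := ae_on_forall h.
have h2 : ae_on Omega (fun x => forall i : 'I_d,
    residual (f i) (b i) (C i) (u n i) x @[n --> \oo] --> residual (f i) (b i) (C i) (w i) x).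
  by apply: ae_on_forall => i; exact: (residual_cvg (cf i) (b i) (C i) (h i)).
apply: ae_on2 h1 h2 => x _ x1 x2; apply: cvgD.
  exact: (coupling_cvg x1).
exact: (@cvg_finite_sum R _ _ _ (fun i n => residual (f i) (b i) (C i) (u n i) x) _ x2).
Qed.

Variables (psi : 'I_d -> V -> R) (hpsi : forall i, H1 Omega (psi i)).
Hypothesis psi0 : forall i x, Omega x -> 0 <= psi i x.
(** The admissible class is either [U_class] or [H_class]. Closedness is asked only for almost
    everywhere limits already known to be in [U_class], boundary values being handled separately. *)
Variable A : ('I_d -> V -> R) -> Prop.
Hypotheses (Apsi : A psi) (AU : forall u, A u -> U_class Omega psi u)
  (Aabs : forall u, A u -> A (fun i x => `|u i x|))
  (Acl : forall (us : nat -> 'I_d -> V -> R) u, (forall n, A (us n)) -> U_class Omega psi u ->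
    (forall i, ae_on Omega (fun x => us n i x @[n --> \oo] --> u i x)) -> A u).

Lemma functional_abs u : A u -> (functional (fun i x => `|u i x|%R) <= functional u)%E.
Proof.
move=> Au; have h i : H1 Omega (u i) by have [] := AU Au i.
have m i : measurable_on Omega (u i) by have [] := H1_sqO (h i).
have ma i : measurable_on Omega (fun x => `|u i x|).
  by have [m1 _] := sqint_norm mO (H1_sqO (h i)); exact: m1.
apply: leeD.
  by rewrite lee_fin; apply: ler_sum => i _; have [_ [_ _ _ _] _ _] := bP i; exact: energy_abs.
have m1 := measurable_total_residual m; have m2 := measurable_total_residual ma.
have h1 := @ae_le_integral _ (euclid R N) R mu Omega mO _ _ m2 m1
  (fun x _ => total_residual_ge0 _ x) (fun x _ => total_residual_ge0 _ x) (total_residual_abs u).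
exact: h1.
Qed.

Lemma integral_total_residual_ge0 u : (0 <= \int[mu]_(x in Omega) (total_residual u x)%:E)%E.
Proof.
have h := @integral_ge0 _ (euclid R N) R mu Omega (fun x => (total_residual u x)%:E).
by apply: h => x _; rewrite lee_fin total_residual_ge0.
Qed.

Lemma total_energy_le_functional u : ((total_energy u)%:E <= functional u)%E.
Proof. by rewrite /functional leeDl// integral_total_residual_ge0. Qed.

Lemma coercivity : exists cc : 'I_d -> R, forall i u, A u ->
  e i / 4 * (\sum_(j < N) nrmO (wpO j (fun x => u i x - psi i x)) ^+ 2) - cc i <=
  energy Omega (b i) (C i) (u i).
Proof.
have [r [r0 Or]] := bounded_sub_cube.
have /choice[cc ccP] : forall i, exists cc : R, forall u : V -> R, H1 Omega u ->
    H10 Omega (fun x => u x - psi i x) ->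
    e i / 4 * (\sum_(j < N) nrmO (wpO j (fun x => u x - psi i x)) ^+ 2) - cc <=
    energy Omega (b i) (C i) u.
  move=> i; have [mb [M0 bM C0 e0] _ eb] := bP i.
  exact: (energy_coercive oO bO mb M0 bM C0 e0 eb r0 Or N0 (hpsi i)).
by exists cc => i u /AU Uu; have [h1 h2] := Uu i; exact: ccP.
Qed.

Lemma bounded_of_energy (K : R) : 0 <= K -> exists B : 'I_d -> R, forall i u, A u ->
  total_energy u <= K ->
  nrmO (fun x => u i x - psi i x) <= B i /\
  \sum_(j < N) nrmO (wpO j (fun x => u i x - psi i x)) <= B i.
Proof.
move=> K0; have [cc ccP] := coercivity; have [r [r0 Or]] := bounded_sub_cube.
pose S := \sum_(i < d) `|cc i|.
(* The other components have energy at least - S in total, which bounds the sum of squares by (K +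
   S) 4/e; then X <= 1 + X^2 in each of the [N] directions. The factor 1 + 2r below also covers
   Poincare's bound on the function itself. *)
pose B1 i := N%:R + (K + S) * 4 / e i.
exists (fun i => (1 + r *+ 2) * B1 i) => i u Au uK.
have r20 : 0 <= r *+ 2 by rewrite mulrn_wge0// ltW.
have hv := (AU Au i).2; have [_ [_ _ _ e0] _ _] := bP i.
pose X j := nrmO (wpO j (fun x => u i x - psi i x)).
have sX : e i / 4 * (\sum_(j < N) X j ^+ 2) <= K + S.
  have t j : - `|cc j| <= energy Omega (b j) (C j) (u j).
    apply: le_trans (ccP j u Au); have [_ [_ _ _ ej0] _ _] := bP j.
    have : 0 <= e j / 4 * \sum_(j0 < N) nrmO (wpO j0 (fun x => u j x - psi j x)) ^+ 2.
      by rewrite mulr_ge0 ?divr_ge0 ?(ltW ej0)// sumr_ge0// => j' _; exact: sqr_ge0.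
    by have := ler_norm (cc j); lra.
  have := ccP i u Au; rewrite -/(X _); move: uK; rewrite /total_energy (bigD1 i)//=.
  have : - \sum_(j < d | j != i) `|cc j| <= \sum_(j < d | j != i) energy Omega (b j) (C j) (u j).
    by rewrite -sumrN; exact: ler_sum.
  have -> : S = `|cc i| + \sum_(j < d | j != i) `|cc j| by rewrite /S (bigD1 i).
  have := ler_norm (cc i).
  set y1 := \sum_(_ < _ | _) _; set y2 := \sum_(_ < _ | _) _.
  set y3 := e i / 4 * _; set y4 := energy _ _ _ _; clearbody y1 y2 y3 y4.
  by move=> h1 h2 h3 h4; lra.
have XB : \sum_(j < N) X j <= B1 i.
  apply: (@le_trans _ _ (\sum_(j < N) (1 + X j ^+ 2))).
    by apply: ler_sum => j _; have := sqr_ge0 (X j - 2^-1); nra.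
  rewrite big_split/= sumr_const card_ord /B1 lerD2l ler_pdivlMr//.
  by move: sX; set y := \sum_(_ < _) _; clearbody y; nra.
have B10 : 0 <= B1 i.
  by apply: le_trans XB; rewrite sumr_ge0// => j _; exact: nrm_ge0.
have po := poincare oO r0 Or N0 hv.
have po2 : r *+ 2 * \sum_(j < N) X j <= r *+ 2 * B1 i by rewrite ler_wpM2l.
have E z : (1 + r *+ 2) * z = z + r *+ 2 * z by rewrite mulrDl mul1r.
rewrite E; split; first by apply: le_trans po (le_trans po2 _); rewrite lerDr.
by apply: le_trans XB _; rewrite lerDl mulr_ge0.
Qed.

Lemma total_energy_lower_bound : exists K : R, forall u, A u -> - K <= total_energy u.
Proof.
have [cc ccP] := coercivity; exists (\sum_(i < d) cc i) => u Au.
rewrite -sumrN; apply: ler_sum => i _; apply: le_trans (ccP i u Au).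
have [_ [_ _ _ e0] _ _] := bP i.
rewrite -[X in X <= _]add0r lerD2r mulr_ge0 ?divr_ge0 ?(ltW e0)// sumr_ge0// => j _.
exact: sqr_ge0.
Qed.

(* Along a minimising sequence the gradient norms converge after extraction, and
   the limit has no larger gradient norms; the remaining terms are handled by
   strong L^2 convergence and Fatou's lemma. *)
Lemma lower_semicontinuity (us : nat -> 'I_d -> V -> R) (m : R) : (forall n, A (us n)) ->
  (forall eps : R, 0 < eps -> \forall n \near \oo, (functional (us n) <= (m + eps)%:E)%E) ->
  exists2 u, A u & (functional u <= m%:E)%E.
Proof.
move=> Aus usm.
have [n1 _ n1P] := usm 1 ltr01.
(* The first terms are dropped so that every term has functional at most m + 1. *)
pose us1 n := us (n + n1)%N.
have us1E n : total_energy (us1 n) <= `|m| + 1.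
  have := le_trans (total_energy_le_functional _) (n1P (n + n1)%N (leq_addl _ _)).
  by rewrite lee_fin => /le_trans; apply; rewrite lerD2r ler_norm.
have K0 : 0 <= `|m| + 1 by rewrite addr_ge0.
have [B BP] := bounded_of_energy K0.
have Aus1 n : A (us1 n) by exact: Aus.
pose v i n (x : V) : R := us1 n i x - psi i x.
have hv i n : H10 Omega (v i n) by exact: (AU (Aus1 n) i).2.
have [|s1 [w [ns1 wP]]] := rellich_vector hv.
  by move=> i; exists (B i) => n; exact: BP.
have hus n i : H1 Omega (us1 n i) by exact: (AU (Aus1 n) i).1.
have hw i : H10 Omega (w i).
  have [sw wc _] := wP i.
  apply: (H10_closed_H10 oO (M := fun=> B i) sw) => eps eps0.
  have /cvgrPdist_le/(_ _ eps0)[n0 _ n0P] := wc.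
  exists (v i (s1 n0)); split => //.
    by have := n0P n0 (leqnn _); rewrite sub0r normrN ger0_norm ?nrm_ge0.
  move=> j; have [_ h] := BP i _ (Aus1 (s1 n0)) (us1E _); apply: le_trans h.
  rewrite (bigD1 j)//= lerDl sumr_ge0// => j' _; exact: nrm_ge0.
pose U i x := psi i x + w i x.
have hU i : H1 Omega (U i) by have h := H1D oO (hpsi i) (H10_H1 (hw i)); exact: h.
have UU : U_class Omega psi U.
  move=> i; split => //; rewrite (_ : (fun x => _) = w i)//.
  by apply/funext => x; rewrite /U addrAC subrr add0r.
(* Only the norms of the partial derivatives, bounded real numbers, are made convergent; no weak
   limit of gradients is extracted. *)
pose a n (q : nat) : R := if unpickle q is Some (i, j) then
  nrmO (wpO (j : 'I_N) (us1 (s1 n) (i : 'I_d))) else 0.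
pose Ba (q : nat) : R := if unpickle q is Some (i, j) then
  B (i : 'I_d) + nrmO (wpO (j : 'I_N) (psi i)) else 0.
have aB n q : `|a n q| <= Ba q.
  rewrite /a /Ba; case: unpickle => [[i j]|]; last by rewrite normr0.
  rewrite ger0_norm ?nrm_ge0//.
  have uE : us1 (s1 n) i = fun x => v i (s1 n) x + psi i x.
    by apply/funext => x; rewrite /v subrK.
  rewrite uE (nrm_wpartialD oO j (H10_H1 (hv i (s1 n))) (hpsi i)).
  have [sg _] := H1_wpartial j (H10_H1 (hv i (s1 n))); have [sh _] := H1_wpartial j (hpsi i).
  have h1 := nrmD mO sg sh; apply: le_trans h1 _; rewrite lerD2r.
  have [_ h] := BP i _ (Aus1 (s1 n)) (us1E _); apply: le_trans h.
  rewrite (bigD1 j)//= lerDl sumr_ge0// => j' _; exact: nrm_ge0.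
have [s2 [s2i s2c]] := diagonal_extraction aB.
have ns2 := incr_ge s2i.
pose s n := s1 (s2 n).
pose l i j : R := limn (fun n => nrmO (wpO j (us1 (s n) i))).
have lc i j : nrmO (wpO j (us1 (s n) i)) @[n --> \oo] --> l i j.
  by have := s2c (pickle (i, j)); rewrite /a pickleK.
have Uc i : nrmO (fun x => us1 (s n) i x - U i x) @[n --> \oo] --> 0.
  have [_ wc _] := wP i; have := cvg_subseq ns2 wc.
  rewrite (_ : (fun n => _) = fun n => nrmO (fun x => us1 (s n) i x - U i x))//.
  apply/funext => n; congr (nrm _ _ _); apply/funext => x.
  by rewrite /v /U /s; ring.
have Uae i : ae_on Omega (fun x => us1 (s n) i x @[n --> \oo] --> U i x).
  have [_ _ wae] := wP i; apply: ae_on_mono wae => x _ h.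
  have h1 := cvg_subseq ns2 h.
  have h2 : (fun n => psi i x + v i (s n) x) @ \oo --> U i x.
    by apply: cvgD => //; exact: cvg_cst.
  move: h2; rewrite (_ : (fun n => _) = fun n => us1 (s n) i x)//.
  by apply/funext => n; rewrite /v addrC subrK.
have AUU : A U by exact: (Acl (fun n => Aus1 (s n)) UU Uae).
(* Terms far in the sequence have derivative norm at most l + eps and are L^2-close to U, as
   [weak_partial_closed] requires. *)
have Ul i j : nrmO (wpO j (U i)) <= l i j.
  have l0 : 0 <= l i j by apply: (cvgr_to_ge (lc i j)); apply: nearW => n; exact: nrm_ge0.
  apply/ler_addgt0Pr => eps eps0.
  have le0 : 0 <= l i j + eps by rewrite addr_ge0// ltW.
  have [dl dl0|g [sg gK Ug]] := weak_partial_closed oO (H1_sqO (hU i)) le0 (i := j).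
    have /cvgrPdist_le/(_ _ eps0) h1 := lc i j.
    have /cvgrPdist_le/(_ _ dl0) h2 := Uc i.
    have [n [h3 h4]] := filter_ex (filterI h1 h2).
    have [sg wg] := H1_wpartial j (hus (s n) i).
    exists (us1 (s n) i), (wpO j (us1 (s n) i)); split => //.
    - exact: H1_sqO (hus _ _).
    - by move: h3; rewrite distrC ler_norml => /andP[_ h3]; rewrite -lerBlDl.
    - by move: h4; rewrite sub0r normrN ger0_norm ?nrm_ge0.
  by rewrite (nrm_wpartial oO sg Ug).
pose E := \sum_(i < d) (2^-1 * \sum_(j < N) l i j ^+ 2 - potential Omega (b i) (C i) (U i)).
have UE : total_energy U <= E.
  apply: ler_sum => i _; rewrite /energy lerD2r ler_wpM2l ?invr_ge0// ler_sum// => j _.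
  by rewrite ler_pXn2r ?nnegrE ?nrm_ge0//; apply: le_trans (Ul i j); exact: nrm_ge0.
have Ec : total_energy (us1 (s n)) @[n --> \oo] --> E.
  apply: (@cvg_finite_sum R _ _ _ (fun i n => energy Omega (b i) (C i) (us1 (s n) i))) => i.
  have [mb [M0 bM C0 _] _ _] := bP i.
  apply: cvgB; last first.
    have h := potential_cvg oO bO (C := C i) mb M0 bM (fun n => H1_sqO (hus (s n) i)) (H1_sqO (hU i)) (Uc i).
    exact: h.
  apply: cvgM; first exact: cvg_cst.
  apply: (@cvg_finite_sum R _ _ _ (fun j n => nrmO (wpO j (us1 (s n) i)) ^+ 2)) => j.
  by under eq_fun do rewrite expr2; rewrite expr2; exact: cvgM.
exists U => //; apply/lee_addgt0Pr => eps eps0.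
have e2 : 0 < eps / 2 by rewrite divr_gt0.
(* Eventually the functional is at most m + eps/2 and the energy at least E - eps/2, so the residual
   integral is at most m + eps - E; Fatou's lemma passes this to U. *)
have ev : \forall n \near \oo,
    (\int[mu]_(x in Omega) (total_residual (us1 (s n)) x)%:E <= (m + eps - E)%:E)%E.
  have /cvgrPdist_le/(_ _ e2) h1 := Ec; have [n0 _ n0P] := usm _ e2.
  have h2 : \forall n \near \oo, (functional (us1 (s n)) <= (m + eps / 2)%:E)%E.
    exists n0; first exact: I.
    move=> n n0n; have le : (n0 <= s n + n1)%N.
      by apply: leq_trans n0n (leq_trans (ns2 n) (leq_trans (ns1 _) (leq_addr _ _))).
    have h2 := n0P _ le; exact: h2.
  apply: filterS2 h1 h2 => n; rewrite ler_norml => /andP[_ h1].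
  rewrite /functional; have := integral_total_residual_ge0 (us1 (s n)).
  (* The value +oo is excluded by the finite bound and -oo by nonnegativity. *)
  move: (integral _ _ _) => [y| |]//; rewrite -EFinD !lee_fin => _ h2.
  by move: h1 h2; set z := total_energy _; clearbody z; lra.
have mU : measurable_on Omega (total_residual U).
  by apply: measurable_total_residual => i; have [] := H1_sqO (hU i).
have mus n : measurable_on Omega (total_residual (us1 (s n))).
  by apply: measurable_total_residual => i; have [] := H1_sqO (hus (s n) i).
have rae : ae_on Omega (fun x => (forall n, 0 <= total_residual (us1 (s n)) x) /\
    total_residual (us1 (s n)) x @[n --> \oo] --> total_residual U x).
  apply: ae_on_mono (total_residual_cvg Uae) => x _ h; split => // n.
  exact: total_residual_ge0.
have fat := @ae_fatou _ (euclid R N) R mu Omega mO (fun n => total_residual (us1 (s n)))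
  (total_residual U) _ mus mU rae ev.
have hE : ((total_energy U)%:E <= E%:E)%E by rewrite lee_fin.
apply: le_trans (leeD hE fat) _.
by rewrite -EFinD -EFinD lee_fin addrC subrK.
Qed.

Lemma minimiser : exists u, [/\ A u, nonnegative Omega u &
  forall v, A v -> (functional u <= functional v)%E].
Proof.
have [K KP] := total_energy_lower_bound.
pose m := ereal_inf [set functional u | u in A].
have mle v : A v -> (m <= functional v)%E by move=> Av; apply: ereal_inf_lbound; exists v.
have Km : ((- K)%:E <= m)%E.
  apply: le_ereal_inf_tmp => _ [u Au <-].
  by apply: le_trans (total_energy_le_functional u); rewrite lee_fin; exact: KP.
(* If the infimum is +oo, every admissible function is a minimiser, and psi is a nonnegative one. *)
have [moo|mfin] := eqVneq m +oo%E.
  exists psi; split; first exact: Apsi.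
    by move=> i; apply: ae_on_true => x; exact: psi0.
  by move=> v Av; apply: le_trans (mle v Av); rewrite moo leey.
have mf : m \is a fin_num.
  rewrite fin_numE mfin andbT; apply/eqP => mn; by rewrite mn in Km.
have /choice[us usP] : forall n : nat, exists u, A u /\ (functional u <= m + (n.+1%:R^-1)%:E)%E.
  move=> n; have n1 : 0 < n.+1%:R^-1 :> R by rewrite invr_gt0.
  by have [_ [u Au <-] h] := lb_ereal_inf_adherent n1 mf; exists u; split => //; exact: ltW.
have [u Au um] : exists2 u, A u & (functional u <= (fine m)%:E)%E.
  apply: (@lower_semicontinuity us) => [n|eps eps0]; first by have [] := usP n.
  have [n0 n0P] := inv_natS_lt eps0; exists n0 => // n /= n0n.
  have [_ h] := usP n; apply: le_trans h _; rewrite -{1}(fineK mf) -EFinD lee_fin lerD2l.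
  by apply: ltW; apply: le_lt_trans n0P; rewrite lef_pV2 ?posrE// ler_nat.
exists (fun i x => `|u i x|); split; first exact: Aabs.
  by move=> i; apply: ae_on_true.
move=> v Av; apply: le_trans (functional_abs Au) (le_trans um _).
by rewrite fineK//; exact: mle.
Qed.

End vector_minimisation.

Section sum_of_integrals.
Context d (T : measurableType d) (R : realType).
Variables (mu : {measure set T -> \bar R}) (D : set T) (mD : measurable D).

Lemma integral_sum_ge0 (I : finType) (h : I -> T -> R) :
  (forall i, measurable_fun D (h i)) -> (forall i x, 0 <= h i x) ->
  (\int[mu]_(x in D) (\sum_i h i x)%:E = \sum_i \int[mu]_(x in D) (h i x)%:E)%E.
Proof.
move=> mh h0; under eq_integral do rewrite -sumEFin.
rewrite ge0_integral_sum//; first by move=> i; exact/measurable_EFinP.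
by move=> i x _; rewrite lee_fin.
Qed.

End sum_of_integrals.

Lemma sum_regroup (R : realFieldType) (I : finType) (u v w z : I -> R) (q : R) :
  (forall i, 2^-1 * u i - v i = w i + z i) ->
  2^-1 * (\sum_i u i) + q - \sum_i v i = \sum_i w i + (q + \sum_i z i).
Proof.
move=> h; have E : 2^-1 * (\sum_i u i) - \sum_i v i = \sum_i w i + \sum_i z i.
  by rewrite mulr_sumr -sumrB -big_split; apply: eq_bigr => i _; exact: h.
by rewrite addrAC E -addrA (addrC q).
Qed.

(** * Identification with the functionals of the statement *)

Section functionals.
Context (R : realType) (N d : nat).
Local Notation V := 'rV[R]_N.
Local Notation mu := (@lebesgue R N).
Variables (Omega : set V) (oO : open Omega) (bO : bounded_set Omega).
Variables (f : 'I_d -> V -> R -> R) (b : 'I_d -> V -> R) (M C e : 'I_d -> R).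
Hypotheses (cf : forall i, caratheodory_fun Omega (f i)).
Hypothesis bP : forall i, [/\ measurable_on Omega (b i),
    [/\ 0 <= M i, forall x, `|b i x| <= M i, 0 <= C i & 0 < e i],
    ae_on Omega (fun x => forall t, primitive (f i) x t <= b i x / 2 * t ^+ 2 + C i * `|t|) &
    forall v : V -> R, H10 Omega v ->
      e i * (\sum_(j < N) nrm mu Omega (wpartial Omega j v) ^+ 2) <=
      \sum_(j < N) nrm mu Omega (wpartial Omega j v) ^+ 2 - ip mu Omega v (fun x => b i x * v x)].
Variables (k : nat) (gamma : {set 'I_d} -> R).
Hypothesis gamma0 : forall J : {set 'I_d}, #|J| = k -> 0 <= gamma J.
Variables (u : 'I_d -> V -> R) (hu : forall i, H1 Omega (u i)).

Let mO : measurable (Omega : set (euclid R N)).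
Proof. exact: open_measurable_euclid. Qed.

Let mu_ i : measurable_on Omega (u i). Proof. by have [] := H1_sqO (hu i). Qed.

Let mF i : measurable_on Omega (fun x => primitive (f i) x (u i x)).
Proof. exact: measurable_primitive. Qed.

Let mg i : measurable_on Omega (grad_sq Omega (u i)).
Proof. by apply/measurable_EFinP; exact: measurable_int (grad_sq_integrable oO (hu i)). Qed.

Let ihE i : mu.-integrable Omega (EFin \o energy_density Omega (b i) (C i) (u i)) /\
  \int[mu]_(x in Omega) energy_density Omega (b i) (C i) (u i) x =
  energy Omega (b i) (C i) (u i).
Proof.
by have [mb [M0 bM _ _] _ _] := bP i; exact: (energy_densityP oO bO (C i) mb M0 bM (hu i)).
Qed.

Let split_ae i : ae_on Omega (fun x => 2^-1 * grad_sq Omega (u i) x - primitive (f i) x (u i x) =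
  energy_density Omega (b i) (C i) (u i) x + residual (f i) (b i) (C i) (u i) x).
Proof. by have [_ _ fb _] := bP i; exact: (energy_density_split fb). Qed.

Let mr i : measurable_on Omega (residual (f i) (b i) (C i) (u i)).
Proof. by have [mb _ _ _] := bP i; exact: (measurable_residual oO (cf i) (C i) mb (mu_ i)). Qed.

Let m0 (a : R) : measurable_fun (Omega : set (euclid R N)) (cst a).
Proof. exact: measurable_cst. Qed.

Lemma J_betaE (beta : R) : 0 <= beta ->
  J_beta Omega k gamma beta f u = functional Omega f b C k gamma (beta / 2) u.
Proof.
move=> beta0; have c0 : 0 <= beta / 2 by rewrite divr_ge0.
have [ih hE] := @Rintegral_sum _ (euclid R N) R mu Omega mO 'I_d (index_enum 'I_d) _
  (fun i => (ihE i).1).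
have sg := @measurable_sum _ (euclid R N) R Omega 'I_d (index_enum 'I_d) _ mg.
have sF := @measurable_sum _ (euclid R N) R Omega 'I_d (index_enum 'I_d) _ mF.
have mc := measurable_coupling k gamma (beta / 2) mu_.
have me := measurable_funB (measurable_funD (measurable_funM (m0 2^-1) sg) mc) sF.
have mres := measurable_total_residual oO cf bP k gamma (beta / 2) mu_.
have ae : ae_on Omega (fun x => 2^-1 * (\sum_(i < d) grad_sq Omega (u i) x) +
    coupling k gamma (beta / 2) (fun i => u i x) - \sum_(i < d) primitive (f i) x (u i x) =
    \sum_(i < d) energy_density Omega (b i) (C i) (u i) x +
    total_residual f b C k gamma (beta / 2) u x).
  apply: ae_on_mono (ae_on_forall split_ae) => x _ h; rewrite /total_residual.
  exact: sum_regroup.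
have key := @integral_split _ (euclid R N) R mu Omega mO _ _ _ me ih mres
  (fun x _ => total_residual_ge0 f b C c0 gamma0 u x) ae.
rewrite /functional /total_energy.
have -> : \sum_(i < d) energy Omega (b i) (C i) (u i) =
    \int[mu]_(x in Omega) \sum_(i < d) energy_density Omega (b i) (C i) (u i) x.
  by rewrite hE; apply: eq_bigr => i _; rewrite (ihE i).2.
exact: key.
Qed.

(** [J_infty] is a sum of separate integrals, so the splitting is done component by component and
    the residual integrals are then added, which nonnegativity allows. *)
Lemma J_inftyE : J_infty Omega f u = functional Omega f b C k gamma 0 u.
Proof.
have E i : (\int[mu]_(x in Omega)
      (2^-1 * grad_sq Omega (u i) x - primitive (f i) x (u i x))%:E =
    (energy Omega (b i) (C i) (u i))%:E +
    \int[mu]_(x in Omega) (residual (f i) (b i) (C i) (u i) x)%:E)%E.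
  have me := measurable_funB (measurable_funM (m0 2^-1) (mg i)) (mF i).
  have key := @integral_split _ (euclid R N) R mu Omega mO _ _ _ me (ihE i).1 (mr i)
    (fun x _ => residual_ge0 (f i) (b i) (C i) (u i) x) (split_ae i).
  by rewrite -(ihE i).2; exact: key.
rewrite /J_infty (eq_bigr _ (fun i _ => E i)) big_split sumEFin /functional /total_energy.
congr (_ + _)%E.
have key := @integral_sum_ge0 _ (euclid R N) R mu Omega mO 'I_d _ mr
  (fun i x => residual_ge0 (f i) (b i) (C i) (u i) x).
rewrite -key; apply: eq_integral => x _.
by rewrite /total_residual /coupling mul0r add0r.
Qed.

End functionals.

(* [q] packs the coefficient [b], its bound, and the constants [C] and [e] of (A2). *)
Definition A2_bound (R : realType) (N : nat) (Omega : set 'rV[R]_N)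
    (f : 'rV[R]_N -> R -> R) (q : ('rV[R]_N -> R) * R * R * R) : Prop :=
  [/\ measurable_on Omega q.1.1.1,
    [/\ 0 <= q.1.1.2, forall x, `|q.1.1.1 x| <= q.1.1.2, 0 <= q.1.2 & 0 < q.2],
    ae_on Omega (fun x => forall t,
      primitive f x t <= q.1.1.1 x / 2 * t ^+ 2 + q.1.2 * `|t|) &
    forall v, H10 Omega v ->
      q.2 * (\sum_(j < N) nrm (@lebesgue R N) Omega (wpartial Omega j v) ^+ 2) <=
      \sum_(j < N) nrm (@lebesgue R N) Omega (wpartial Omega j v) ^+ 2 -
      ip (@lebesgue R N) Omega v (fun x => q.1.1.1 x * v x)].

(** * Boundary data *)

Section boundary_data.
Context (R : realType) (N d : nat).
Local Notation V := 'rV[R]_N.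
Variables (Omega : set V) (oO : open Omega) (bO : bounded_set Omega).
Variables (psi : 'I_d -> V -> R).
Hypothesis psi_ge0 : forall i x, closure Omega x -> 0 <= psi i x.
Hypothesis psi_lip : forall i, [lipschitz psi i x | x in closure Omega].

Lemma lipschitz_constant i : exists2 L : R, 0 <= L &
  forall x y, Omega x -> Omega y -> `|psi i x - psi i y| <= L * `|x - y|.
Proof.
have [M [_ h]] := psi_lip i; exists (`|M| + 1); first by rewrite addr_ge0.
move=> x y Ox Oy; have Mlt : M < `|M| + 1 by rewrite (le_lt_trans (ler_norm M))// ltrDl.
by have := h _ Mlt (x, y); apply; split; exact: subset_closure.
Qed.

Lemma H1_psi i : H1 Omega (psi i).
Proof. by have [L L0 lip] := lipschitz_constant i; have h := H1_lipschitz oO bO L0 lip; exact: h. Qed.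

Lemma U_class_psi : U_class Omega psi psi.
Proof.
move=> i; split; first exact: H1_psi.
rewrite (_ : (fun x => _) = fun=> 0); last by apply/funext => x; rewrite subrr.
exact: (H10_test oO (test0 Omega)).
Qed.

Lemma U_class_abs u : U_class Omega psi u -> U_class Omega psi (fun i x => `|u i x|).
Proof.
move=> Uu i; have [hu hv] := Uu i; split; first by have [] := H1_abs oO hu.
have [L L0 lip] := lipschitz_constant i.
apply: (H10_abs oO bO L0 lip) => // x Ox.
by apply: psi_ge0; exact: subset_closure.
Qed.

End boundary_data.

Theorem proposition1p10 (R : realType) (N k d : nat)
    (hN : (2 <= N)%N) (hk : (3 <= k)%N) (hkd : (k <= d)%N)
    (gamma : {set 'I_d} -> R)
    (hgamma : forall L : {set 'I_d}, #|L| = k -> 0 < gamma L)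
    (Omega : set 'rV[R]_N)
    (hOmega : bounded_domain Omega) (hboundary : C1_boundary Omega)
    (psi : 'I_d -> 'rV[R]_N -> R)
    (hpsi_ge0 : forall i x, closure Omega x -> 0 <= psi i x)
    (hpsi_lip : forall i, [lipschitz psi i x | x in closure Omega])
    (hpsi_prod : forall J : {set 'I_d}, #|J| = k ->
       forall x, closure Omega x -> \prod_(j in J) psi j x = 0) :
  (forall (beta : R) (f : 'I_d -> 'rV[R]_N -> R -> R),
     0 < beta ->
     (forall i, [/\ caratheodory_fun Omega (f i), condG Omega (f i),
                    condA1 Omega (f i) & condA2 Omega (f i)]) ->
     exists u, [/\ U_class Omega psi u, nonnegative Omega u &
       J_beta Omega k gamma beta f u =
       ereal_inf [set J_beta Omega k gamma beta f v | v in U_class Omega psi]])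
  /\
  (forall f : 'I_d -> 'rV[R]_N -> R -> R,
     (forall i, [/\ caratheodory_fun Omega (f i), condG Omega (f i),
                    condA1 Omega (f i) & condA2 Omega (f i)]) ->
     exists u, [/\ H_class Omega k psi u, nonnegative Omega u &
       J_infty Omega f u =
       ereal_inf [set J_infty Omega f v | v in H_class Omega k psi]]).
Proof.
have [oO _ _ bO] := hOmega.
have N0 : (0 < N)%N by exact: leq_trans hN.
have psi0 i x : Omega x -> 0 <= psi i x by move=> Ox; apply: hpsi_ge0; exact: subset_closure.
have hpsi := H1_psi oO bO hpsi_lip.
have gamma0 (J : {set 'I_d}) : #|J| = k -> 0 <= gamma J by move=> /hgamma /ltW.
have Upsi := U_class_psi oO bO hpsi_lip.
have Uabs u := @U_class_abs R N d Omega oO bO psi hpsi_ge0 hpsi_lip u.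
have prep (f : 'I_d -> 'rV[R]_N -> R -> R) :
    (forall i, [/\ caratheodory_fun Omega (f i), condG Omega (f i),
                   condA1 Omega (f i) & condA2 Omega (f i)]) ->
    exists q, forall i, A2_bound Omega (f i) (q i).
  move=> hf; have /choice[q qP] : forall i, exists q, A2_bound Omega (f i) q.
    move=> i; have [_ _ a1 a2] := hf i.
    by have [b [M [C [e h]]]] := condA2_bounded oO a1 a2; exists (b, M, C, e).
  by exists q.
split=> [beta f beta0 hf|f hf].
  have [q qP] := prep f hf.
  have cf i : caratheodory_fun Omega (f i) by have [] := hf i.
  have A1 i : condA1 Omega (f i) by have [] := hf i.
  have c0 : 0 <= beta / 2 by rewrite divr_ge0// ltW.
  have [u [Uu nu umin]] := @minimiser R N d Omega oO bO N0 f (fun i => (q i).1.1.1)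
    (fun i => (q i).1.1.2) (fun i => (q i).1.2) (fun i => (q i).2) cf A1 qP k gamma _ c0 gamma0 psi hpsi psi0 _ Upsi
    (fun u h => h) Uabs (fun us u _ Uu _ => Uu).
  exists u; split => //.
  have JE v : U_class Omega psi v -> J_beta Omega k gamma beta f v =
      functional Omega f (fun i => (q i).1.1.1) (fun i => (q i).1.2) k gamma (beta / 2) v.
    by move=> Uv; exact: (J_betaE oO bO cf qP gamma0 (fun i => (Uv i).1) (ltW beta0)).
  apply/eqP; rewrite eq_le; apply/andP; split; last by apply: ereal_inf_lbound; exists u.
  by apply: le_ereal_inf_tmp => _ [v Uv <-]; rewrite (JE u Uu) (JE v Uv); exact: umin v Uv.
have [q qP] := prep f hf.
have cf i : caratheodory_fun Omega (f i) by have [] := hf i.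
have A1 i : condA1 Omega (f i) by have [] := hf i.
have Hpsi : H_class Omega k psi psi.
  split => // J cJ; apply: ae_on_true => x Ox; apply: hpsi_prod => //.
  exact: subset_closure.
have Habs u : H_class Omega k psi u -> H_class Omega k psi (fun i x => `|u i x|).
  move=> [Uu pu]; split; first exact: Uabs.
  by move=> J /pu; apply: ae_on_mono => x _ h; rewrite -normr_prod h normr0.
(* Countably many exceptional sets are merged, so that at almost every point the product vanishes
   for all n while every component converges. *)
have Hcl (us : nat -> 'I_d -> 'rV[R]_N -> R) u : (forall n, H_class Omega k psi (us n)) ->
    U_class Omega psi u ->
    (forall i, ae_on Omega (fun x => us n i x @[n --> \oo] --> u i x)) -> H_class Omega k psi u.
  move=> Hus Uu cu; split => // J cJ.
  have h : ae_on Omega (fun x => forall n, \prod_(j in J) us n j x = 0).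
    by apply: ae_on_forall => n; have [_] := Hus n; apply.
  apply: ae_on2 h (ae_on_forall cu) => x _ p0 cx.
  have := @cvg_finite_prod R _ (index_enum 'I_d) (mem J) (fun j n => us n j x) _ cx.
  by under eq_fun do rewrite p0; move/cst_cvg_eq.
have [u [Hu nu umin]] := @minimiser R N d Omega oO bO N0 f (fun i => (q i).1.1.1)
    (fun i => (q i).1.1.2) (fun i => (q i).1.2) (fun i => (q i).2) cf A1 qP k gamma _ (lexx 0) gamma0 psi hpsi psi0 _ Hpsi
  (fun u h => h.1) Habs Hcl.
exists u; split => //.
have JE v : H_class Omega k psi v -> J_infty Omega f v =
    functional Omega f (fun i => (q i).1.1.1) (fun i => (q i).1.2) k gamma 0 v.
  by move=> Hv; exact: (J_inftyE oO bO cf qP k gamma (fun i => (Hv.1 i).1)).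
apply/eqP; rewrite eq_le; apply/andP; split; last by apply: ereal_inf_lbound; exists u.
by apply: le_ereal_inf_tmp => _ [v Hv <-]; rewrite (JE u Hu) (JE v Hv); exact: umin v Hv.
Qed.
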